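(* Let $m>3$ and set $\alpha=\frac{m-3}{m-1}$. Then the inclusion $\mathrm{Def}_m\subset\mathcal M_\alpha(\mathbb T)$ is strict. More precisely, there exist a closed null set $E\subset\mathbb T$ and a nonatomic probability measure $\mu$ supported on $E$ such that $$\sum_{J\subset\mathbb T\setminus E}|J|^\alpha<\infty,$$ where the sum is over the complementary arcs $J$ of $E$ (the connected components of $\mathbb T\setminus E$), but $\mu\notin\mathrm{Def}_m$.
   Context: $\mathbb D$ is the open unit disk and $\mathbb T=\partial\mathbb D$; $|J|$ is normalized arc length ($|\mathbb T|=1$), while $|d\xi|$ is the unnormalized arc length element (total mass $2\pi$); $t_+=\max\{t,0\}$. For $0<\eta<1$, an $\eta$-Beurling--Carleson set is a closed Lebesgue-null set $E\subset\mathbb T$ with $\sum_{J}|J|^\eta<\infty$, the sum being over the complementary arcs of $E$. $\mathcal M_\eta(\mathbb T)$ is the class of finite positive measures on $\mathbb T$ that are concentrated on a countable union of $\eta$-Beurling--Carleson sets. For $m>3$ consider real-valued solutions of $\Delta u=(u_+)^m$ in $\mathbb D$ (by elliptic regularity these may be taken to be $C^2$). Let $U$ be the maximal solution, i.e. the solution such that $u\le U$ for every solution $u$ (it exists and is positive, by Keller--Osserman theory). A solution $u$ is nearly maximal if $$\limsup_{r\to1^-}\int_{\mathbb T}(U-u)(r\xi)\,|d\xi|<\infty.$$ For a nearly maximal $u$, the measures $(U-u)(r\xi)\,|d\xi|$ on $\mathbb T$ have a weak-* limit $\mu[u]$ as $r\to1^-$, called the deficiency measure of $u$. $\mathrm{Def}_m$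 is the class of all deficiency measures of nearly maximal solutions. The inclusion $\mathrm{Def}_m\subset\mathcal M_\alpha(\mathbb T)$ is a known theorem of Ivrii and Nicolau. *)

(* Defs.v *)
From HB Require Import structures.
From mathcomp Require Import all_boot all_order all_algebra.
From mathcomp Require Import all_classical all_reals all_analysis.

Set Implicit Arguments.
Unset Strict Implicit.
Unset Printing Implicit Defensive.

Import Order.TTheory GRing.Theory Num.Theory.
Import numFieldNormedType.Exports.

Local Open Scope classical_set_scope.
Local Open Scope ring_scope.

(* The complex plane is [R * R].  Finite Borel measures on the unit circle are
   represented by the finite Borel measures on the plane that vanish off it;
   the product sigma-algebra on [R * R] is the Borel one. *)

Section Deficiency.
Variable R : realType.

Definition disk : set (R * R) := [set z | z.1 ^+ 2 + z.2 ^+ 2 < 1].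

Definition circle : set (R * R) := [set z | z.1 ^+ 2 + z.2 ^+ 2 = 1].

(* r e^{it} *)
Definition polar (r t : R) : R * R := (r * cos t, r * sin t).

(* Arc length normalized so that the circle has length 1. *)
Definition arc_length (A : set (R * R)) : R :=
  fine (lebesgue_measure [set t : R | 0 <= t < 2 * pi /\ A (polar 1 t)])
    / (2 * pi).

Definition complementary_arcs (E : set (R * R)) : set (set (R * R)) :=
  [set connected_component (circle `\` E) z | z in circle `\` E].

Definition beurling_carleson (eta : R) (E : set (R * R)) : Prop :=
  [/\ closed E, E `<=` circle, arc_length E = 0
    & (\esum_(J in complementary_arcs E) (arc_length J `^ eta)%:E < +oo)%E].

Definition carried_by (mu : set (R * R) -> \bar R) (A : set (R * R)) : Prop :=
  mu (~` A) = 0%E.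

Definition nonatomic (mu : set (R * R) -> \bar R) : Prop :=
  forall z : R * R, mu [set z] = 0%E.

Definition BC_measures (eta : R) :
    set {finite_measure set (R * R)%type -> \bar R} :=
  [set mu | carried_by mu circle /\
    exists F : (set (R * R))^nat,
      (forall n, beurling_carleson eta (F n)) /\
      carried_by mu (\bigcup_n F n)].

Definition e1 : R * R := (1, 0).
Definition e2 : R * R := (0, 1).

(* C^k regularity on [A], meant for open [A]. *)
Fixpoint Ck_on (k : nat) (A : set (R * R)) (u : R * R -> R) : Prop :=
  (forall z, A z -> {for z, continuous u}) /\
  if k is k'.+1 then
    forall v, v = e1 \/ v = e2 ->
      (forall z, A z -> derivable u z v) /\ Ck_on k' A ('D_v u)
  else True.

Definition laplacian (u : R * R -> R) (z : R * R) : R :=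
  'D_e1 ('D_e1 u) z + 'D_e2 ('D_e2 u) z.

(* A function on the disk is represented by any extension to the plane. *)
Definition solution (m : R) (u : R * R -> R) : Prop :=
  Ck_on 2 disk u /\
  forall z, disk z -> laplacian u z = Num.max (u z) 0 `^ m.

Definition maximal_solution (m : R) (U : R * R -> R) : Prop :=
  solution m U /\
  forall u, solution m u -> forall z, disk z -> u z <= U z.

(* The integral of f(r xi) phi(xi) |d xi| over the circle. *)
Definition circle_integral (f phi : R * R -> R) (r : R) : \bar R :=
  (\int[lebesgue_measure]_(t in `[0%R, (2 * pi)%R])
     (phi (polar 1 t) * f (polar r t))%:E)%E.

Definition nearly_maximal (m : R) (U u : R * R -> R) : Prop :=
  solution m u /\
  (limf_esup (circle_integral (U \- u)%R (cst 1%R)) 1^'- < +oo)%E.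

(* mu is the weak-* limit of (U - u)(r xi) |d xi| as r -> 1^-. *)
Definition deficiency_measure (U u : R * R -> R)
    (mu : {finite_measure set (R * R)%type -> \bar R}) : Prop :=
  carried_by mu circle /\
  forall phi : R * R -> R, {within circle, continuous phi} ->
    circle_integral (U \- u) phi r @[r --> 1^'-]
      --> (\int[mu]_(xi in circle) (phi xi)%:E)%E.

(* Maximal solutions coincide on the disk, so the choice of [U] is immaterial. *)
Definition Def (m : R) : set {finite_measure set (R * R)%type -> \bar R} :=
  [set mu | exists U u : R * R -> R,
    [/\ maximal_solution m U, nearly_maximal m U u
      & deficiency_measure U u mu]].

End Deficiency.

Arguments disk {R}.
Arguments circle {R}.

(* Main.v *)
Require Import Defs.
From HB Require Import structures.
From mathcomp Require Import all_boot all_order all_algebra.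
From mathcomp Require Import all_classical all_reals all_analysis.
From mathcomp Require Import measurable_realfun.
From mathcomp Require Import ring lra.

Set Implicit Arguments.
Unset Strict Implicit.
Unset Printing Implicit Defensive.

Import Order.TTheory GRing.Theory Num.Theory.
Import numFieldNormedType.Exports.

Local Open Scope classical_set_scope.
Local Open Scope ring_scope.

(** Why the theorem is true.  Put kappa = 2 / (m - 1) = 1 - alpha, let [U] be
the maximal solution, [u] another solution and w = U - u >= 0.  In the
coordinates z = exp (- y + i x) the function w becomes W (x, y), of period
2 pi in x, and y = 0 is the circle.

Absorption.  The functions A s^(- kappa), where s is the distance to a tangent
line of the circle, are solutions, so U >= A (1 - |z|)^(- kappa)
([maximal_ge]).  Convexity of t^m then gives
      lap W >= c0 y^(-2) min (W, y^(- kappa))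
([diff_lap_lower]).  Hence W loses a fixed proportion of itself over each
dyadic range of heights, wherever W is at most a multiple of y^(- kappa).

Bounded budget.  The flux F (y), the integral over x of y W_y - W, has
derivative the integral of y lap W, so it is nondecreasing; if the mass, the
integral of W over x, tends to 1 at the boundary, then F >= -2 ([flux_ge]).
The absorption near the boundary is therefore finite.

One stage.  Let n be large and a small, and suppose that W <= K y^(- kappa)
for y comparable with a / n, except near the angles where cos (n x) = 1.  The
mass, which stays above 1 / 2, must then squeeze through the neighbourhoods of
n equidistant points, and this costs at least c a of flux between the heights
a / (2 n) and 18 / n ([stage]).  This is Green's identity against an explicit
test function, and it is linear in a.  If stages with disjoint ranges of
heights have weights a_k with a divergent sum, the flux is exhausted: no such
W exists ([stages_absurd]).

The example.  With a_k = 1 / (20 (k + 1)), take a Cantor set whose level k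
consists of N_k short intervals at points of the lattice of step 2 pi / n_k,
where N_k is comparable with n_k^alpha a_k^(2 - alpha), and its natural
probability measure mu.  A gap created at level k has length at most
2 pi / n_k, so the sum of |J|^alpha is controlled by the sum of
N_k n_k^(- alpha), that is, of a_k^(2 - alpha), which converges because
2 - alpha > 1 ([arcs_summable]).  On the other hand w is subharmonic, so W is
at most a multiple of the Poisson integral of mu, up to O (y)
([poisson_bound]); at height comparable with a_k / n_k and away from the
lattice that integral is at most a multiple of y n_k^2 / N_k, hence of
y^(- kappa) ([kern_integral], [scale_bound]).  Every level k >= 1 is a stage, and the
sum of the a_k diverges, so mu is not a deficiency measure
([not_deficiency]). *)

(** * One-variable calculus and integrals over a period *)

Section Calculus.
Variable R : realType.
Implicit Types (f g : R -> R) (x a b c : R).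

(** These differentiation rules are pointwise statements with explicit values, so
that the derivative of a formula is assembled as a term and then compared with
the wanted value by [dv_eq]. *)
Lemma dvD f g x a b : is_derive x 1 f a -> is_derive x 1 g b ->
  is_derive x 1 (fun t => f t + g t) (a + b).
Proof. exact: is_deriveD. Qed.

Lemma dvB f g x a b : is_derive x 1 f a -> is_derive x 1 g b ->
  is_derive x 1 (fun t => f t - g t) (a - b).
Proof. exact: is_deriveB. Qed.

Lemma dvN f x a : is_derive x 1 f a -> is_derive x 1 (fun t => - f t) (- a).
Proof. exact: is_deriveN. Qed.

Lemma dvM f g x a b : is_derive x 1 f a -> is_derive x 1 g b ->
  is_derive x 1 (fun t => f t * g t) (f x * b + a * g x).
Proof.
by move=> h1 h2; apply: is_derive_eq; rewrite /GRing.scale /= (mulrC a).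
Qed.

Lemma dvc x c : is_derive x 1 (fun=> c) 0.
Proof. exact: is_derive_cst. Qed.

Lemma dvid x : is_derive x 1 (fun t : R => t) 1.
Proof. exact: is_derive_id. Qed.

Lemma dvcomp f g x a b : is_derive (g x) 1 f a -> is_derive x 1 g b ->
  is_derive x 1 (fun t => f (g t)) (a * b).
Proof. exact: is_derive1_comp. Qed.

Lemma dvX f n x a : is_derive x 1 f a ->
  is_derive x 1 (fun t => f t ^+ n) (n%:R * f x ^+ n.-1 * a).
Proof.
move=> h; rewrite (_ : (fun t => f t ^+ n) = f ^+ n); last first.
  by apply/funext => t; rewrite fctE.
by apply: is_derive_eq; rewrite /GRing.scale.
Qed.

Lemma dv_exp f x a : is_derive x 1 f a ->
  is_derive x 1 (fun t => expR (f t)) (expR (f x) * a).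
Proof. by move=> h; apply: (@dvcomp expR). Qed.

Lemma dv_cos f x a : is_derive x 1 f a ->
  is_derive x 1 (fun t => cos (f t)) (- sin (f x) * a).
Proof. by move=> h; apply: (@dvcomp cos). Qed.

Lemma dv_sin f x a : is_derive x 1 f a ->
  is_derive x 1 (fun t => sin (f t)) (cos (f x) * a).
Proof. by move=> h; apply: (@dvcomp sin). Qed.

Lemma dv_cont f x a : is_derive x 1 f a -> {for x, continuous f}.
Proof.
by move=> h; apply: differentiable_continuous; apply/derivable1_diffP; case: h.
Qed.

Lemma dv_eq f x a b : is_derive x 1 f a -> a = b -> is_derive x 1 f b.
Proof. by move=> h <-. Qed.

Lemma MVT_dv f (df : R -> R) a b : a <= b ->
  (forall x, a <= x <= b -> is_derive x 1 f (df x)) ->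
  exists2 c, a <= c <= b & f b - f a = df c * (b - a).
Proof.
move=> ab hd.
have [c] : exists2 c, c \in `[a, b] & f b - f a = df c * (b - a).
  apply: MVT_segment => //.
    by move=> x; rewrite in_itv /= => /andP[h3 h4]; apply: hd; rewrite !ltW.
  apply: continuous_in_subspaceT => x; rewrite inE /= in_itv /= => xab.
  exact: dv_cont (hd _ xab).
by rewrite in_itv /=; exists c.
Qed.

(** The mean value theorem; all monotonicity in the height goes through it. *)
Lemma le_of_dv f (df : R -> R) a b : a <= b ->
  (forall x, a <= x <= b -> is_derive x 1 f (df x)) ->
  (forall x, a <= x <= b -> 0 <= df x) -> f a <= f b.
Proof.
move=> ab h1 h2; have [c cab e] := MVT_dv ab h1.
by rewrite -subr_ge0 e mulr_ge0 ?subr_ge0 // h2.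
Qed.

End Calculus.

Definition xint {R : realType} (f : R -> R) : R :=
  \int[lebesgue_measure]_(x in `[0%R, (2 * pi)%R]) f x.

Section Xint.
Variable R : realType.
Implicit Types (f g : R -> R) (a b c : R).

Let T := (2 * pi : R).
Let T0 : 0 < T. Proof. by rewrite mulr_gt0 // pi_gt0. Qed.

Lemma xintegrable f : continuous f ->
  lebesgue_measure.-integrable `[0%R, T] (EFin \o f).
Proof.
move=> cf; apply: continuous_compact_integrable; first exact: segment_compact.
exact: continuous_subspaceT.
Qed.

Lemma xintD f g : continuous f -> continuous g ->
  xint (fun x => f x + g x) = xint f + xint g.
Proof. by move=> cf cg; apply: RintegralD => //; exact: xintegrable. Qed.

Lemma xintB f g : continuous f -> continuous g ->
  xint (fun x => f x - g x) = xint f - xint g.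
Proof. by move=> cf cg; apply: RintegralB => //; exact: xintegrable. Qed.

Lemma xintZ c f : continuous f -> xint (fun x => c * f x) = c * xint f.
Proof. by move=> cf; apply: RintegralZl => //; exact: xintegrable. Qed.

Lemma xint_ge0 f : (forall x, 0 <= x <= T -> 0 <= f x) -> 0 <= xint f.
Proof.
by move=> h; apply: Rintegral_ge0 => x; rewrite /= in_itv => /h.
Qed.

Lemma le_xint f g : continuous f -> continuous g ->
  (forall x, 0 <= x <= T -> f x <= g x) -> xint f <= xint g.
Proof.
move=> cf cg h; apply: le_Rintegral => //; try exact: xintegrable.
Qed.

Lemma xint_cst c : xint (fun=> c) = c * T.
Proof.
rewrite /xint Rintegral_cst //= lebesgue_measure_itv /= lte_fin T0 /=.
by rewrite subr0.
Qed.

Lemma xint_period f (df : R -> R) : continuous df ->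
  (forall x : R, is_derive x 1 f (df x)) -> f 0 = f T -> xint df = 0.
Proof.
move=> cdf hf e; rewrite /xint /Rintegral.
rewrite (@continuous_FTC2 _ _ f)//=; first by rewrite e subrr.
- exact: continuous_subspaceT.
- split.
  + by move=> x _; case: (hf x).
  + by apply: cvg_at_right_filter; exact: dv_cont (hf 0).
  + by apply: cvg_at_left_filter; exact: dv_cont (hf T).
- by move=> x _; rewrite derive1E; case: (hf x).
Qed.

(** Joint continuity is required at the points of height above [c] only: the
functions that matter blow up, or are not defined, at the boundary. *)
Definition jcont (c : R) (F : R -> R -> R) :=
  forall x y : R, c < y -> F z.1 z.2 @[z --> (x, y)] --> F x y.

Lemma jcontx c F y : jcont c F -> c < y -> continuous (fun x => F x y).
Proof.
move=> h cy x.
exact: (continuous2_cvg _ (h x y cy) (@cvg_id _ _) (cvg_cst _)).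
Qed.

Lemma jcont_bounded c F a b : jcont c F -> c < a ->
  exists2 K, 0 <= K & forall x y, 0 <= x <= T -> a <= y <= b -> `|F x y| <= K.
Proof.
move=> h ca.
have cK : compact (`[0, T]%classic `*` `[a, b]%classic : set (R * R)).
  by apply: compact_setX; exact: segment_compact.
have := @continuous_compact _ _ (fun z : R * R => F z.1 z.2) _ _ cK.
have cF : {within `[0, T]%classic `*` `[a, b]%classic,
   continuous (fun z : R * R => F z.1 z.2)}.
  apply: continuous_in_subspaceT => -[x y]; rewrite inE /= => -[_ /=].
  rewrite in_itv => /andP[ay _]; apply: h.
  exact: lt_le_trans ay.
move=> /(_ cF) /compact_bounded [M [_ hM]].
exists (Num.max (M + 1) 0); first by rewrite le_max lexx orbT.
move=> x y hx hy; rewrite le_max (hM (M + 1)) ?ltrDl//.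
by exists (x, y) => //=; split; rewrite /= in_itv.
Qed.

(** A dominating constant for the differentiation under the integral sign is a
bound of [gy] on a compact rectangle around height [y]. *)
Lemma dv_xint c (g gy : R -> R -> R) y : c < y ->
  (forall x y : R, c < y -> is_derive y 1 (g x) (gy x y)) ->
  jcont c g -> jcont c gy ->
  is_derive y 1 (fun y => xint (fun x => g x y)) (xint (fun x => gy x y)).
Proof.
move=> cy dg cg cgy.
pose u := (c + y) / 2; pose v := y + 1.
have cu : c < u by rewrite /u; lra.
have uy : u < y by rewrite /u; lra.
have [K K0 hK] := @jcont_bounded c gy u v cgy cu.
have I : `]u, v[%classic y by rewrite /= in_itv /= uy /v ltrDl ltr01.
have i1 z : `]u, v[%classic z ->
    lebesgue_measure.-integrable `[0%R, T] (EFin \o (fun x => g x z)).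
  rewrite /= in_itv /= => /andP[uz _]; apply: xintegrable.
  exact: jcontx cg (lt_trans cu uz).
have i2 z x : `]u, v[%classic z -> `[0%R, T]%classic x ->
   derivable (fun z => g x z) z 1.
  rewrite /= in_itv /= => /andP[uz _] _.
  by case: (dg x z (lt_trans cu uz)).
have i3 : lebesgue_measure.-integrable `[0%R, T] (EFin \o (fun=> K)).
  by apply: xintegrable => x; exact: cvg_cst.
have e1 z x : c < z -> partial1of2 (fun z x => g x z) z x = gy x z.
  by move=> cz; rewrite partial1of2E; case: (dg x z cz).
have i4 z x : `]u, v[%classic z -> `[0%R, T]%classic x ->
   `|partial1of2 (fun z x => g x z) z x| <= K.
  rewrite /= in_itv /= => /andP[uz zv]; rewrite in_itv /= => hx.
  by rewrite e1 ?(lt_trans cu uz)//; apply: hK => //; rewrite !ltW.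
have mB : measurable (`[0%R, T]%classic : set R) by [].
have K0' (x : R) : 0 <= K by [].
apply: DeriveDef.
  exact: (@derivable_under_integral _ _ _ lebesgue_measure
     (fun z x => g x z) _ mB y u v I i1 i2 _ K0' i3 i4).
rewrite -derive1E.
rewrite (@differentiation_under_integral _ _ _ lebesgue_measure
     (fun z x => g x z) _ mB y u v I i1 i2 _ K0' i3 i4).
by apply: eq_Rintegral => x _; rewrite e1.
Qed.

End Xint.

(** * Functions on the half-cylinder and Green's identity *)

(** A function of (x, y) together with candidates for its derivatives; [C2] says
that they are its derivatives.  Carrying the candidates along makes the
Laplacian of a composite test function a matter of [ring]. *)
Record jet (R : realType) := Jet {
  j0 : R -> R -> R;
  jx : R -> R -> R;
  jy : R -> R -> R;
  jxx : R -> R -> R;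
  jyy : R -> R -> R }.

Section Jets.
Variable R : realType.
Implicit Types (c : R) (F G : jet R).

Lemma jcontD c (f g : R -> R -> R) : jcont c f -> jcont c g ->
  jcont c (fun x y => f x y + g x y).
Proof. by move=> hf hg x y cy; apply: cvgD; [exact: hf | exact: hg]. Qed.

Lemma jcontN c (f : R -> R -> R) : jcont c f -> jcont c (fun x y => - f x y).
Proof. by move=> hf x y cy; apply: cvgN; exact: hf. Qed.

Lemma jcontM c (f g : R -> R -> R) : jcont c f -> jcont c g ->
  jcont c (fun x y => f x y * g x y).
Proof. by move=> hf hg x y cy; apply: cvgM; [exact: hf | exact: hg]. Qed.

Lemma jcont_cst c (k : R) : jcont c (fun _ _ => k).
Proof. by move=> x y cy; exact: cvg_cst. Qed.

Lemma jcont_x c : jcont c (fun x _ => x).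
Proof. by move=> x y cy; exact: cvg_fst. Qed.

Lemma jcont_y c : jcont c (fun _ y => y).
Proof. by move=> x y cy; exact: cvg_snd. Qed.

Lemma jcont_comp c (f : R -> R -> R) (h : R -> R) : jcont c f ->
  (forall x y, c < y -> {for f x y, continuous h}) ->
  jcont c (fun x y => h (f x y)).
Proof.
move=> hf hh x y cy; apply: (@continuous_cvg _ _ _ _ _ (fun z => f z.1 z.2) h).
  exact: hh.
exact: hf.
Qed.

Lemma jcont_exp c (f : R -> R -> R) : jcont c f -> jcont c (fun x y => expR (f x y)).
Proof. by move=> h; apply: (jcont_comp h) => *; exact: continuous_expR. Qed.

Lemma jcont_cos c (f : R -> R -> R) : jcont c f -> jcont c (fun x y => cos (f x y)).
Proof. by move=> h; apply: (jcont_comp h) => *; exact: continuous_cos. Qed.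

Lemma jcont_sin c (f : R -> R -> R) : jcont c f -> jcont c (fun x y => sin (f x y)).
Proof. by move=> h; apply: (jcont_comp h) => *; exact: continuous_sin. Qed.

Definition lap F x y := jxx F x y + jyy F x y.
Definition grad2 F x y := jx F x y ^+ 2 + jy F x y ^+ 2.

Record C2 c F : Prop := MkC2 {
  C2_x : forall x y : R, c < y -> is_derive x 1 (fun t => j0 F t y) (jx F x y);
  C2_y : forall x y : R, c < y -> is_derive y 1 (fun t => j0 F x t) (jy F x y);
  C2_xx : forall x y : R, c < y -> is_derive x 1 (fun t => jx F t y) (jxx F x y);
  C2_yy : forall x y : R, c < y -> is_derive y 1 (fun t => jy F x t) (jyy F x y);
  C2_c0 : jcont c (j0 F);
  C2_cx : jcont c (jx F);
  C2_cy : jcont c (jy F);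
  C2_cxx : jcont c (jxx F);
  C2_cyy : jcont c (jyy F) }.

(** Agreement at the two ends of the period is all that integration by parts in x
uses. *)
Definition periodic F :=
  forall y, j0 F 0 y = j0 F (2 * pi) y /\ jx F 0 y = jx F (2 * pi) y.

Lemma jcont_lap c F : C2 c F -> jcont c (lap F).
Proof. by case=> *; exact: jcontD. Qed.

Lemma jcont_le c c' (f : R -> R -> R) : c <= c' -> jcont c f -> jcont c' f.
Proof. by move=> cc h x y cy; apply: h; exact: le_lt_trans cy. Qed.

Lemma C2_le c c' F : c <= c' -> C2 c F -> C2 c' F.
Proof.
move=> cc [*]; have cc' y : c' < y -> c < y by exact: le_lt_trans.
by split; auto; exact: jcont_le cc _.
Qed.

(** The boundary term of Green's identity on the circle at height [y]. *)
Definition bdry F G y :=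
  xint (fun x => j0 F x y * jy G x y - j0 G x y * jy F x y).

(** The x-derivatives form an exact derivative and integrate to zero over a
period. *)
Lemma green c F G y : C2 c F -> C2 c G -> periodic F -> periodic G -> c < y ->
  is_derive y 1 (bdry F G)
    (xint (fun x => j0 F x y * lap G x y - j0 G x y * lap F x y)).
Proof.
move=> hF hG pF pG cy.
pose g x y := j0 F x y * jy G x y - j0 G x y * jy F x y.
pose gy x y := j0 F x y * jyy G x y + jy F x y * jy G x y -
  (j0 G x y * jyy F x y + jy G x y * jy F x y).
have [? ? ? ? cF _ cFy cFxx cFyy] := hF; have [? ? ? ? cG _ cGy cGxx cGyy] := hG.
have cg : jcont c g := jcontD (jcontM cF cGy) (jcontN (jcontM cG cFy)).
have cgy : jcont c gy := jcontD (jcontD (jcontM cF cGyy) (jcontM cFy cGy))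
  (jcontN (jcontD (jcontM cG cFyy) (jcontM cGy cFy))).
have cxx : jcont c (fun x y => j0 F x y * jxx G x y - j0 G x y * jxx F x y) :=
  jcontD (jcontM cF cGxx) (jcontN (jcontM cG cFxx)).
have dg x y' : c < y' -> is_derive (y' : R) 1 (g x) (gy x y').
  by move=> cy'; apply: dvB; apply: dvM; auto.
apply: dv_eq (dv_xint cy dg cg cgy) _.
have h0 : xint (fun x => j0 F x y * jxx G x y - j0 G x y * jxx F x y) = 0.
  apply: (@xint_period _ (fun x => j0 F x y * jx G x y - j0 G x y * jx F x y)).
  - exact: (jcontx cxx cy).
  - move=> x; apply: dv_eq; first by apply: dvB; apply: dvM; auto.
    by rewrite /=; ring.
  - by have [-> ->] := pF y; have [-> ->] := pG y.
rewrite -[LHS]addr0 -h0 -xintD.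
- by congr xint; apply/funext => x; rewrite /gy /lap; ring.
- exact: (jcontx cgy cy).
- exact: (jcontx cxx cy).
Qed.

Definition jadd F G := Jet
  (fun x y => j0 F x y + j0 G x y) (fun x y => jx F x y + jx G x y)
  (fun x y => jy F x y + jy G x y) (fun x y => jxx F x y + jxx G x y)
  (fun x y => jyy F x y + jyy G x y).

Definition jscale k F := Jet
  (fun x y => k * j0 F x y) (fun x y => k * jx F x y)
  (fun x y => k * jy F x y) (fun x y => k * jxx F x y)
  (fun x y => k * jyy F x y).

(** [h1] and [h2] stand for the first two derivatives of [h]. *)
Definition jcomp (h h1 h2 : R -> R) F := Jet
  (fun x y => h (j0 F x y))
  (fun x y => h1 (j0 F x y) * jx F x y)
  (fun x y => h1 (j0 F x y) * jy F x y)
  (fun x y => h2 (j0 F x y) * jx F x y ^+ 2 + h1 (j0 F x y) * jxx F x y)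
  (fun x y => h2 (j0 F x y) * jy F x y ^+ 2 + h1 (j0 F x y) * jyy F x y).

Lemma C2_add c F G : C2 c F -> C2 c G -> C2 c (jadd F G).
Proof.
by move=> [? ? ? ? ? ? ? ? ?] [? ? ? ? ? ? ? ? ?]; split => /= *; try (by apply: jcontD); apply: dvD; auto.
Qed.

Lemma C2_scale c k F : C2 c F -> C2 c (jscale k F).
Proof.
move=> [hx hy hxx hyy ? ? ? ? ?].
have dk (f : R -> R) (x a : R) : is_derive x 1 f a ->
    is_derive x 1 (fun t => k * f t) (k * a).
  by move=> h; apply: (dv_eq (dvM (dvc x k) h)); ring.
by split => /=; try (by apply: jcontM => //; exact: jcont_cst);
  move=> x y cy; apply: dk; auto.
Qed.

Lemma C2_comp c (h h1 h2 : R -> R) F : C2 c F ->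
  (forall x y : R, c < y -> is_derive (j0 F x y) 1 h (h1 (j0 F x y))) ->
  (forall x y : R, c < y -> is_derive (j0 F x y) 1 h1 (h2 (j0 F x y))) ->
  (forall x y : R, c < y -> {for j0 F x y, continuous h2}) ->
  C2 c (jcomp h h1 h2 F).
Proof.
move=> [dx dy dxx dyy c0 cx cy cxx cyy] hh hh1 ch2.
have c1 : jcont c (fun x y => h (j0 F x y)).
  by apply: jcont_comp => // x y cy'; exact: dv_cont (hh _ _ cy').
have c2 : jcont c (fun x y => h1 (j0 F x y)).
  by apply: jcont_comp => // x y cy'; exact: dv_cont (hh1 _ _ cy').
have c3 : jcont c (fun x y => h2 (j0 F x y)) by exact: jcont_comp.
split => //=; try exact: jcontM; try (by apply: jcontD; [apply: jcontM|exact: jcontM]).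
- by move=> x y cy'; apply: (@dvcomp _ h); auto.
- by move=> x y cy'; apply: (@dvcomp _ h); auto.
- move=> x y cy'.
  apply: (dv_eq (dvM (@dvcomp _ h1 (fun t => j0 F t y) _ _ _ (hh1 x y cy') (dx x y cy')) (dxx x y cy'))).
  by rewrite /=; ring.
- move=> x y cy'.
  apply: (dv_eq (dvM (dvcomp (hh1 x y cy') (dy x y cy')) (dyy x y cy'))).
  by rewrite /=; ring.
- by under eq_fun do under eq_fun do rewrite expr2;
    apply: jcontD; [apply: jcontM => //; apply: jcontM|apply: jcontM].
- by under eq_fun do under eq_fun do rewrite expr2;
    apply: jcontD; [apply: jcontM => //; apply: jcontM|apply: jcontM].
Qed.

Lemma lap_comp (h h1 h2 : R -> R) F x y :
  lap (jcomp h h1 h2 F) x y =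
  h2 (j0 F x y) * grad2 F x y + h1 (j0 F x y) * lap F x y.
Proof. by rewrite /lap /grad2 /=; ring. Qed.

Lemma periodic_add F G : periodic F -> periodic G -> periodic (jadd F G).
Proof. by move=> pF pG y /=; have [-> ->] := pF y; have [-> ->] := pG y. Qed.

Lemma periodic_scale k F : periodic F -> periodic (jscale k F).
Proof. by move=> pF y /=; have [-> ->] := pF y. Qed.

Lemma periodic_comp (h h1 h2 : R -> R) F :
  periodic F -> periodic (jcomp h h1 h2 F).
Proof. by move=> pF y /=; have [-> ->] := pF y. Qed.

End Jets.

(** * The cube of the positive part *)

Section CubePos.
Variable R : realType.

(** A quadratic error term needs no one-sided limits, which suits functions glued
at 0. *)
Lemma dv_quad (f : R -> R) (t a K : R) :
  (forall h, `|h| <= 1 -> `|f (t + h) - f t - a * h| <= K * h ^+ 2) ->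
  is_derive t 1 f a.
Proof.
move=> hb.
have hc : (fun h : R => h^-1 *: (f (h *: 1 + t) - f t)) @ 0^' --> a.
  apply/cvgrPdist_le => e e0.
  pose K' := `|K| + 1.
  have K'0 : 0 < K' by rewrite /K'; have := normr_ge0 K; lra.
  near=> h.
  have h0 : h != 0 by near: h; exact: nbhs_dnbhs_neq.
  have h1 : `|h| <= Num.min 1 (e / K').
    near: h; apply: dnbhs0_le; by rewrite lt_min ltr01 divr_gt0.
  have /andP[h2 h3] : (`|h| <= 1) && (`|h| <= e / K') by rewrite -le_min.
  have hn : 0 < `|h| by rewrite normr_gt0.
  rewrite /GRing.scale /= mulr1 (addrC h).
  have -> : a - h^-1 * (f (t + h) - f t) = - ((f (t + h) - f t - a * h) / h).
    by field.
  rewrite normrN normf_div ler_pdivrMr //; apply: le_trans (hb h h2) _.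
  rewrite -[h ^+ 2]ger0_norm ?sqr_ge0// normrX expr2 mulrA ler_pM2r//.
  have : `|h| * K' <= e by rewrite -ler_pdivlMr.
  have := ler_norm K; rewrite /K' => hK.
  have hKh : K * `|h| <= `|K| * `|h| by rewrite ler_pM2r.
  have : 0 <= `|h| by []; move: hKh; set u := `|K|; lra.
have ex : derivable f t 1 by apply/cvg_ex; exists a.
by split => //; exact/cvg_lim.
Unshelve. all: by end_near. Qed.

(** The cube is the first power of the positive part that is of class C^2; it is
convex and nondecreasing, so composing with it cuts a function off below 0
while the Laplacian keeps a sign. *)
Definition cubep (t : R) := Num.max t 0 ^+ 3.
Definition cubep1 (t : R) := 3 * Num.max t 0 ^+ 2.
Definition cubep2 (t : R) := 6 * Num.max t 0.

Lemma cubep_dv (t : R) : is_derive t 1 cubep (cubep1 t).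
Proof.
apply: (@dv_quad _ _ _ (3 * `|t| + 1)) => h.
rewrite ler_norml => /andP[h1 h2]; rewrite /cubep /cubep1.
have h3 : 0 <= h ^+ 2 by exact: sqr_ge0.
have [t0|t0] := leP 0 t; have [th|th] := leP 0 (t + h);
  rewrite ?(max_l t0) ?(max_l th) ?(max_r (ltW t0)) ?(max_r (ltW th)) ?(ger0_norm t0) ?(ltr0_norm t0).
- have -> : (t + h) ^+ 3 - t ^+ 3 - 3 * t ^+ 2 * h = (3 * t + h) * h ^+ 2 by ring.
  rewrite normrM (ger0_norm h3) ler_wpM2r// ler_norml; apply/andP; split; lra.
- rewrite expr0n/= ler_norml.
  have [u u0 ->] : exists2 u, 0 <= u & h = - (t + u).
    by exists (- h - t); [lra | ring].
  have t3 : 0 <= t ^+ 3 by rewrite exprn_ge0.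
  have t2u : 0 <= t ^+ 2 * u by rewrite mulr_ge0 ?exprn_ge0.
  have tu2 : 0 <= t * u ^+ 2 by rewrite mulr_ge0 ?exprn_ge0.
  have tu : 0 <= (t + u) ^+ 2 by exact: sqr_ge0.
  apply/andP; split; lra.
- rewrite !expr0n /= ?mulr0 mul0r !subr0 ger0_norm ?exprn_ge0//.
  have : (t + h) ^+ 3 <= h ^+ 3 by apply: lerXn2r; rewrite ?nnegrE; lra.
  have : h ^+ 3 <= h ^+ 2 by rewrite exprS ler_piMl.
  nra.
- rewrite !expr0n /= mulr0 mul0r !subrr normr0; nra.
Qed.

Lemma cubep1_dv (t : R) : is_derive t 1 cubep1 (cubep2 t).
Proof.
apply: (@dv_quad _ _ _ 3) => h.
rewrite ler_norml => /andP[h1 h2]; rewrite /cubep1 /cubep2.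
have h3 : 0 <= h ^+ 2 by exact: sqr_ge0.
have [t0|t0] := leP 0 t; have [th|th] := leP 0 (t + h);
  rewrite ?(max_l t0) ?(max_l th) ?(max_r (ltW t0)) ?(max_r (ltW th)).
- have -> : 3 * (t + h) ^+ 2 - 3 * t ^+ 2 - 6 * t * h = 3 * h ^+ 2 by ring.
  by rewrite ger0_norm //; nra.
- rewrite expr0n/= ler_norml.
  have ht : t <= - h by lra.
  apply/andP; split; nra.
- rewrite ?expr0n /= ?mulr0 mul0r !subr0 ger0_norm ?mulr_ge0 ?exprn_ge0//.
  rewrite ler_pM2l//; apply: lerXn2r; rewrite ?nnegrE; lra.
- rewrite !expr0n /= !mulr0 mul0r !subrr normr0; nra.
Qed.

Lemma cubep2_cont : continuous cubep2.
Proof.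
move=> t; apply: cvgM; first exact: cvg_cst.
have h := @continuous_max R R (id : R -> R^o) (cst 0) t (@cvg_id _ _) (cvg_cst _).
exact: h.
Qed.

Lemma cubep_ge0 t : 0 <= cubep t. Proof. by rewrite exprn_ge0 // le_max lexx orbT. Qed.
Lemma cubep1_ge0 t : 0 <= cubep1 t.
Proof. by rewrite mulr_ge0 ?exprn_ge0 // le_max lexx orbT. Qed.
Lemma cubep2_ge0 t : 0 <= cubep2 t.
Proof. by rewrite mulr_ge0 // le_max lexx orbT. Qed.

Lemma cubep_neg t : t <= 0 -> [/\ cubep t = 0, cubep1 t = 0 & cubep2 t = 0].
Proof. by move=> t0; rewrite /cubep /cubep1 /cubep2 (max_r t0) !expr0n /= !mulr0. Qed.

Lemma cubep_pos t : 0 <= t -> [/\ cubep t = t ^+ 3, cubep1 t = 3 * t ^+ 2 & cubep2 t = 6 * t].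
Proof. by move=> t0; rewrite /cubep /cubep1 /cubep2 (max_l t0). Qed.

Lemma C2_cubep c F : C2 c F -> C2 c (jcomp cubep cubep1 cubep2 F).
Proof.
move=> hF; apply: C2_comp => // x y _.
- exact: cubep_dv.
- exact: cubep1_dv.
- exact: cubep2_cont.
Qed.

End CubePos.

(** * The cost of one stage *)

Section Stage.
Variable R : realType.

Definition jlin (p q : R) : jet R := Jet (fun _ y => p + q * y) (fun _ _ => 0)
  (fun _ _ => q) (fun _ _ => 0) (fun _ _ => 0).

Lemma C2_lin c p q : C2 c (jlin p q).
Proof.
have e (x y b : R) : is_derive y 1 (fun t => p + q * t) q.
  by apply: (dv_eq (dvD (dvc y p) (dvM (dvc y q) (dvid y)))); ring.
split => /=; try exact: jcont_cst; try (by move=> *; exact: dvc).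
- by move=> x y _; exact: e.
- apply: jcontD; [exact: jcont_cst | apply: jcontM; [exact: jcont_cst|exact: jcont_y]].
Qed.

Lemma periodic_lin p q : periodic (jlin p q).
Proof. by []. Qed.

(** The real part of z^n in the coordinates z = exp (- y + i x). *)
Definition jwave (n : R) : jet R := Jet
  (fun x y => expR (- (n * y)) * cos (n * x))
  (fun x y => - (n * (expR (- (n * y)) * sin (n * x))))
  (fun x y => - (n * (expR (- (n * y)) * cos (n * x))))
  (fun x y => - (n ^+ 2 * (expR (- (n * y)) * cos (n * x))))
  (fun x y => n ^+ 2 * (expR (- (n * y)) * cos (n * x))).

Lemma C2_wave c n : C2 c (jwave n).
Proof.
have dn (t : R) : is_derive t 1 (fun t => n * t) n.
  by apply: (dv_eq (dvM (dvc t n) (dvid t))); ring.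
have de (t : R) : is_derive t 1 (fun t => expR (- (n * t))) (expR (- (n * t)) * - n).
  exact: dv_exp (dvN (dn t)).
have dcs (t : R) : is_derive t 1 (fun t => cos (n * t)) (- sin (n * t) * n).
  exact: dv_cos (dn t).
have ds (t : R) : is_derive t 1 (fun t => sin (n * t)) (cos (n * t) * n).
  exact: dv_sin (dn t).
have ce := jcont_exp (jcontN (jcontM (@jcont_cst _ c n) (@jcont_y _ c))).
have cx := jcontM (@jcont_cst _ c n) (@jcont_x _ c).
have cc := jcontM ce (jcont_cos cx); have cs := jcontM ce (jcont_sin cx).
split => /=.
- by move=> x y _; apply: (dv_eq (dvM (dvc x _) (dcs x))); ring.
- by move=> x y _; apply: (dv_eq (dvM (de y) (dvc y _))); ring.
- move=> x y _.
  by apply: (dv_eq (dvN (dvM (dvc x n) (dvM (dvc x (expR _)) (ds x))))); ring.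
- move=> x y _.
  by apply: (dv_eq (dvN (dvM (dvc y n) (dvM (de y) (dvc y (cos _)))))); ring.
- exact: cc.
- exact: jcontN (jcontM (@jcont_cst _ c n) cs).
- exact: jcontN (jcontM (@jcont_cst _ c n) cc).
- exact: jcontN (jcontM (@jcont_cst _ c (n ^+ 2)) cc).
- exact: jcontM (@jcont_cst _ c (n ^+ 2)) cc.
Qed.

Lemma sin_period (k : nat) (x : R) : sin (x + k%:R * (2 * pi)) = sin x.
Proof.
elim: k => [|k ih]; first by rewrite mul0r addr0.
rewrite -[RHS]ih (_ : x + _ = x + k%:R * (2 * pi) + pi *+ 2); last by rewrite -natr1 -(mulr_natl pi); ring.
exact: sinD2pi.
Qed.

Lemma cos_period (k : nat) (x : R) : cos (x + k%:R * (2 * pi)) = cos x.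
Proof.
elim: k => [|k ih]; first by rewrite mul0r addr0.
rewrite -[RHS]ih (_ : x + _ = x + k%:R * (2 * pi) + pi *+ 2); last by rewrite -natr1 -(mulr_natl pi); ring.
exact: cosD2pi.
Qed.

Lemma periodic_wave (k : nat) : periodic (jwave k%:R).
Proof.
move=> y /=; have := cos_period k 0; have := sin_period k 0.
by rewrite add0r => -> ->; rewrite mulr0.
Qed.

Variables (W : jet R) (c0 kappa : R).
Hypothesis W2 : C2 0 W.
Hypothesis Wp : periodic W.
Hypothesis W0 : forall x y : R, 0 < y -> 0 <= j0 W x y.
Hypothesis L0 : forall x y : R, 0 < y -> 0 <= lap W x y.
Hypothesis c00 : 0 < c0.
Hypothesis HL : forall x y : R, 0 < y -> y <= 1 ->
  c0 * y ^- 2 * Num.min (j0 W x y) (y `^ (- kappa)) <= lap W x y.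

(** The boundary term against the harmonic function y, that is, the integral of
y W_y - W. *)
Definition flux y := bdry (jlin 0 1) W y.
Definition mass y := xint (fun x => j0 W x y).

Lemma flux_dv (y : R) : 0 < y -> is_derive y 1 flux (xint (fun x => y * lap W x y)).
Proof.
move=> y0; have h := green (C2_lin 0 0 1) W2 (periodic_lin 0 1) Wp y0.
apply: dv_eq h _; congr xint; apply/funext => x.
by rewrite /lap /=; ring.
Qed.

(** The test function psi = d (f_+)^3 of a stage of frequency [n] and height [d].
The harmonic function V = [jV] is positive at small heights only away from the
angles where cos (n x) = 1, and negative from height 18 / n on.  The harmonic
function Z = V + 1 - y / d equals V + 1 / 2 at height d / 2, and f = V - (Z_+)^3
is therefore nonpositive there, while f = V as soon as y >= 11 d / 4.  So psi
vanishes at both ends of the stage, and its Laplacian is nonnegative except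
where the term (Z_+)^3 bends it. *)
Definition jV (n : R) := jadd (jlin (3 / 4) (- (n / 10))) (jscale (-1) (jwave n)).
Definition jZ (n d : R) := jadd (jV n) (jlin 1 (- d^-1)).
Definition jf (n d : R) :=
  jadd (jV n) (jscale (-1) (jcomp (@cubep R) (@cubep1 R) (@cubep2 R) (jZ n d))).
Definition jtest (n d : R) :=
  jscale d (jcomp (@cubep R) (@cubep1 R) (@cubep2 R) (jf n d)).

Lemma C2_test c n d : C2 c (jtest n d).
Proof.
apply: C2_scale; apply: C2_cubep; apply: C2_add; last (apply: C2_scale; apply: C2_cubep; apply: C2_add; last exact: C2_lin);
by apply: C2_add; [exact: C2_lin | apply: C2_scale; exact: C2_wave].
Qed.

Lemma periodic_test (k : nat) d : periodic (jtest k%:R d).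
Proof.
have h : periodic (jV k%:R).
  apply: periodic_add; [exact: periodic_lin | apply: periodic_scale; exact: periodic_wave].
by apply: periodic_scale; apply: periodic_comp; apply: periodic_add => //;
  apply: periodic_scale; apply: periodic_comp; apply: periodic_add.
Qed.

Lemma lap_V n x y : lap (jV n) x y = 0.
Proof. by rewrite /lap /=; ring. Qed.

Lemma lap_Z n d x y : lap (jZ n d) x y = 0.
Proof. by rewrite /lap /=; ring. Qed.

Lemma lap_f n d x y : lap (jf n d) x y =
  - (cubep2 (j0 (jZ n d) x y) * grad2 (jZ n d) x y).
Proof.
have -> : lap (jf n d) x y = lap (jV n) x y -
   lap (jcomp (@cubep R) (@cubep1 R) (@cubep2 R) (jZ n d)) x y by rewrite /lap /=; ring.
by rewrite lap_V lap_comp lap_Z; ring.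
Qed.

Lemma lap_test n d x y : lap (jtest n d) x y =
  d * (cubep2 (j0 (jf n d) x y) * grad2 (jf n d) x y -
   cubep1 (j0 (jf n d) x y) * (cubep2 (j0 (jZ n d) x y) * grad2 (jZ n d) x y)).
Proof.
have -> : lap (jtest n d) x y =
   d * lap (jcomp (@cubep R) (@cubep1 R) (@cubep2 R) (jf n d)) x y by rewrite /lap /=; ring.
by rewrite lap_comp lap_f; ring.
Qed.

Lemma sqr_le (x b : R) : - b <= x -> x <= b -> x ^+ 2 <= b ^+ 2.
Proof. by move=> h1 h2; nra. Qed.

Section OneStage.
Variables (k : nat) (n d a K : R).
Hypothesis nE : n = k%:R.
Hypothesis n0 : 0 < n.
Hypothesis nd : n * d = a.
Hypothesis a0 : 0 < a.
Hypothesis a1 : a <= 1 / 20.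
Hypothesis K1 : 1 <= K.
Hypothesis n18 : 18 / n <= 1.
Hypothesis hM : forall y, 4 / n <= y <= 5 / n -> 1 / 2 <= mass y.
Hypothesis hK : forall x y, 0 <= x <= 2 * pi -> d / 2 <= y <= 11 / 4 * d ->
  cos (n * x) <= 9 / 10 -> j0 W x y <= K * y `^ (- kappa).

Let d0 : 0 < d. Proof. by rewrite -(pmulr_rgt0 _ n0) nd. Qed.

Let c2 : R := 9 / 8 * (3 / 80) ^+ 2.
Let C1 : R := 12 + 910 * K / c0.

Lemma wave_le (f : R -> R) y t : 0 < y -> `|f t| <= 1 ->
  `|expR (- (n * y)) * f t| <= 1.
Proof.
move=> y0 ft; rewrite normrM (gtr0_norm (expR_gt0 _)) -[X in _ <= X]mulr1.
apply: ler_pM => //.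
by rewrite -expR0 ler_expR oppr_le0 mulr_ge0 // ltW.
Qed.

Lemma V_le x y : 0 < y -> j0 (jV n) x y <= 7 / 4 /\
  j0 (jV n) x y = 3 / 4 - n * y / 10 - expR (- (n * y)) * cos (n * x).
Proof.
move=> y0; have -> : j0 (jV n) x y = 3 / 4 - n * y / 10 - expR (- (n * y)) * cos (n * x).
  by rewrite /=; ring.
split => //; have ny0 : 0 < n * y by rewrite mulr_gt0.
have : `|expR (- (n * y)) * cos (n * x)| <= 1.
  by apply: wave_le => //; rewrite ler_norml cos_geN1 cos_le1.
by rewrite ler_norml => /andP[]; lra.
Qed.

Lemma fE x y : j0 (jf n d) x y = j0 (jV n) x y - cubep (j0 (jZ n d) x y).
Proof. by rewrite -mulN1r. Qed.

Lemma zE x y : j0 (jZ n d) x y = j0 (jV n) x y + 1 - y / d.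
Proof.
have -> : j0 (jZ n d) x y = j0 (jV n) x y + (1 + - d^-1 * y) by [].
by rewrite mulNr (mulrC _ y) addrA.
Qed.

(** Here f <= V <= 7 / 4 and d <= 2 y. *)
Lemma test_le x y : d / 2 <= y -> j0 (jtest n d) x y <= 12 * y.
Proof.
move=> hy; have hd0 := d0; have y0 : 0 < y by lra.
have -> : j0 (jtest n d) x y = d * cubep (j0 (jf n d) x y) by [].
set f := j0 (jf n d) x y.
suff pf6 : cubep f <= 6.
  by apply: (@le_trans _ _ (d * 6)); [rewrite ler_pM2l | lra].
have [f0|f0] := leP f 0; first by have [-> _ _] := cubep_neg f0.
have fv : f <= j0 (jV n) x y.
  by rewrite /f fE gerBl cubep_ge0.
have [v74 _] := V_le x y0.
have [-> _ _] := cubep_pos (ltW f0).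
have : f ^+ 3 <= (7 / 4) ^+ 3 by apply: lerXn2r; rewrite ?nnegrE; lra.
by lra.
Qed.

(** Where psi is subharmonic the left side is at most psi lap W, and psi <= 12 y.
Otherwise f and Z are positive, which forces y <= 11 d / 4 and
cos (n x) <= 9 / 10; there W <= K y^(- kappa) by hypothesis, the differential
inequality turns W itself into a multiple of y^2 lap W, and the bad term is
absorbed as well. *)
Lemma stage_pt x y : 0 <= x <= 2 * pi -> d / 2 <= y -> y <= 1 ->
  j0 (jtest n d) x y * lap W x y - j0 W x y * lap (jtest n d) x y <=
  C1 * (y * lap W x y).
Proof.
move=> hx hy y1.
have ha0 := a0; have ha1 := a1; have hK1 := K1; have hd0 := d0; have hc0 := c00.
have y0 : 0 < y by apply: lt_le_trans hy; rewrite divr_gt0.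
have w0 := W0 x y0; have l0 := L0 x y0.
have yl0 : 0 <= y * lap W x y by rewrite mulr_ge0 // ltW.
have KC0 : 0 <= K / c0 by rewrite divr_ge0 // ltW // (lt_le_trans _ K1).
have C10 : 0 <= C1 by rewrite /C1 -mulrA; lra.
rewrite lap_test.
set f := j0 (jf n d) x y; set z := j0 (jZ n d) x y; set v := j0 (jV n) x y.
have -> : j0 (jtest n d) x y = d * cubep f by [].
have fE : f = v - cubep z by exact: fE.
have zE : z = v + 1 - y / d by exact: zE.
have [f0|f0] := leP f 0.
  have [-> -> ->] := cubep_neg f0.
  by rewrite !mul0r subrr mulr0 mul0r mulr0 subrr mulr_ge0.
have [v74 vE] := V_le x y0; rewrite -/v in v74 vE.
have ny0 : 0 < n * y by rewrite mulr_gt0.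
have e0 : 0 < expR (- (n * y)) := expR_gt0 _.
have ec : `|expR (- (n * y)) * cos (n * x)| <= 1.
  by apply: wave_le => //; rewrite ler_norml cos_geN1 cos_le1.
have es : `|expR (- (n * y)) * sin (n * x)| <= 1.
  by apply: wave_le => //; rewrite ler_norml sin_geN1 sin_le1.
have fv : f <= v by rewrite fE; have := cubep_ge0 z; lra.
have psi12 : d * cubep f * lap W x y <= 12 * (y * lap W x y).
  by rewrite mulrA; apply: ler_wpM2r => //; exact: test_le.
have g20 F : 0 <= grad2 F x y :> R by rewrite addr_ge0 ?sqr_ge0.
have t1 : 0 <= j0 W x y * (d * (cubep2 f * grad2 (jf n d) x y)).
  apply: mulr_ge0 => //; apply: mulr_ge0; first exact: ltW.
  by apply: mulr_ge0; [exact: cubep2_ge0 | exact: g20].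
have [z0|z0] := leP z 0.
  have [_ _ ->] := cubep_neg z0; rewrite mul0r mulr0 subr0.
  have : 12 * (y * lap W x y) <= C1 * (y * lap W x y).
    by rewrite ler_wpM2r // /C1 -mulrA; lra.
  lra.
have yd : y <= 11 / 4 * d.
  by rewrite -ler_pdivrMr //; move: z0; rewrite zE; lra.
have z114 : z <= 11 / 4.
  rewrite zE; have h : 0 < y / d by rewrite divr_gt0.
  lra.
have cx : cos (n * x) <= 9 / 10.
  have v0 : 0 < v by apply: lt_le_trans fv.
  have : 1 - n * y <= expR (- (n * y)) by have := expR_ge1Dx (- (n * y)); lra.
  have : n * y <= 11 / 80.
    have : n * y <= n * (11 / 4 * d) by rewrite ler_pM2l.
    have -> : n * (11 / 4 * d) = 11 / 4 * (n * d) by ring.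
    by rewrite nd; lra.
  move: v0 e0; rewrite vE; set e := expR _; set c := cos _ => v0 e0 h1 h2.
  rewrite leNgt; apply/negP => hc.
  have : e * (9 / 10) <= e * c by rewrite ler_pM2l // ltW.
  lra.
have hd : d / 2 <= y <= 11 / 4 * d by rewrite hy yd.
have hw := hK hx hd cx.
(* W / K is below both arguments of the minimum in the inequality for lap W *)
have wl : j0 W x y <= K / c0 * (y ^+ 2 * lap W x y).
  have h1 := HL x y0 y1.
  have h2 : j0 W x y / K <= Num.min (j0 W x y) (y `^ (- kappa)).
    rewrite le_min; apply/andP; split; last by rewrite ler_pdivrMr ?(lt_le_trans _ K1) // mulrC.
    by rewrite ler_pdivrMr ?(lt_le_trans _ K1) // ler_peMr.
  have h3 : c0 * y ^- 2 * (j0 W x y / K) <= lap W x y.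
    apply: le_trans h1; rewrite ler_wpM2l // mulr_ge0 ?ltW //.
    by rewrite invr_gt0 exprn_gt0.
  have y2 : 0 < y ^+ 2 by rewrite exprn_gt0.
  have K0 : 0 < K by apply: lt_le_trans K1.
  have -> : j0 W x y = K / c0 * (y ^+ 2 * (c0 * y ^- 2 * (j0 W x y / K))).
    by field; rewrite !gt_eqF.
  by rewrite ler_wpM2l // ler_wpM2l // ltW.
have gz : grad2 (jZ n d) x y <= 2 / d ^+ 2.
  have n_d : n <= (1 / 20) / d by rewrite ler_pdivlMr // nd.
  rewrite /grad2 /=.
  set e := expR _ in ec es *; move: ec es.
  set p := e * cos _; set q := e * sin _; rewrite !ler_norml => /andP[p1 p2] /andP[q1 q2].
  have -> : 2 / d ^+ 2 = 2 * d^-1 ^+ 2 by rewrite exprVn.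
  move: n_d; have : 0 < d^-1 by rewrite invr_gt0.
  set u := d^-1 => u0 n_d.
  have hn0 := n0.
  have nq : - n <= n * q <= n by apply/andP; split; nra.
  have np : - n <= n * p <= n by apply/andP; split; nra.
  move: nq np => /andP[nq1 nq2] /andP[np1 np2].
  have hA : (0 + -1 * - (n * q) + 0) ^+ 2 <= (u / 20) ^+ 2.
    by apply: sqr_le; lra.
  have hB : (- (n / 10) + -1 * - (n * p) + - u) ^+ 2 <= (u * (1 + 11 / 200)) ^+ 2.
    by apply: sqr_le; lra.
  have u2 := sqr_ge0 u; lra.
have p1f : cubep1 f <= 10.
  have [_ -> _] := cubep_pos (ltW f0).
  have : f ^+ 2 <= (7 / 4) ^+ 2 by apply: lerXn2r; rewrite ?nnegrE; lra.
  lra.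
have p2z : cubep2 z <= 33 / 2 by have [_ _ ->] := cubep_pos (ltW z0); lra.
have t2 : d * (cubep1 f * (cubep2 z * grad2 (jZ n d) x y)) <= 330 / d.
  have -> : 330 / d = d * (10 * (33 / 2 * (2 / d ^+ 2))) by field; rewrite gt_eqF.
  rewrite ler_pM2l //; apply: ler_pM => //; first exact: cubep1_ge0.
    by apply: mulr_ge0; [exact: cubep2_ge0 | exact: g20].
  by apply: ler_pM => //; exact: cubep2_ge0.
have t3 : j0 W x y * (330 / d) <= 910 * K / c0 * (y * lap W x y).
  have h330 : 0 <= 330 / d by apply: divr_ge0; [exact: ler0n | exact: ltW].
  apply: le_trans (ler_wpM2r h330 wl) _.
  have -> : K / c0 * (y ^+ 2 * lap W x y) * (330 / d) =
    330 * (K / c0) * (y * lap W x y) * (y / d) by field; rewrite !gt_eqF.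
  have -> : 910 * K / c0 * (y * lap W x y) =
    330 * (K / c0) * (y * lap W x y) * (91 / 33) by field; rewrite gt_eqF.
  apply: ler_wpM2l.
    by apply: mulr_ge0; [apply: mulr_ge0; [exact: ler0n|exact: KC0] | exact: yl0].
  by rewrite ler_pdivrMr //; lra.
have t4 : j0 W x y * (d * (cubep1 f * (cubep2 z * grad2 (jZ n d) x y))) <=
    j0 W x y * (330 / d) by apply: ler_wpM2l.
move: t1 t2 t3 t4 psi12; rewrite /C1.
set A := cubep2 f * _; set B := cubep1 f * _ => t1 t2 t3 t4 psi12.
rewrite [d * (A - B)]mulrBr [j0 W x y * (_ - _)]mulrBr mulrDl.
lra.
Qed.

(** At these heights Z < 0, so f = V.  The wave is smaller than 1 / 16, hence V is
at least 3 / 16 and its gradient, dominated by the linear part, is at least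
3 n / 80. *)
Lemma stage_top x y : 4 / n <= y <= 5 / n ->
  d * n ^+ 2 * c2 <= lap (jtest n d) x y.
Proof.
move=> /andP[]; rewrite ler_pdivrMr // ler_pdivlMr // ![y * n]mulrC => y4 y5.
have ha0 := a0; have ha1 := a1; have hd0 := d0; have hn0 := n0.
have y0 : 0 < y by rewrite -(pmulr_rgt0 _ n0); lra.
rewrite lap_test.
set f := j0 (jf n d) x y; set z := j0 (jZ n d) x y; set v := j0 (jV n) x y.
have fE : f = v - cubep z by exact: fE.
have zE : z = v + 1 - y / d by exact: zE.
have [_ vE] := V_le x y0; rewrite -/v in vE.
have e0 : 0 < expR (- (n * y)) := expR_gt0 _.
have e16 : expR (- (n * y)) <= 1 / 16.
  rewrite expRN -div1r ler_pM2l // lef_pV2 ?posrE ?expR_gt0 //.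
  have h4 : (16 : R) <= expR 1 ^+ 4.
    have -> : (16 : R) = 2 ^+ 4 by ring.
    by apply: lerXn2r; rewrite ?nnegrE ?expR_ge0 //; have := expR_ge1Dx (1 : R); lra.
  apply: le_trans h4 _; rewrite -expRM_natl ler_expR mulr1.
  by apply: le_trans y4.
have ec : `|expR (- (n * y)) * cos (n * x)| <= 1 / 16.
  rewrite normrM (gtr0_norm e0) -[X in _ <= X]mulr1; apply: ler_pM => //.
  by rewrite ler_norml cos_geN1 cos_le1.
move: ec; rewrite ler_norml => /andP[ec1 ec2].
have yd : 80 <= y / d.
  rewrite ler_pdivlMr // -(ler_pM2l n0).
  have -> : n * (80 * d) = 80 * (n * d) by ring.
  by rewrite nd; lra.
have z0 : z <= 0 by lra.
have [pz _ ->] := cubep_neg z0; rewrite mul0r mulr0 subr0.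
have v3 : 3 / 16 <= v by lra.
have f3 : 3 / 16 <= f by lra.
have -> : d * n ^+ 2 * c2 = d * (9 / 8 * (n ^+ 2 * (3 / 80) ^+ 2)).
  by rewrite /c2; ring.
have n2 := sqr_ge0 n.
rewrite ler_pM2l //; apply: ler_pM.
- by lra.
- by apply: mulr_ge0 => //; exact: sqr_ge0.
- have f0 : 0 <= f by lra.
  by have [_ _ ->] := cubep_pos f0; lra.
have -> : grad2 (jf n d) x y = grad2 (jV n) x y.
  have [_ pz1 _] := cubep_neg z0.
  by rewrite /grad2 /= -/z pz1; ring.
apply: (@le_trans _ _ (jy (jV n) x y ^+ 2)); last first.
  by rewrite /grad2 lerDr sqr_ge0.
rewrite /=; set p := expR _ * _ in ec1 ec2 *.
have -> : (- (n / 10) + -1 * - (n * p)) ^+ 2 = n ^+ 2 * (1 / 10 - p) ^+ 2 by ring.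
by rewrite ler_wpM2l //; apply: sqr_le; lra.
Qed.

(** At height d / 2 one has Z = V + 1 / 2, and (V + 1 / 2)^3 >= V for V >= 0; at
height 18 / n the linear part of V is below -1.  So f <= 0 at both. *)
Lemma bdry_test0 y : (y = d / 2 \/ y = 18 / n) -> bdry (jtest n d) W y = 0.
Proof.
move=> hy; have ha0 := a0; have ha1 := a1; have hd0 := d0; have hn0 := n0.
have y0 : 0 < y by case: hy => ->; rewrite divr_gt0.
have h0 x : j0 (jtest n d) x y = 0 /\ jy (jtest n d) x y = 0.
  suff f0 : j0 (jf n d) x y <= 0.
    by have [e1 e2 _] := cubep_neg f0; move: e1 e2; rewrite /= => -> ->; rewrite mul0r mulr0.
  set f := j0 (jf n d) x y; set z := j0 (jZ n d) x y; set v := j0 (jV n) x y.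
  have fE : f = v - cubep z by exact: fE.
  have zE : z = v + 1 - y / d by exact: zE.
  have [v0|v0] := leP v 0; first by have := cubep_ge0 z; lra.
  case: hy => hy.
    have zv : z = v + 1 / 2 by rewrite zE hy; field; rewrite gt_eqF.
    have z0 : 0 <= z by lra.
    have [e _ _] := cubep_pos z0; rewrite fE e zv; nra.
  have vE : v = 3 / 4 - n * y / 10 - expR (- (n * y)) * cos (n * x).
    by rewrite /v /=; ring.
  have e0 : 0 < expR (- (n * y)) := expR_gt0 _.
  have ny0 : 0 < n * y by rewrite mulr_gt0.
  have e1 : expR (- (n * y)) <= 1 by rewrite -expR0 ler_expR; lra.
  have ec : `|expR (- (n * y)) * cos (n * x)| <= 1.
    rewrite normrM (gtr0_norm e0) -[X in _ <= X]mulr1; apply: ler_pM => //.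
    by rewrite ler_norml cos_geN1 cos_le1.
  move: ec; rewrite ler_norml => /andP[ec1 ec2].
  have : n * y = 18 by rewrite hy; field; rewrite gt_eqF.
  lra.
rewrite /bdry (_ : (fun x => _) = (fun=> 0)) ?xint_cst ?mul0r //.
by apply/funext => x; have [-> ->] := h0 x; rewrite mul0r mulr0 subrr.
Qed.

(** Green's identity for psi and W between the heights d / 2 and 18 / n.  Nothing
comes from the two ends; the layer of [stage_top], of thickness 1 / n, meets
mass at least 1 / 2 and contributes a multiple of d n^2 / n = a; the rest is
dominated by the increase of the flux ([stage_pt]). *)
Lemma stage : c2 / 2 * a <= C1 * (flux (18 / n) - flux (d / 2)).
Proof.
have ha0 := a0; have ha1 := a1; have hd0 := d0; have hn0 := n0.
pose H (s : R) y := C1 * flux y - bdry (jtest n d) W y - s * y.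
pose h (s : R) y := xint (fun x => C1 * (y * lap W x y) -
  (j0 (jtest n d) x y * lap W x y - j0 W x y * lap (jtest n d) x y)) - s.
have pW := Wp.
have ppsi : periodic (jtest n d) by rewrite nE; exact: periodic_test.
have jc1 : jcont 0 (fun x y => C1 * (y * lap W x y)).
  by apply: jcontM; [exact: jcont_cst | apply: jcontM; [exact: jcont_y | exact: jcont_lap]].
have cL : jcont 0 (lap (jtest n d)) by apply: jcont_lap; exact: C2_test.
have cW : jcont 0 (j0 W) by exact: C2_c0.
have jc2 : jcont 0 (fun x y => j0 (jtest n d) x y * lap W x y - j0 W x y * lap (jtest n d) x y).
  apply: jcontD; last apply: jcontN; apply: jcontM => //; last exact: jcont_lap.
  exact: C2_c0 (C2_test 0 n d).
have dH s (y : R) : 0 < y -> is_derive y 1 (H s) (h s y).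
  move=> y0; have h1 := flux_dv y0.
  have h2 := green (C2_test 0 n d) W2 ppsi Wp y0.
  have h3 := dvB (dvB (dvM (dvc y C1) h1) h2) (dvM (dvc y s) (dvid y)).
  apply: dv_eq h3 _.
  have eZ : xint (fun x => C1 * (y * lap W x y)) = C1 * xint (fun x => y * lap W x y).
    apply: xintZ; apply: (@jcontx _ 0 (fun x y => y * lap W x y)) => //.
    by apply: jcontM; [exact: jcont_y | exact: jcont_lap].
  by rewrite /h (xintB (jcontx jc1 y0) (jcontx jc2 y0)) eZ; ring.
have cB y : 0 < y -> continuous (fun x => C1 * (y * lap W x y) -
   (j0 (jtest n d) x y * lap W x y - j0 W x y * lap (jtest n d) x y)).
  by move=> y0; apply: (jcontx (jcontD jc1 (jcontN jc2))).
have dnc0 : 0 <= d * n ^+ 2 * c2.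
  by rewrite /c2; apply: mulr_ge0; [apply: mulr_ge0; [exact: ltW | exact: sqr_ge0] | lra].
have n4 : d / 2 <= 4 / n.
  rewrite ler_pdivlMr // (_ : d / 2 * n = a / 2); first by lra.
  by rewrite -nd; field.
have n45 : 4 / n <= 5 / n by rewrite ler_pM2r ?invr_gt0 // ler_nat.
have n518 : 5 / n <= 18 / n by rewrite ler_pM2r ?invr_gt0 // ler_nat.
have m1 b1 b2 : d / 2 <= b1 -> b1 <= b2 -> b2 <= 18 / n -> H 0 b1 <= H 0 b2.
  move=> h1 h2 h3.
  have pos y : b1 <= y -> 0 < y by apply: lt_le_trans; apply: lt_le_trans h1; rewrite divr_gt0.
  apply: (@le_of_dv _ (H 0) (h 0) _ _ h2) => y /andP[y1 y2].
    by apply: dH; exact: pos.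
  rewrite /h subr0; apply: xint_ge0 => x hx; rewrite subr_ge0.
  apply: stage_pt => //; first exact: le_trans y1.
  by apply: le_trans n18; exact: le_trans h3.
have m2 : H (d * n ^+ 2 * (c2 / 2)) (4 / n) <= H (d * n ^+ 2 * (c2 / 2)) (5 / n).
  have pos y : 4 / n <= y -> 0 < y by apply: lt_le_trans; rewrite divr_gt0.
  apply: (@le_of_dv _ (H _) (h _) _ _ n45) => y /andP[y1 y2].
    by apply: dH; exact: pos.
  have y0 := pos _ y1.
  rewrite /h subr_ge0; apply: (@le_trans _ _ (d * n ^+ 2 * c2 * mass y)).
    have -> : d * n ^+ 2 * (c2 / 2) = d * n ^+ 2 * c2 * (1 / 2) by ring.
    by apply: ler_wpM2l; [exact: dnc0 | apply: hM; rewrite y1].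
  rewrite /mass -xintZ; last exact: (jcontx cW).
  apply: le_xint.
  - exact: (jcontx (jcontM (@jcont_cst _ 0 (d * n ^+ 2 * c2)) cW)).
  - exact: cB.
  - move=> x hx.
    have h1 := W0 x y0.
    have h2 : d * n ^+ 2 * c2 * j0 W x y <= j0 W x y * lap (jtest n d) x y.
      by rewrite mulrC; apply: ler_wpM2l => //; apply: stage_top; rewrite y1.
    have h3 : j0 (jtest n d) x y * lap W x y <= C1 * (y * lap W x y).
      apply: (@le_trans _ _ (12 * y * lap W x y)).
        apply: ler_wpM2r; first exact: L0.
        by apply: test_le; exact: le_trans y1.
      rewrite -mulrA; apply: ler_wpM2r.
        by apply: mulr_ge0; [exact: ltW | exact: L0].
      rewrite /C1 lerDl -mulrA; apply: mulr_ge0; first exact: ler0n.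
      by apply: divr_ge0; [exact: le_trans K1 | exact: ltW].
    lra.
have e1 := bdry_test0 (or_introl erefl).
have e2 := bdry_test0 (or_intror erefl).
have := m1 _ _ (lexx _) n4 (le_trans n45 n518).
have := m1 _ _ (le_trans n4 n45) n518 (lexx _).
move: m2; rewrite /H e1 e2.
have -> : d * n ^+ 2 * (c2 / 2) * (5 / n) = d * n ^+ 2 * (c2 / 2) * (4 / n) + c2 / 2 * a.
  by rewrite -nd; field; rewrite gt_eqF.
rewrite mulrBr.
set X1 := C1 * _; set X2 := C1 * _; set X3 := C1 * _; set X4 := C1 * _.
set X5 := bdry _ _ _; set X6 := bdry _ _ _; set X7 := _ * (4 / n); set X8 := c2 / 2 * a.
lra.
Qed.

End OneStage.
End Stage.

(** * Summing the stages *)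

Section Divergence.
Variable R : realType.
Variables (W : jet R) (c0 kappa : R).
Hypothesis W2 : C2 0 W.
Hypothesis Wp : periodic W.
Hypothesis W0 : forall x y : R, 0 < y -> 0 <= j0 W x y.
Hypothesis L0 : forall x y : R, 0 < y -> 0 <= lap W x y.
Hypothesis c00 : 0 < c0.
Hypothesis HL : forall x y : R, 0 < y -> y <= 1 ->
  c0 * y ^- 2 * Num.min (j0 W x y) (y `^ (- kappa)) <= lap W x y.
Hypothesis M1 : mass W y @[y --> 0^'+] --> (1 : R).

Lemma flux_nd (y1 y2 : R) : 0 < y1 -> y1 <= y2 -> flux W y1 <= flux W y2.
Proof.
move=> y10 y12; apply: (@le_of_dv _ _ (fun y => xint (fun x => y * lap W x y)) _ _ y12) => y /andP[h1 h2].
  exact: (flux_dv W2 Wp (lt_le_trans y10 h1)).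
have y0 := lt_le_trans y10 h1.
by apply: xint_ge0 => x _; apply: mulr_ge0; [exact: ltW | exact: L0].
Qed.

Lemma mass_dv (y : R) : 0 < y ->
  is_derive y 1 (mass W) ((flux W y + mass W y) / y).
Proof.
move=> y0.
have h := @dv_xint _ 0 (j0 W) (jy W) y y0 (fun x y h => C2_y W2 x h) (C2_c0 W2) (C2_cy W2).
apply: dv_eq h _.
have -> : flux W y = y * xint (fun x => jy W x y) - mass W y.
  rewrite -xintZ; last exact: (jcontx (C2_cy W2)).
  rewrite -xintB.
  - by congr xint; apply/funext => x /=; rewrite add0r mul1r mulr1.
  - exact: (jcontx (jcontM (@jcont_y _ 0) (C2_cy W2))).
  - exact: (jcontx (C2_c0 W2)).
by field; rewrite gt_eqF.
Qed.

(** The derivative of (mass - 2) / y is (flux + 2) / y^2.  If it were negative at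
[y1], hence at all smaller heights, (mass - 2) / y would stay above its value
at [y1], whereas it tends to - oo when the mass tends to 1. *)
Lemma flux_ge (y1 : R) : 0 < y1 -> -2 <= flux W y1.
Proof.
move=> y10; rewrite leNgt; apply/negP => hB.
have mono y : 0 < y -> y <= y1 -> (mass W y1 - 2) / y1 <= (mass W y - 2) / y.
  move=> y0 hy.
  pose h (t : R) := - (((flux W t + mass W t) / t) * t^-1 + (mass W t - 2) * - t ^- 2).
  have pos t : y <= t -> 0 < t by exact: lt_le_trans.
  suff : - ((mass W y - 2) / y) <= - ((mass W y1 - 2) / y1) by rewrite lerN2.
  apply: (@le_of_dv _ (fun t => - ((mass W t - 2) / t)) h _ _ hy) => t /andP[t1 t2].
    have t0 := pos t t1.
    have dV : is_derive t 1 (fun t : R => t^-1) (- t ^- 2).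
      have := @is_deriveV R id t 1 1 (lt0r_neq0 t0) (is_derive_id _ _).
      by rewrite /GRing.scale /= mulr1.
    apply: (dv_eq (dvN (dvM (dvB (mass_dv t0) (dvc t 2)) dV))).
    by rewrite /h; ring.
  have t0 := pos t t1.
  have -> : h t = (-2 - flux W t) / t ^+ 2 by rewrite /h; field; rewrite gt_eqF.
  apply: divr_ge0; last exact: sqr_ge0.
  by have := flux_nd t0 t2; lra.
have [e /= e0 he] : \forall y \near (0 : R)^'+, mass W y < 3 / 2.
  apply: (cvgr_lt 1 M1); lra.
pose c := (mass W y1 - 2) / y1.
pose y := Num.min (e / 2) (Num.min y1 ((1 / 2) / (`|c| + 1))).
have c1 : 0 < `|c| + 1 by have := normr_ge0 c; lra.
have y0 : 0 < y by rewrite !lt_min !divr_gt0 //= y10.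
have ye : y <= e / 2 by rewrite ge_min lexx.
have yy1 : y <= y1 by rewrite /y !ge_min lexx !orbT.
have yc : y * (`|c| + 1) <= 1 / 2 by rewrite -ler_pdivlMr // /y !ge_min lexx !orbT.
have h1 : mass W y < 3 / 2.
  apply: he => //=; rewrite sub0r normrN gtr0_norm //; lra.
have := mono y y0 yy1; rewrite -/c ler_pdivlMr // => h2.
have h3 : - (y * `|c|) <= c * y.
  have hc : - c <= `|c| by rewrite ler_normr lexx orbT.
  have := ler_wpM2l (ltW y0) hc; lra.
by lra.
Qed.

Variables (nn : nat -> nat) (aa : nat -> R) (K : R).
Hypothesis nn_ge : forall k, (k < nn k)%N.
Hypothesis aa0 : forall k, 0 < aa k.
Hypothesis aa1 : forall k, aa k <= 1 / 20.
Hypothesis nnaa : forall k, 18 / (nn k.+1)%:R <= aa k / (nn k)%:R / 2.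
Hypothesis aa_dvg : forall A : R, exists N, A <= \sum_(k < N) aa k.
Hypothesis K1 : 1 <= K.
Hypothesis hK : forall k x y, 0 <= x <= 2 * pi ->
  aa k / (nn k)%:R / 2 <= y <= 11 / 4 * (aa k / (nn k)%:R) ->
  cos ((nn k)%:R * x) <= 9 / 10 -> j0 W x y <= K * y `^ (- kappa).

(** The ranges of heights of successive stages are disjoint by [nnaa] and the flux
is monotone, so the costs add up to at most the variation of the flux, which
is bounded by its value at a fixed height plus 2. *)
Lemma stages_absurd : False.
Proof.
have n0 k : 0 < (nn k)%:R :> R by rewrite ltr0n (leq_ltn_trans _ (nn_ge k)).
have [e /= e0 he] : \forall y \near (0 : R)^'+, 1 / 2 < mass W y.
  apply: (cvgr_gt 1 M1); lra.
have [k0 hk0] : exists k0 : nat, 18 / e + 18 <= k0%:R.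
  exists (Num.Def.truncn (18 / e + 18)).+1.
  by apply: ltW; exact: truncnS_gt.
have big k : (k0 <= k)%N -> 18 / e + 18 <= (nn k)%:R :> R.
  move=> kk; apply: le_trans hk0 _; rewrite ler_nat.
  exact: leq_trans kk (ltnW (nn_ge k)).
have e18 : 0 < 18 / e by rewrite divr_gt0.
pose c2 : R := 9 / 8 * (3 / 80) ^+ 2; pose C1 : R := 12 + 910 * K / c0.
have st k : (k0 <= k)%N -> c2 / 2 * aa k <=
    C1 * (flux W (18 / (nn k)%:R) - flux W (aa k / (nn k)%:R / 2)).
  move=> kk.
  apply: (@stage R W c0 kappa W2 Wp W0 L0 c00 HL (nn k) (nn k)%:R (aa k / (nn k)%:R) (aa k) K) => //.
  - by rewrite mulrC divfK // gt_eqF.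
  - by rewrite ler_pdivrMr // mul1r; have := big k kk; lra.
  - move=> y /andP[y1 y2]; apply: ltW; apply: he => /=; last first.
      by apply: lt_le_trans y1; rewrite divr_gt0.
    have y0 : 0 < y by apply: lt_le_trans y1; rewrite divr_gt0.
    rewrite sub0r normrN gtr0_norm //; apply: le_lt_trans y2 _.
    rewrite ltr_pdivrMr //; have := ler_wpM2l (ltW e0) (big k kk).
    by rewrite mulrDr mulrC divfK ?gt_eqF //; lra.
  - by move=> x y; exact: hK.
have C10 : 0 <= C1.
  apply: addr_ge0; first exact: ler0n.
  apply: divr_ge0; last exact: ltW.
  by apply: mulr_ge0; [exact: ler0n | exact: le_trans K1].
have dpos k : 0 < aa k / (nn k)%:R / 2 by rewrite !divr_gt0.
have tele j : c2 / 2 * \sum_(k0 <= k < k0 + j.+1) aa k <=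
   C1 * (flux W (18 / (nn k0)%:R) - flux W (aa (k0 + j)%N / (nn (k0 + j)%N)%:R / 2)).
  elim: j => [|j ih]; first by rewrite addn1 big_nat1 addn0; exact: st.
  rewrite addnS big_nat_recr ?leq_addr //= mulrDr.
  have h1 := st (k0 + j.+1)%N (leq_addr _ _).
  have h2 : flux W (18 / (nn (k0 + j.+1)%N)%:R) <= flux W (aa (k0 + j)%N / (nn (k0 + j)%N)%:R / 2).
    apply: flux_nd; first by rewrite divr_gt0.
    by rewrite addnS; exact: nnaa.
  have h3 := ler_wpM2l C10 h2.
  move: ih h1 h3; rewrite !mulrBr.
  set X1 := C1 * _; set X2 := C1 * _; set X3 := C1 * _; set X4 := C1 * _.
  lra.
have c20 : 0 < c2 / 2 by rewrite /c2; lra.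
pose A := (C1 * (flux W (18 / (nn k0)%:R) + 2)) / (c2 / 2).
have [N hN] := aa_dvg (A + \sum_(k < k0) aa k + 1).
have le1 (N1 N2 : nat) : (N1 <= N2)%N -> \sum_(k < N1) aa k <= \sum_(k < N2) aa k.
  move=> h; rewrite -!(big_mkord xpredT aa) (big_cat_nat (leq0n N1) h) /= lerDl.
  by apply: sumr_ge0 => k _; exact: ltW.
have h1 := le1 N (k0 + N.+1)%N (leq_trans (leqnSn N) (leq_addl _ _)).
have h2 : \sum_(k < k0 + N.+1) aa k = \sum_(k < k0) aa k + \sum_(k0 <= k < k0 + N.+1) aa k.
  by rewrite -!(big_mkord xpredT aa) (big_cat_nat (leq0n k0) (leq_addr _ _)).
have h3 : \sum_(k0 <= k < k0 + N.+1) aa k <= A.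
  rewrite /A ler_pdivlMr // mulrC; apply: le_trans (tele N) _.
  apply: ler_wpM2l => //; rewrite lerD2l lerNl; exact: flux_ge.
by lra.
Qed.

End Divergence.

(** * A regularized Green function and the Poisson bound *)

Section Poisson.
Variable R : realType.

(** [sh2] is 2 sinh, [ch] is cosh. *)
Definition sh2 (v : R) := expR v - expR (- v).
Definition ch (v : R) := (expR v + expR (- v)) / 2.

Lemma expKN (v : R) : expR v * expR (- v) = 1.
Proof. by rewrite -expRD subrr expR0. Qed.

Lemma sh2_bounds (v : R) : 0 <= v -> v <= 1 / 2 -> v <= sh2 v <= 3 * v.
Proof.
move=> v0 v1; have h1 := expR_ge1Dx v; have h2 := expR_ge1Dx (- v).
have h3 := expKN v; rewrite /sh2; move: h1 h2 h3.
set p := expR v; set q := expR (- v) => h1 h2 h3.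
have q1 : q <= 1 by rewrite /q -expR0 ler_expR; lra.
have p2 : p <= 2 by nra.
by apply/andP; split; nra.
Qed.

Lemma chE (u : R) : ch u - 1 = sh2 (u / 2) ^+ 2 / 2.
Proof.
rewrite /ch /sh2.
have -> : expR u = expR (u / 2) ^+ 2 by rewrite -expRM_natl; congr expR; field.
have -> : expR (- u) = expR (- (u / 2)) ^+ 2 by rewrite -expRM_natl; congr expR; field.
have := expKN (u / 2); set p := expR _; set q := expR _ => h.
by have -> : (p - q) ^+ 2 = p ^+ 2 + q ^+ 2 - 2 * (p * q) by [ring]; rewrite h; field.
Qed.

Lemma chN u : ch (- u) = ch u.
Proof. by rewrite /ch opprK addrC. Qed.

Lemma ch_le (u : R) : `|u| <= 1 -> ch u - 1 <= 2 * u ^+ 2.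
Proof.
wlog u0 : u / 0 <= u.
  move=> h hu; have [u0|u0] := leP 0 u; first exact: h.
  by rewrite -chN -sqrrN; apply: h; [lra | rewrite normrN].
rewrite ger0_norm // => u1; rewrite chE.
have v0 : 0 <= u / 2 by lra.
have v1 : u / 2 <= 1 / 2 by lra.
have /andP[h1 h2] := sh2_bounds v0 v1.
have : sh2 (u / 2) ^+ 2 <= (3 * (u / 2)) ^+ 2 by apply: lerXn2r; rewrite ?nnegrE; lra.
have := sqr_ge0 u; lra.
Qed.

Lemma ch_ge1 u : 1 <= ch u.
Proof. by rewrite -subr_ge0 chE divr_ge0 // sqr_ge0. Qed.

Lemma ch_ge (u : R) : 0 <= u -> u <= 1 -> 1 + u ^+ 2 / 8 <= ch u.
Proof.
move=> u0 u1; have := chE u.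
have v0 : 0 <= u / 2 by lra.
have v1 : u / 2 <= 1 / 2 by lra.
have /andP[h1 h2] := sh2_bounds v0 v1.
have : (u / 2) ^+ 2 <= sh2 (u / 2) ^+ 2 by apply: lerXn2r; rewrite ?nnegrE; lra.
lra.
Qed.

Lemma sin_le (x : R) : 0 <= x -> sin x <= x.
Proof.
move=> x0; suff : 0 - sin 0 <= x - sin x :> R by rewrite sin0; lra.
have D (t : R) : 0 <= t <= x -> is_derive t 1 (fun t => t - sin t) (1 - cos t).
  by move=> _; apply: (dv_eq (dvB (dvid t) (dv_sin (dvid t)))); rewrite mulr1.
by apply: (@le_of_dv _ _ _ _ _ x0 D) => t _; rewrite subr_ge0 cos_le1.
Qed.

Lemma cos_ge (x : R) : 1 - x ^+ 2 / 2 <= cos x.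
Proof.
wlog x0 : x / 0 <= x.
  move=> h; have [x0|x0] := leP 0 x; first exact: h.
  by rewrite -cosN -sqrrN; apply: h; lra.
suff : cos 0 - (1 - 0 ^+ 2 / 2) <= cos x - (1 - x ^+ 2 / 2) :> R.
  by rewrite cos0 expr0n /= mul0r; lra.
have D (t : R) : 0 <= t <= x ->
    is_derive t 1 (fun t => cos t - (1 - t ^+ 2 / 2)) (- sin t + t).
  move=> _; apply: (dv_eq (dvB (dv_cos (dvid t)) (dvB (dvc t 1) (dvM (dvX 2 (dvid t)) (dvc t 2^-1))))).
  by rewrite /=; field.
by apply: (@le_of_dv _ _ _ _ _ x0 D) => t /andP[t0 _]; have := sin_le t0; lra.
Qed.

(** The numerators and denominators of Moebius maps of the disk have squared
moduli of this form, up to a factor exp (- y). *)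
Definition jF (P Q c x0 : R) : jet R := Jet
  (fun x y => P * expR y + Q * expR (- y) - c * cos (x - x0))
  (fun x y => c * sin (x - x0))
  (fun x y => P * expR y - Q * expR (- y))
  (fun x y => c * cos (x - x0))
  (fun x y => P * expR y + Q * expR (- y)).

Lemma C2_F d P Q c x0 : C2 d (jF P Q c x0).
Proof.
have ds (x : R) : is_derive x 1 (fun t => t - x0) 1.
  by apply: (dv_eq (dvB (dvid x) (dvc x x0))); ring.
have de (y : R) : is_derive y 1 (fun t => expR t) (expR y).
  by apply: (dv_eq (dv_exp (dvid y))); ring.
have dn (y : R) : is_derive y 1 (fun t => expR (- t)) (- expR (- y)).
  by apply: (dv_eq (dv_exp (dvN (dvid y)))); ring.
have c1 := jcont_exp (@jcont_y _ d); have c2 := jcont_exp (jcontN (@jcont_y _ d)).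
have cx : jcont d (fun x _ => x - x0) := jcontD (@jcont_x _ d) (@jcont_cst _ d _).
have c3 := jcont_cos cx; have c4 := jcont_sin cx.
have kM (k : R) (f : R -> R -> R) : jcont d f -> jcont d (fun x y => k * f x y).
  by move=> h; exact: jcontM (@jcont_cst _ d k) h.
split => /=.
- move=> x y _.
  by apply: (dv_eq (dvB (dvD (dvc x (P * expR y)) (dvc x _)) (dvM (dvc x c) (dv_cos (ds x))))); ring.
- move=> x y _.
  by apply: (dv_eq (dvB (dvD (dvM (dvc y P) (de y)) (dvM (dvc y Q) (dn y))) (dvc y _))); ring.
- by move=> x y _; apply: (dv_eq (dvM (dvc x c) (dv_sin (ds x)))); ring.
- move=> x y _.
  by apply: (dv_eq (dvB (dvM (dvc y P) (de y)) (dvM (dvc y Q) (dn y)))); ring.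
- exact: jcontD (jcontD (kM _ _ c1) (kM _ _ c2)) (jcontN (kM _ _ c3)).
- exact: kM.
- exact: jcontD (kM _ _ c1) (jcontN (kM _ _ c2)).
- exact: kM.
- exact: jcontD (kM _ _ c1) (kM _ _ c2).
Qed.

Lemma periodic_F P Q c x0 : periodic (jF P Q c x0).
Proof.
move=> y /=; rewrite -(cosD2pi (0 - x0)) -(sinD2pi (0 - x0)).
by rewrite (_ : 0 - x0 + pi *+ 2 = 2 * pi - x0) // -mulr_natl; ring.
Qed.

Definition jlog (F : jet R) : jet R :=
  jcomp (fun t => ln t) (fun t => t^-1) (fun t => - t ^- 2) F.

Lemma C2_log d F : C2 d F -> (forall x y, d < y -> 0 < j0 F x y) -> C2 d (jlog F).
Proof.
have dV (t : R) : 0 < t -> is_derive t 1 (fun t : R => t^-1) (- t ^- 2).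
  move=> t0; have := @is_deriveV R id t 1 1 (lt0r_neq0 t0) (is_derive_id _ _).
  by rewrite /GRing.scale /= mulr1.
move=> h2 hp; apply: C2_comp => // x y dy; have p := hp x y dy.
- exact: is_derive1_ln.
- exact: dV.
- set t := j0 F x y in p *.
  apply: (@dv_cont _ (fun t => - t ^- 2) t (2 * t ^- 3)).
  rewrite (_ : (fun t : R => _) = (fun t => - (t^-1 * t^-1))); last first.
    by apply/funext => s; rewrite -invfM -expr2.
  apply: (dv_eq (dvN (dvM (dV t p) (dV t p)))).
  by field; rewrite gt_eqF.
Qed.

(** For F of this form F lap F - |grad F|^2 is constant. *)
Lemma lap_logF P Q c x0 x y : 0 < j0 (jF P Q c x0) x y ->
  lap (jlog (jF P Q c x0)) x y = (4 * P * Q - c ^+ 2) / j0 (jF P Q c x0) x y ^+ 2.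
Proof.
move=> p; rewrite lap_comp; set f := j0 _ x y in p *.
have -> : 4 * P * Q - c ^+ 2 = f * lap (jF P Q c x0) x y - grad2 (jF P Q c x0) x y.
  rewrite /f /lap /grad2 /=.
  have h1 := expKN y; have h2 := cos2Dsin2 (x - x0).
  move: h1 h2; set p1 := expR y; set q1 := expR (- y); set cc := cos _; set ss := sin _.
  move=> h1 h2.
  transitivity (4 * P * Q * (p1 * q1) - c ^+ 2 * (cc ^+ 2 + ss ^+ 2)).
    by rewrite h1 h2; ring.
  by ring.
by field; rewrite gt_eqF.
Qed.

Lemma xint_ge_sub (g : R -> R) (x0 r m : R) : continuous g -> 0 < r ->
  0 <= x0 - r -> x0 + r <= 2 * pi ->
  (forall x : R, 0 <= x <= 2 * pi -> 0 <= g x) ->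
  (forall x : R, x0 - r <= x <= x0 + r -> m <= g x) -> 0 <= m -> 2 * r * m <= xint g.
Proof.
move=> cg r0 h1 h2 g0 gm m0; rewrite /xint.
have ig := xintegrable cg.
have fing : (\int[lebesgue_measure]_(x in `[0%R, (2 * pi)%R]) (g x)%:E)%E \is a fin_num.
  exact: integrable_fin_num.
rewrite -lee_fin /Rintegral fineK //.
apply: (@le_trans _ _ (\int[lebesgue_measure]_(x in `[(x0 - r)%R, (x0 + r)%R]) (g x)%:E)%E); last first.
  apply: ge0_subset_integral => //.
  - by case/integrableP : ig.
  - move=> x; rewrite /= !in_itv /= => /andP[a1 a2]; apply/andP; split.
      exact: le_trans a1.
    exact: le_trans h2.
have -> : ((2 * r * m)%:E = \int[lebesgue_measure]_(x in `[(x0 - r)%R, (x0 + r)%R]) (cst m%:E) x)%E.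
  rewrite integral_cst //= lebesgue_measure_itv /= lte_fin.
  rewrite (_ : (x0 - r < x0 + r) = true); last by lra.
  by rewrite -EFinD -EFinM; congr EFin; ring.
apply: ge0_le_integral => //.
by apply/measurable_EFinP; apply: measurable_funTS; exact: continuous_measurable_fun.
Qed.

Definition jshift (e : R) (W : jet R) : jet R := Jet
  (fun x y => j0 W x (y + e)) (fun x y => jx W x (y + e))
  (fun x y => jy W x (y + e)) (fun x y => jxx W x (y + e))
  (fun x y => jyy W x (y + e)).

Lemma C2_shift c e W : C2 c W -> C2 (c - e) (jshift e W).
Proof.
move=> [dx dy dxx dyy c0 cx cy cxx cyy].
have sh y : c - e < y -> c < y + e by rewrite ltrBlDr.
have cs (f : R -> R -> R) : jcont c f -> jcont (c - e) (fun x y => f x (y + e)).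
  move=> hf x y hy.
  apply: (@continuous2_cvg _ _ _ _ _ _ (fun z => z.1) (fun z => z.2 + e) f).
  - exact: hf (sh _ hy).
  - exact: cvg_fst.
  - by apply: cvgD; [exact: cvg_snd | exact: cvg_cst].
have ds (f : R -> R) (y a : R) : is_derive (y + e) 1 f a ->
    is_derive y 1 (fun t => f (t + e)) a.
  move=> h.
  by apply: (dv_eq (@dvcomp _ f (fun t => t + e) y _ _ h (dvD (dvid y) (dvc y e)))); ring.
split => /=; try exact: cs.
- by move=> x y /sh h; exact: dx.
- by move=> x y /sh h; apply: (ds (fun t => j0 W x t)); exact: dy.
- by move=> x y /sh h; exact: dxx.
- by move=> x y /sh h; apply: (ds (fun t => jy W x t)); exact: dyy.
Qed.

Lemma periodic_shift e W : periodic W -> periodic (jshift e W).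
Proof. by move=> h y; exact: h. Qed.

Section Kernel.
Variables (x0 y0 t : R).
Hypothesis y00 : 0 < y0.
Hypothesis y01 : y0 <= 1 / 4.
Hypothesis t0 : 0 < t.
Hypothesis t1 : t <= 1.

(** [f1] and [f2] are the numerator and the denominator of
(1 + t) / (|phi|^2 + t), where phi is the Moebius map of the disk that sends
exp (- y0 + i x0) to 0.  The logarithm of this quotient tends to the Green
function - log |phi|^2 as t tends to 0; for t > 0 the pole is replaced by a
bump of the Laplacian of total mass of order 1. *)
Let f1 := jF ((1 + t) * expR y0 / 2) ((1 + t) * expR (- y0) / 2) (1 + t) x0.
Let f2 := jF ((expR (- y0) + t * expR y0) / 2) ((expR y0 + t * expR (- y0)) / 2)
  (1 + t) x0.
Definition jgreen := jadd (jlog f1) (jscale (-1) (jlog f2)).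

Lemma f1E x y : j0 f1 x y = (1 + t) * (ch (y + y0) - cos (x - x0)).
Proof.
by rewrite /= /ch opprD !expRD; field.
Qed.

Lemma f2E x y : j0 f2 x y =
  (ch (y - y0) - cos (x - x0)) + t * (ch (y + y0) - cos (x - x0)).
Proof.
by rewrite /= /ch !opprD !expRD opprK; field.
Qed.

Lemma f12E x y : j0 f1 x y - j0 f2 x y = sh2 y0 * sh2 y / 2.
Proof. by rewrite /= /sh2; field. Qed.

Lemma f1_gt0 x y : - y0 < y -> 0 < j0 f1 x y.
Proof.
move=> hy; rewrite f1E; apply: mulr_gt0; first by have := t0; lra.
have u0 : 0 < y + y0 by lra.
have h1 := cos_le1 (x - x0).
suff : 1 < ch (y + y0) by lra.
rewrite -subr_gt0 chE divr_gt0 // exprn_gt0 // /sh2 subr_gt0 ltr_expR; lra.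
Qed.

Lemma f2_gt0 x y : 0 < j0 f2 x y.
Proof.
rewrite f2E; have h1 := cos_le1 (x - x0); have h2 := ch_ge1 (y - y0).
have h3 := ch_ge1 (y + y0); have ht := t0.
have h4 (u : R) : u != 0 -> 1 < ch u.
  move=> u0; rewrite -subr_gt0 chE divr_gt0 // exprn_even_gt0 //= /sh2 subr_eq0.
  by apply/negP => /eqP /expR_inj; lra.
have [e|e] := eqVneq y y0.
  have : 1 < ch (y + y0) by apply: h4; rewrite gt_eqF //; have := y00; lra.
  move=> h5; have : 0 < t * (ch (y + y0) - cos (x - x0)) by apply: mulr_gt0 => //; lra.
  lra.
have : 1 < ch (y - y0) by apply: h4; rewrite subr_eq0.
move=> h5; have : 0 <= t * (ch (y + y0) - cos (x - x0)) by apply: mulr_ge0; lra.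
lra.
Qed.

Lemma C2_green : C2 (- y0) jgreen.
Proof.
apply: C2_add; first by apply: C2_log; [exact: C2_F | move=> x y; exact: f1_gt0].
apply: C2_scale; apply: C2_log; first exact: C2_F.
by move=> x y _; exact: f2_gt0.
Qed.

Lemma periodic_green : periodic jgreen.
Proof.
apply: periodic_add; last apply: periodic_scale;
by apply: periodic_comp; exact: periodic_F.
Qed.

Lemma lap_green x y : - y0 < y ->
  lap jgreen x y = - (t * sh2 y0 ^+ 2 / j0 f2 x y ^+ 2).
Proof.
move=> hy.
have -> : lap jgreen x y = lap (jlog f1) x y - lap (jlog f2) x y.
  by rewrite /lap /=; ring.
rewrite !lap_logF; [|exact: f2_gt0|exact: f1_gt0].
have h := expKN y0; rewrite -/f1 -/f2.
have -> : 4 * ((1 + t) * expR y0 / 2) * ((1 + t) * expR (- y0) / 2) - (1 + t) ^+ 2 =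
   (1 + t) ^+ 2 * (expR y0 * expR (- y0) - 1) by field.
rewrite h subrr mulr0 mul0r sub0r /sh2; congr (- (_ / _)).
move: h; set p := expR _; set q := expR _ => h.
have -> : 4 * ((q + t * p) / 2) * ((p + t * q) / 2) - (1 + t) ^+ 2 =
   (1 + t ^+ 2) * (p * q) + t * (p ^+ 2 + q ^+ 2) - (1 + t) ^+ 2 by field.
have -> : t * (p - q) ^+ 2 = t * (p ^+ 2 + q ^+ 2) - 2 * t * (p * q) by ring.
by rewrite h; ring.
Qed.

Lemma green_ge0 x y : 0 <= y -> 0 <= j0 jgreen x y.
Proof.
move=> hy; have hy0 := y00; rewrite [j0 _ _ _]/= mulN1r subr_ge0 -/f1.
have h2 := f2_gt0 x y; have h1 : 0 < j0 f1 x y by apply: f1_gt0; lra.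
rewrite ler_ln ?posrE //; rewrite -subr_ge0.
change (0 <= j0 f1 x y - j0 f2 x y); rewrite f12E divr_ge0 //.
by apply: mulr_ge0; rewrite /sh2 subr_ge0 ler_expR; lra.
Qed.

(** On y = 0 one has |phi| = 1.  The y-derivative there is the Poisson kernel, up
to the factor 1 / (1 + t). *)
Lemma green_0 x : j0 jgreen x 0 = 0 /\
  jy jgreen x 0 = sh2 y0 / ((1 + t) * (ch y0 - cos (x - x0))).
Proof.
have hy0 := y00; have e12 : j0 f1 x 0 = j0 f2 x 0.
  by apply/eqP; rewrite -subr_eq0 f12E /sh2 oppr0 subrr mulr0 mul0r.
have e1 : j0 f1 x 0 = (1 + t) * (ch y0 - cos (x - x0)) by rewrite f1E add0r.
have p1 : 0 < j0 f1 x 0 by apply: f1_gt0; lra.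
split.
  have -> : j0 jgreen x 0 = ln (j0 f1 x 0) + -1 * ln (j0 f2 x 0) by [].
  by rewrite e12 mulN1r subrr.
have -> : jy jgreen x 0 = (j0 f1 x 0)^-1 * jy f1 x 0 + -1 * ((j0 f2 x 0)^-1 * jy f2 x 0) by [].
rewrite -e12 -e1 mulN1r -mulrBr mulrC; congr (_ / _).
by rewrite /= oppr0 expR0 /sh2; field.
Qed.

(** The function is Lipschitz in y0 and vanishes for y0 = 0; the constants are
crude. *)
Lemma green_1 x : `|j0 jgreen x 1| <= 90 * y0 /\ `|jy jgreen x 1| <= 3000 * y0.
Proof.
have hy0 := y00; have hy1 := y01; have ht0 := t0; have ht1 := t1.
have e2 : expR (1 : R) <= 4 /\ 0 < expR (-1 : R) <= 1.
  have h1 := expKN (1 / 2 : R); have h2 := expR_ge1Dx (- (1 / 2) : R).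
  have h3 := expR_gt0 (1 / 2 : R).
  split; last by rewrite expR_gt0 /= -[X in _ <= X]expR0 ler_expR; lra.
  have -> : (1 : R) = 2%:R * (1 / 2) by field.
  rewrite expRM_natl; move: h1 h2 h3; set p := expR _; set q := expR _ => h1 h2 h3.
  have : p <= 2 by nra.
  nra.
move: e2 => [e4 /andP[en0 en1]].
have /andP[S0 S3] : y0 <= sh2 y0 <= 3 * y0 by apply: sh2_bounds; lra.
have p2 : 1 / 15 <= j0 f2 x 1.
  rewrite f2E; have h1 := cos_le1 (x - x0).
  have h2 : 1 + (1 - y0) ^+ 2 / 8 <= ch (1 - y0) by apply: ch_ge; lra.
  have h3 := ch_ge1 (1 + y0).
  have h4 : 0 <= t * (ch (1 + y0) - cos (x - x0)) by apply: mulr_ge0; lra.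
  have : (3 / 4) ^+ 2 <= (1 - y0) ^+ 2 by apply: lerXn2r; rewrite ?nnegrE; lra.
  lra.
have d12 := f12E x 1.
have sh1 : 0 <= sh2 (1 : R) <= 4.
  by rewrite /sh2; apply/andP; split; [rewrite subr_ge0 ler_expR|]; lra.
move: sh1 => /andP[s0 s4].
have D0 : 0 <= j0 f1 x 1 - j0 f2 x 1 <= 6 * y0.
  by rewrite d12; apply/andP; split; nra.
move: D0 => /andP[D0 D6].
have q1 : 0 < j0 f1 x 1 by lra.
have q2 : 0 < j0 f2 x 1 by lra.
have inv15 (u : R) : 1 / 15 <= u -> 0 < u^-1 <= 15.
  move=> hu; have u0 : 0 < u by lra.
  by rewrite invr_gt0 u0 /= -div1r ler_pdivrMr //; lra.
have u2 := inv15 _ p2.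
have u1 : 0 < (j0 f1 x 1)^-1 <= 15 by apply: inv15; lra.
move: u1 u2 => /andP[u10 u11] /andP[u20 u21].
split.
  rewrite ger0_norm; last by apply: green_ge0.
  have -> : j0 jgreen x 1 = ln (j0 f1 x 1) + -1 * ln (j0 f2 x 1) by [].
  rewrite mulN1r -ln_div ?posrE //.
  have h : j0 f1 x 1 / j0 f2 x 1 = 1 + (j0 f1 x 1 - j0 f2 x 1) / j0 f2 x 1.
    by field; rewrite gt_eqF.
  have h0 : 0 <= (j0 f1 x 1 - j0 f2 x 1) / j0 f2 x 1 by apply: divr_ge0 => //; exact: ltW.
  rewrite h; apply: le_trans (le_ln1Dx _) _; first lra.
  by apply: (@le_trans _ _ (6 * y0 * 15)); [apply: ler_pM => //; exact: ltW | lra].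
have -> : jy jgreen x 1 = (jy f1 x 1 - jy f2 x 1) * (j0 f1 x 1)^-1 -
   jy f2 x 1 * (j0 f2 x 1)^-1 * ((j0 f1 x 1 - j0 f2 x 1) * (j0 f1 x 1)^-1).
  have -> : jy jgreen x 1 = (j0 f1 x 1)^-1 * jy f1 x 1 + -1 * ((j0 f2 x 1)^-1 * jy f2 x 1) by [].
  by field; rewrite !gt_eqF.
have A1 : `|jy f1 x 1 - jy f2 x 1| <= 15 / 2 * y0.
  have -> : jy f1 x 1 - jy f2 x 1 = sh2 y0 * (expR 1 + expR (-1)) / 2.
    by rewrite /= /sh2; field.
  have ee : 0 <= expR (1 : R) + expR (-1) <= (5 : R).
    by have e0 := expR_gt0 (1 : R); apply/andP; split; lra.
  move: ee => /andP[ee0 ee5]; have s00 : 0 <= sh2 y0 by lra.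
  have h1 : 0 <= sh2 y0 * (expR 1 + expR (-1)) by exact: mulr_ge0.
  have h2 : sh2 y0 * (expR 1 + expR (-1)) <= 3 * y0 * 5 by exact: ler_pM.
  by rewrite ger0_norm; lra.
have A2 : `|jy f2 x 1 * (j0 f2 x 1)^-1| <= 31.
  rewrite normrM (gtr0_norm u20) ler_pdivrMr //.
  apply: (@le_trans _ _ (j0 f2 x 1 + 2)); last by lra.
  have h1 := cos_geN1 (x - x0); have h2 := cos_le1 (x - x0).
  have P0 : 0 < (expR (- y0) + t * expR y0) / 2 * expR 1.
    have := expR_gt0 (- y0); have := expR_gt0 y0; have := expR_gt0 (1 : R) => ? ? ?.
    by apply: mulr_gt0 => //; rewrite divr_gt0 // addr_gt0 // mulr_gt0.
  have Q0 : 0 < (expR y0 + t * expR (- y0)) / 2 * expR (-1).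
    have := expR_gt0 (- y0); have := expR_gt0 y0 => ? ?.
    by apply: mulr_gt0 => //; rewrite divr_gt0 // addr_gt0 // mulr_gt0.
  have h3 : (1 + t) * cos (x - x0) <= 2 by nra.
  have -> : jy f2 x 1 = (expR (- y0) + t * expR y0) / 2 * expR 1 -
      (expR y0 + t * expR (- y0)) / 2 * expR (-1) by [].
  have -> : j0 f2 x 1 = (expR (- y0) + t * expR y0) / 2 * expR 1 +
      (expR y0 + t * expR (- y0)) / 2 * expR (-1) - (1 + t) * cos (x - x0) by [].
  move: P0 Q0 h3; set P := _ * expR 1; set Q := _ * expR (-1); set c := _ * cos _.
  by move=> P0 Q0 h3; rewrite ler_norml; apply/andP; split; lra.
have A3 : `|(j0 f1 x 1 - j0 f2 x 1) * (j0 f1 x 1)^-1| <= 90 * y0.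
  rewrite ger0_norm; last by apply: mulr_ge0 => //; exact: ltW.
  by apply: (@le_trans _ _ (6 * y0 * 15)); [apply: ler_pM => //; exact: ltW | lra].
have A4 : `|(jy f1 x 1 - jy f2 x 1) * (j0 f1 x 1)^-1| <= 15 / 2 * y0 * 15.
  by rewrite normrM (gtr0_norm u10); apply: ler_pM => //; exact: ltW.
have A5 : `|jy f2 x 1 * (j0 f2 x 1)^-1 * ((j0 f1 x 1 - j0 f2 x 1) * (j0 f1 x 1)^-1)| <= 31 * (90 * y0).
  by rewrite normrM; apply: ler_pM.
apply: le_trans (ler_normB _ _) _; lra.
Qed.

(** With t = (r / y0)^2 the bump has width r: on the box of half-side r the
denominator [f2] is at most 21 r^2. *)
Lemma lap_green_box x y r : 0 < r -> r <= y0 -> t = r ^+ 2 / y0 ^+ 2 ->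
  `|x - x0| <= r -> `|y - y0| <= r -> 1 / (441 * r ^+ 2) <= - lap jgreen x y.
Proof.
move=> r0 ry te hx hy; have hy0 := y00; have hy1 := y01.
move: (hx) (hy); rewrite !ler_norml => /andP[x1 x2] /andP[y1 y2].
have yy : - y0 < y by lra.
rewrite lap_green // opprK.
have /andP[S0 S3] : y0 <= sh2 y0 <= 3 * y0 by apply: sh2_bounds; lra.
have p2 := f2_gt0 x y.
have r2 : 0 < r ^+ 2 by rewrite exprn_gt0.
have F21 : j0 f2 x y <= 21 * r ^+ 2.
  rewrite f2E.
  have sq u : `|u| <= r -> u ^+ 2 <= r ^+ 2.
    by rewrite ler_norml => /andP[? ?]; nra.
  have a1 : ch (y - y0) - 1 <= 2 * (y - y0) ^+ 2 by apply: ch_le; apply: le_trans hy _; lra.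
  have a2 := sq _ hy; have a3 := sq _ hx; have a4 := cos_ge (x - x0).
  have a5 : ch (y + y0) - 1 <= 2 * (y + y0) ^+ 2 by apply: ch_le; rewrite ger0_norm; lra.
  have a6 : (y + y0) ^+ 2 <= (3 * y0) ^+ 2 by apply: lerXn2r; rewrite ?nnegrE; lra.
  have ty : t * y0 ^+ 2 = r ^+ 2 by rewrite te divfK // expf_neq0 // gt_eqF.
  have a7 : t * (ch (y + y0) - cos (x - x0)) <= t * (18 * y0 ^+ 2) + r ^+ 2 / 2.
    have ht0 := t0; have ht1 := t1.
    apply: (@le_trans _ _ (t * (18 * y0 ^+ 2 + r ^+ 2 / 2))); first by rewrite ler_pM2l //; lra.
    by rewrite mulrDr lerD2l; apply: ler_piMl => //; lra.
  lra.
have -> : 1 / (441 * r ^+ 2) = t * y0 ^+ 2 / (21 * r ^+ 2) ^+ 2.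
  by rewrite te; field; rewrite !gt_eqF.
have hh : t * y0 ^+ 2 <= t * sh2 y0 ^+ 2.
  by rewrite ler_pM2l //; apply: lerXn2r; rewrite ?nnegrE; lra.
apply: ler_pM => //.
- by apply: mulr_ge0; [exact: ltW | exact: sqr_ge0].
- by rewrite invr_ge0; exact: sqr_ge0.
- rewrite lef_pV2 ?posrE ?exprn_gt0 //; last by lra.
  by apply: lerXn2r; rewrite ?nnegrE; lra.
Qed.

End Kernel.

End Poisson.

Lemma twopi_gt0 (R : realType) : 0 < 2 * pi :> R.
Proof. by rewrite mulr_gt0 // pi_gt0. Qed.

(** Green's identity between the heights 0 and 1, for W shifted by [e] and the
regularized Green function with pole (x0, y0).  The bottom contributes the
Poisson integral; the top contributes O (y0) because W is bounded at heights
between 1 and 2; the term in lap W has a sign; and the bump of the Green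
function is tested on a box so small that W stays above half of its value at
the pole.  The gain is 2 / 441 of that value. *)
Lemma poisson_bound (R : realType) (W : jet R) : C2 0 W -> periodic W ->
  (forall x y : R, 0 < y -> 0 <= j0 W x y) ->
  (forall x y : R, 0 < y -> 0 <= lap W x y) ->
  exists2 CW, 0 <= CW & forall x0 y0 e : R, 0 < x0 < 2 * pi -> 0 < y0 <= 1 / 4 ->
    0 < e <= 1 -> j0 W x0 (y0 + e) <=
      221 * (xint (fun x => j0 W x e * (sh2 y0 / (ch y0 - cos (x - x0)))) + CW * y0).
Proof.
move=> W2 Wp W0 L0; have T0 := twopi_gt0 R.
have [K1 K10 hK1] := @jcont_bounded _ 0 (j0 W) 1 2 (C2_c0 W2) ltr01.
have [K2 K20 hK2] := @jcont_bounded _ 0 (jy W) 1 2 (C2_cy W2) ltr01.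
have [CC CC0 CCE] : exists2 CC, 0 <= CC & CC = 90 * K2 + 3000 * K1.
  by eexists; last reflexivity; apply: addr_ge0; apply: mulr_ge0; rewrite ?ler0n.
have CW0 : 0 <= CC * (2 * pi) by apply: mulr_ge0 => //; exact: ltW.
exists (CC * (2 * pi)) => //.
move=> x0 y0 e /andP[x00 x01] /andP[y00 y01] /andP[e0 e1].
have y0e : 0 < y0 + e by rewrite addr_gt0.
have := W0 x0 (y0 + e) y0e; set w := j0 W x0 (y0 + e) => w0.
have chp x : 0 < ch y0 - cos (x - x0).
  have h1 := cos_le1 (x - x0).
  have h2 : 1 + y0 ^+ 2 / 8 <= ch y0 by clear - y00 y01; apply: ch_ge; lra.
  have h3 : 0 < y0 ^+ 2 by rewrite exprn_gt0.
  by clear - h1 h2 h3; lra.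
have S0 : 0 <= sh2 y0.
  have v0 : 0 <= y0 by exact: ltW.
  have v1 : y0 <= 1 / 2 by clear - y01; lra.
  by have /andP[h1 _] := sh2_bounds v0 v1; exact: le_trans h1.
have I0 : 0 <= xint (fun x => j0 W x e * (sh2 y0 / (ch y0 - cos (x - x0)))).
  apply: xint_ge0 => x _; apply: mulr_ge0; first exact: W0.
  by apply: divr_ge0 => //; exact: ltW.
move: w0; rewrite le_eqVlt => /orP[/eqP <-|w0].
  by apply: mulr_ge0; [exact: ler0n | apply: addr_ge0 => //; apply: mulr_ge0 => //; exact: ltW].
(* a box around (x0, y0) on which the shifted function stays above w / 2 *)
have [r [r0 ry rx1 rx2 hr]] : exists r, [/\ 0 < r, r <= y0, 0 <= x0 - r, x0 + r <= 2 * pi &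
    forall x y, `|x - x0| <= r -> `|y - y0| <= r -> w / 2 <= j0 W x (y + e)].
  have cw : j0 W z.1 z.2 @[z --> (x0, y0 + e)] --> j0 W x0 (y0 + e) := C2_c0 W2 y0e.
  have /nbhs_ballP[d /= d0 hd] : \forall z \near ((x0, y0 + e) : R * R), w / 2 < j0 W z.1 z.2.
    by apply: (cvgr_gt _ cw); rewrite -/w; clear - w0; lra.
  exists (Num.min (d / 2) (Num.min y0 (Num.min x0 (2 * pi - x0)))).
  set r := Num.min _ _.
  have r1 : r <= d / 2 by rewrite /r ge_min lexx.
  have r2 : r <= y0 by rewrite /r !ge_min lexx !orbT.
  have r3 : r <= x0 by rewrite /r !ge_min lexx !orbT.
  have r4 : r <= 2 * pi - x0 by rewrite /r !ge_min lexx !orbT.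
  split => //.
  - by rewrite /r !lt_min divr_gt0 //= y00 x00 /= subr_gt0.
  - by rewrite subr_ge0.
  - by rewrite addrC -lerBrDr.
  - have rd : r < d by clear - r1 d0; lra.
    move=> x y hx hy; apply: ltW; apply: (hd (x, y + e)); split; rewrite /ball /=.
      by rewrite distrC; exact: le_lt_trans rd.
    rewrite distrC (_ : y + e - (y0 + e) = y - y0); last by ring.
    by exact: le_lt_trans rd.
pose t := r ^+ 2 / y0 ^+ 2.
have r2 : 0 < r ^+ 2 by rewrite exprn_gt0.
have t0 : 0 < t by rewrite divr_gt0 // exprn_gt0.
have t1 : t <= 1.
  rewrite ler_pdivrMr ?exprn_gt0 // mul1r; apply: lerXn2r; rewrite ?nnegrE //; exact: ltW.
pose F := jgreen x0 y0 t; pose G := jshift e W.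
(* both functions are C^2 down to the negative height c, so Green's identity
   may start at y = 0 *)
pose c := - Num.min e y0.
have c0 : c < 0 by rewrite oppr_lt0 lt_min e0.
have cy : - y0 <= c by rewrite lerN2 ge_min lexx orbT.
have F2 : C2 c F by apply: (@C2_le _ (- y0)) => //; exact: C2_green.
have G2 : C2 c G.
  apply: (@C2_le _ (0 - e)); last exact: C2_shift.
  by rewrite sub0r lerN2 ge_min lexx.
have Fp : periodic F by exact: periodic_green.
have Gp : periodic G by exact: periodic_shift.
have yc y : 0 <= y -> c < y by exact: lt_le_trans.
have ye y : 0 <= y -> 0 < y + e by move=> y_; exact: ltr_wpDl.
have yy0 y : 0 <= y -> - y0 < y by apply: lt_le_trans; rewrite oppr_lt0.
pose D y := xint (fun x => j0 F x y * lap G x y - j0 G x y * lap F x y).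
have dH y : 0 <= y -> is_derive (y : R) 1 (bdry F G) (D y).
  by move=> h; exact: green F2 G2 Fp Gp (yc y h).
have pos x y : 0 <= y -> 0 <= j0 G x y * - lap F x y <=
    j0 F x y * lap G x y - j0 G x y * lap F x y.
  move=> h; have g0 : 0 <= j0 G x y by apply: W0; exact: ye.
  have f0 : 0 <= j0 F x y by exact: green_ge0.
  have l0 : 0 <= lap G x y by apply: L0; exact: ye.
  have m0 : 0 <= - lap F x y.
    rewrite lap_green ?yy0 // opprK; apply: divr_ge0; last exact: sqr_ge0.
    by apply: mulr_ge0; [exact: ltW | exact: sqr_ge0].
  apply/andP; split; first exact: mulr_ge0.
  by rewrite mulrN lerDr; exact: mulr_ge0.
have cD : jcont c (fun x y => j0 F x y * lap G x y - j0 G x y * lap F x y).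
  apply: jcontD; last apply: jcontN; apply: jcontM;
    by [exact: C2_c0 F2 | exact: C2_c0 G2 | exact: jcont_lap].
have D0 y : 0 <= y -> 0 <= D y.
  move=> h; apply: xint_ge0 => x _.
  by have /andP[h1 h2] := pos x y h; exact: le_trans h2.
have mono a b : 0 <= a -> a <= b -> bdry F G a <= bdry F G b.
  move=> a0 ab; apply: (@le_of_dv _ (bdry F G) D _ _ ab) => y /andP[y1 _].
    by apply: dH; exact: le_trans y1.
  by apply: D0; exact: le_trans y1.
have Dbox y : y0 - r <= y <= y0 + r -> w / (441 * r) <= D y.
  move=> /andP[y1 y2]; have yp : 0 <= y by apply: le_trans y1; rewrite subr_ge0.
  have hy : `|y - y0| <= r by rewrite ler_norml; apply/andP; split; [rewrite lerBrDl | rewrite lerBlDl].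
  have -> : w / (441 * r) = 2 * r * (w / 2 * (1 / (441 * r ^+ 2))).
    by field; rewrite gt_eqF.
  have w20 : 0 <= w / 2 by clear - w0; lra.
  have i0 : 0 <= 1 / (441 * r ^+ 2).
    by apply: divr_ge0; [exact: ler01 | apply: mulr_ge0; [exact: ler0n | exact: ltW]].
  apply: (@xint_ge_sub _ _ x0 r).
  - exact: (jcontx cD (yc y yp)).
  - exact: r0.
  - exact: rx1.
  - exact: rx2.
  - by move=> x _; have /andP[h1 h2] := pos x y yp; exact: le_trans h2.
  - move=> x /andP[x1 x2]; have /andP[_ h2] := pos x y yp; apply: le_trans h2.
    have hx : `|x - x0| <= r by rewrite ler_norml; apply/andP; split; [rewrite lerBrDl | rewrite lerBlDl].
    apply: ler_pM; [exact: w20 | exact: i0 | exact: hr | exact: lap_green_box].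
  - exact: mulr_ge0 w20 i0.
have jump : bdry F G (y0 - r) + 2 * w / 441 <= bdry F G (y0 + r).
  pose H (s : R) := bdry F G s - w / (441 * r) * s.
  have rr : y0 - r <= y0 + r by clear - r0; lra.
  have : H (y0 - r) <= H (y0 + r).
    apply: (@le_of_dv _ H (fun s => D s - w / (441 * r)) _ _ rr) => s hs.
      have sp : 0 <= s by move: hs => /andP[+ _]; apply: le_trans; rewrite subr_ge0.
      by apply: (dv_eq (dvB (dH s sp) (dvM (dvc s (w / (441 * r))) (dvid s)))); ring.
    by rewrite subr_ge0; exact: Dbox.
  rewrite /H; have -> : w / (441 * r) * (y0 + r) = w / (441 * r) * (y0 - r) + 2 * w / 441.
    by field; rewrite gt_eqF.
  set X1 := bdry _ _ _; set X2 := bdry _ _ _; set X3 := w / _ * _; set X4 := 2 * w / 441.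
  by clear; lra.
have m1 : bdry F G 0 <= bdry F G (y0 - r) by apply: mono => //; rewrite subr_ge0.
have m2 : bdry F G (y0 + r) <= bdry F G 1 by clear - mono y01 ry r0 y00; apply: mono; lra.
have cB : jcont c (fun x y => j0 F x y * jy G x y - j0 G x y * jy F x y).
  apply: jcontD; last apply: jcontN; apply: jcontM;
    by [exact: C2_c0 F2 | exact: C2_c0 G2 | exact: C2_cy F2 | exact: C2_cy G2].
have cK : continuous (fun x => j0 W x e * (sh2 y0 / (ch y0 - cos (x - x0)))).
  move=> x; apply: cvgM; first exact: (jcontx (C2_c0 W2) e0).
  apply: cvgM; first exact: cvg_cst.
  apply: cvgV; first by rewrite gt_eqF.
  apply: cvgB; first exact: cvg_cst.
  exact: (dv_cont (dv_cos (dvB (dvid x) (dvc x x0)))).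
have b0 : - xint (fun x => j0 W x e * (sh2 y0 / (ch y0 - cos (x - x0)))) <= bdry F G 0.
  rewrite -mulN1r -(xintZ (-1) cK) /bdry; apply: le_xint.
  - by move=> x; apply: cvgM; [exact: cvg_cst | exact: cK].
  - exact: (jcontx cB (yc 0 (lexx 0))).
  - move=> x _; have [-> ->] := green_0 x0 y00 t0 x.
    rewrite mul0r sub0r mulN1r lerN2 /G /= add0r; apply: ler_wpM2l; first exact: W0.
    apply: ler_wpM2l => //; have cx := chp x.
    have t1p : 0 < 1 + t by rewrite addr_gt0.
    rewrite lef_pV2 ?posrE //; last exact: mulr_gt0.
    by rewrite -[leLHS]mul1r ler_pM2r // lerDl; exact: ltW.
have b1 : bdry F G 1 <= CC * (2 * pi) * y0.
  have -> : CC * (2 * pi) * y0 = xint (fun=> CC * y0) by rewrite xint_cst; ring.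
  apply: le_xint.
  - exact: (jcontx cB (yc 1 ler01)).
  - by move=> x; exact: cvg_cst.
  - move=> x hx; have [g1 g2] := green_1 x0 y00 y01 t0 t1 x.
    have e12 : 1 <= 1 + e <= 2 by clear - e0 e1; apply/andP; split; lra.
    have h1 := hK1 _ _ hx e12; have h2 := hK2 _ _ hx e12.
    have a1 : `|j0 F x 1 * jy G x 1| <= 90 * y0 * K2.
      by rewrite normrM; apply: ler_pM.
    have a2 : `|j0 G x 1 * jy F x 1| <= K1 * (3000 * y0).
      by rewrite normrM; apply: ler_pM.
    apply: le_trans (ler_norm _) _; apply: le_trans (ler_normB _ _) _.
    apply: le_trans (lerD a1 a2) _.
    by rewrite CCE; clear; lra.
move: jump m1 m2 b0 b1.
set X1 := bdry _ _ _; set X2 := bdry _ _ _; set X3 := bdry _ _ _; set X4 := bdry _ _ _.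
set X5 := xint _; set X6 := _ * _ * y0.
by clear - w0; lra.
Qed.

(** * The chain rule in the plane *)

Section Plane.
Variable R : realType.
Implicit Types (w : R * R -> R) (z : R * R).

Notation plane := (R * R)%type.

Lemma add_e1 (s u v : R) : s *: e1 R + (u, v) = (s *: (1 : R) + u, v).
Proof.
transitivity (s *: (1 : R) + u, s *: (0 : R) + v); first by [].
by rewrite scaler0 add0r.
Qed.

Lemma add_e2 (s u v : R) : s *: e2 R + (u, v) = (u, s *: (1 : R) + v).
Proof.
transitivity (s *: (0 : R) + u, s *: (1 : R) + v); first by [].
by rewrite scaler0 add0r.
Qed.

Lemma slice1 w (u v : R) : derivable w (u, v) (e1 R) ->
  is_derive u 1 (fun s => w (s, v)) ('D_(e1 R) w (u, v)).
Proof.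
move=> h.
have E : (fun h : R => h^-1 *: ((w \o shift (u, v)) (h *: e1 R) - w (u, v))) =
   (fun h : R => h^-1 *: (((fun s => w (s, v)) \o shift u) (h *: (1 : R)) - w (u, v))).
  apply/funext => s /=; congr (_ *: (w _ - _)).
  exact: add_e1.
split; first by move: h; rewrite /derivable E.
by rewrite /derive E.
Qed.

Lemma slice2 w (u v : R) : derivable w (u, v) (e2 R) ->
  is_derive v 1 (fun s => w (u, s)) ('D_(e2 R) w (u, v)).
Proof.
move=> h.
have E : (fun h : R => h^-1 *: ((w \o shift (u, v)) (h *: e2 R) - w (u, v))) =
   (fun h : R => h^-1 *: (((fun s => w (u, s)) \o shift v) (h *: (1 : R)) - w (u, v))).
  apply/funext => s /=; congr (_ *: (w _ - _)).
  exact: add_e2.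
split; first by move: h; rewrite /derivable E.
by rewrite /derive E.
Qed.

Lemma disk_open : open (disk : set plane).
Proof.
have -> : (disk : set plane) = (fun z : plane => z.1 ^+ 2 + z.2 ^+ 2) @^-1` [set x | x < 1].
  by [].
apply: open_comp; last exact: open_lt.
move=> z _; apply: cvgD; rewrite expr2.
  by under eq_fun do rewrite expr2; apply: cvgM; exact: cvg_fst.
by under eq_fun do rewrite expr2; apply: cvgM; exact: cvg_snd.
Qed.

Lemma MVT_around (f df : R -> R) (a u : R) :
  (forall s, `|a - s| <= `|a - u| -> is_derive s 1 f (df s)) ->
  exists2 c, `|a - c| <= `|a - u| & f u - f a = df c * (u - a).
Proof.
move=> hd; have [au|ua] := leP a u.
  have [|d hd' e] := @MVT_dv _ f df _ _ au; first by move=> s hs; apply: hd; rewrite !ler0_norm; lra.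
  by exists d; rewrite ?ler0_norm; lra.
have [|d hd' e] := @MVT_dv _ f df _ _ (ltW ua); first by move=> s hs; apply: hd; rewrite !ger0_norm; lra.
exists d; first by rewrite !ger0_norm; lra.
by rewrite -[LHS]opprB e; ring.
Qed.

(** The increment of [w] is split along the two sides of a rectangle.  Along the
first side it is A (u, v) (u - a), where the difference quotient A is jointly
continuous by the mean value theorem; the second side has its first coordinate
fixed, and one-variable differentiability is enough. *)
Lemma chain w (p q : R -> R) (t dp dq : R) : Ck_on 1 disk w ->
  disk (p t, q t) -> is_derive t 1 p dp -> is_derive t 1 q dq ->
  is_derive t 1 (fun s => w (p s, q s))
    ('D_(e1 R) w (p t, q t) * dp + 'D_(e2 R) w (p t, q t) * dq).
Proof.
move=> [cw hw] hD hp hq.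
have [d1w [c1w _]] := hw (e1 R) (or_introl erefl).
have [d2w [c2w _]] := hw (e2 R) (or_intror erefl).
set a := p t in hD *; set b := q t in hD *.
set w1 := 'D_(e1 R) w in d1w c1w *; set w2 := 'D_(e2 R) w in d2w c2w *.
(* the difference quotient in the first variable, with its limit on u = a *)
pose A (u v : R) := if u == a then w1 (a, v) else (w (u, v) - w (a, v)) / (u - a).
have AE u v : w (u, v) - w (a, v) = A u v * (u - a).
  rewrite /A; case: eqVneq => [->|ua]; first by rewrite !subrr mulr0.
  by rewrite divfK // subr_eq0.
have cA : A z.1 z.2 @[z --> ((a, b) : plane)] --> A a b.
  rewrite {2}/A eqxx; apply/cvgrPdist_lt => eps eps0.
  have /nbhs_ballP[d1 /= d10 hd1] : \forall z \near ((a, b) : plane), disk z.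
    by apply: open_nbhs_nbhs; split => //; exact: disk_open.
  have /nbhs_ballP[d2 /= d20 hd2] :
      \forall z \near ((a, b) : plane), `|w1 (a, b) - w1 z| < eps.
    by have /cvgrPdist_lt /(_ _ eps0) := c1w _ hD.
  suff : \forall z \near ((a, b) : plane), `|w1 (a, b) - A z.1 z.2| < eps by [].
  apply/nbhs_ballP; exists (Num.min d1 d2) => /=; first by rewrite lt_min d10.
  move=> [u v] [/= hu hv].
  have hb (s : R) : `|a - s| <= `|a - u| -> disk (s, v) /\ `|w1 (a, b) - w1 (s, v)| < eps.
    move=> hs; split.
      apply: hd1; split => /=.
        by rewrite /ball /=; apply: le_lt_trans hs _; apply: lt_le_trans hu _; rewrite ge_min lexx.
      by rewrite /ball /=; apply: lt_le_trans hv _; rewrite ge_min lexx.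
    apply: (hd2 (s, v)); split => /=.
      by rewrite /ball /=; apply: le_lt_trans hs _; apply: lt_le_trans hu _; rewrite ge_min lexx orbT.
    by rewrite /ball /=; apply: lt_le_trans hv _; rewrite ge_min lexx orbT.
  rewrite /A /=; case: eqVneq => [_|ua].
    by apply: (hb a _).2; rewrite subrr normr0.
  have [c hc ->] : exists2 c, `|a - c| <= `|a - u| &
      w (u, v) - w (a, v) = w1 (c, v) * (u - a).
    apply: (@MVT_around (fun s => w (s, v)) (fun s => w1 (s, v))) => s hs.
    by apply: slice1; apply: d1w; exact: (hb s hs).1.
  by rewrite mulfK ?subr_eq0 //; exact: (hb c hc).2.
have /is_derive1_caratheodory[B [BE cB B2]] := slice2 (d2w _ hD).
have /is_derive1_caratheodory[P [PE cP P2]] := hp.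
have /is_derive1_caratheodory[Q [QE cQ Q2]] := hq.
have ctp : p s @[s --> t] --> a := dv_cont hp.
have ctq : q s @[s --> t] --> b := dv_cont hq.
apply/is_derive1_caratheodory.
exists (fun s => A (p s) (q s) * P s + B (q s) * Q s); split.
- move=> s.
  have -> : w (p s, q s) - w (p t, q t) = (w (p s, q s) - w (a, q s)) + (w (a, q s) - w (a, b)).
    by rewrite /a /b; ring.
  rewrite AE BE -/a -/b; have := PE s; have := QE s; rewrite -/a -/b => -> ->; ring.
- apply: cvgD; apply: cvgM => //.
  + exact: (continuous2_cvg _ cA ctp ctq).
  + exact: (cvg_comp _ _ ctq cB).
- by rewrite -/a -/b B2 P2 Q2 /A eqxx.
Qed.
End Plane.

(** * Polar coordinates and tangent solutions *)

Section Polar.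
Variable R : realType.
Implicit Types (w : R * R -> R) (z : R * R).

Notation plane := (R * R)%type.

(** The point exp (- y + i x). *)
Definition zp (x y : R) : plane := polar (expR (- y)) x.

Lemma disk_zp (x y : R) : 0 < y -> disk (zp x y).
Proof.
move=> y0; rewrite /disk /zp /polar /= !exprMn -mulrDr cos2Dsin2 mulr1.
by rewrite -expRM_natl expR_lt1; lra.
Qed.

Lemma jcont_polar : jcont 0 (fun x y => expR (- y) * cos x : R) /\
  jcont 0 (fun x y => expR (- y) * sin x : R).
Proof.
have ce := jcont_exp (jcontN (@jcont_y R 0)).
by split; apply: jcontM => //; [apply: jcont_cos | apply: jcont_sin]; exact: jcont_x.
Qed.

Lemma jcont_zp w : (forall z, disk z -> {for z, continuous w}) ->
  jcont 0 (fun x y => w (zp x y)).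
Proof.
move=> cw x y y0.
have [c1 c2] := jcont_polar.
apply: (@continuous2_cvg _ _ _ _ _ _
  (fun z => expR (- z.2) * cos z.1) (fun z => expR (- z.2) * sin z.1) (fun u v => w (u, v))).
- have := cw _ (disk_zp x y0); rewrite /prop_for /continuous_at.
  by under [in X in _ -> X]eq_fun do rewrite -surjective_pairing.
- exact: c1 x y y0.
- exact: c2 x y y0.
Qed.

(** The chain rule applied twice along [zp]; [D1], [D2], ... stand for the partial
derivatives of [w]. *)
Definition jpol (w D1 D2 D11 D12 D21 D22 : plane -> R) : jet R :=
  let p x y := expR (- y) * cos x in let q x y := expR (- y) * sin x in
  Jet (fun x y => w (zp x y))
   (fun x y => D1 (zp x y) * (- q x y) + D2 (zp x y) * p x y)
   (fun x y => D1 (zp x y) * (- p x y) + D2 (zp x y) * (- q x y))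
   (fun x y => D1 (zp x y) * (- p x y)
     + (D11 (zp x y) * (- q x y) + D12 (zp x y) * p x y) * (- q x y)
     + (D2 (zp x y) * (- q x y)
     + (D21 (zp x y) * (- q x y) + D22 (zp x y) * p x y) * p x y))
   (fun x y => D1 (zp x y) * p x y
     + (D11 (zp x y) * (- p x y) + D12 (zp x y) * (- q x y)) * (- p x y)
     + (D2 (zp x y) * q x y
     + (D21 (zp x y) * (- p x y) + D22 (zp x y) * (- q x y)) * (- q x y))).

Definition jpolar w := jpol w ('D_(e1 R) w) ('D_(e2 R) w)
  ('D_(e1 R) ('D_(e1 R) w)) ('D_(e2 R) ('D_(e1 R) w))
  ('D_(e1 R) ('D_(e2 R) w)) ('D_(e2 R) ('D_(e2 R) w)).

Lemma Ck_on12 w : Ck_on 2 disk w -> Ck_on 1 disk w.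
Proof.
move=> [cw hw]; split => // v hv; have [dw [cdw _]] := hw v hv.
by split.
Qed.

(** The chain rule for [f] along the polar map, with [f1] and [f2] in the place of
its partial derivatives. *)
Definition polar_dv (f f1 f2 : plane -> R) := forall x y : R, 0 < y ->
  is_derive x 1 (fun x => f (zp x y))
    (f1 (zp x y) * (- (expR (- y) * sin x)) + f2 (zp x y) * (expR (- y) * cos x)) /\
  is_derive y 1 (fun y => f (zp x y))
    (f1 (zp x y) * (- (expR (- y) * cos x)) + f2 (zp x y) * (- (expR (- y) * sin x))).

Lemma polar_trig :
  [/\ forall x y : R, is_derive x 1 (fun x => expR (- y) * cos x) (- (expR (- y) * sin x)),
   forall x y : R, is_derive x 1 (fun x => expR (- y) * sin x) (expR (- y) * cos x),
   forall x y : R, is_derive y 1 (fun y => expR (- y) * cos x) (- (expR (- y) * cos x)) &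
   forall x y : R, is_derive y 1 (fun y => expR (- y) * sin x) (- (expR (- y) * sin x))].
Proof.
split => x y.
- by apply: (dv_eq (dvM (dvc x _) (dv_cos (dvid x)))); ring.
- by apply: (dv_eq (dvM (dvc x _) (dv_sin (dvid x)))); ring.
- by apply: (dv_eq (dvM (dv_exp (dvN (dvid y))) (dvc y _))); ring.
- by apply: (dv_eq (dvM (dv_exp (dvN (dvid y))) (dvc y _))); ring.
Qed.

Lemma Ck_polar_dv f : Ck_on 1 disk f -> polar_dv f ('D_(e1 R) f) ('D_(e2 R) f).
Proof.
have [dpx dqx dpy dqy] := polar_trig; move=> hf x y y0; split.
- exact: (@chain R f (fun x => expR (- y) * cos x) (fun x => expR (- y) * sin x) x _ _ hf (disk_zp x y0) (dpx x y) (dqx x y)).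
- exact: (@chain R f (fun y => expR (- y) * cos x) (fun y => expR (- y) * sin x) y _ _ hf (disk_zp x y0) (dpy x y) (dqy x y)).
Qed.

Lemma C2_pol (w D1 D2 D11 D12 D21 D22 : plane -> R) :
  polar_dv w D1 D2 -> polar_dv D1 D11 D12 -> polar_dv D2 D21 D22 ->
  jcont 0 (fun x y => w (zp x y)) ->
  jcont 0 (fun x y => D1 (zp x y)) -> jcont 0 (fun x y => D2 (zp x y)) ->
  jcont 0 (fun x y => D11 (zp x y)) -> jcont 0 (fun x y => D12 (zp x y)) ->
  jcont 0 (fun x y => D21 (zp x y)) -> jcont 0 (fun x y => D22 (zp x y)) ->
  C2 0 (jpol w D1 D2 D11 D12 D21 D22).
Proof.
move=> hw h1 h2 j0 j1 j2 j11 j12 j21 j22; have [dpx dqx dpy dqy] := polar_trig.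
have [jp jq] := jcont_polar.
have jnp := jcontN jp; have jnq := jcontN jq.
split.
- by move=> x y y0; exact: (hw x y y0).1.
- by move=> x y y0; exact: (hw x y y0).2.
- move=> x y y0.
  apply: (dv_eq (dvD (dvM (h1 x y y0).1 (dvN (dqx x y))) (dvM (h2 x y y0).1 (dpx x y)))).
  by rewrite /=; ring.
- move=> x y y0.
  apply: (dv_eq (dvD (dvM (h1 x y y0).2 (dvN (dpy x y))) (dvM (h2 x y y0).2 (dvN (dqy x y))))).
  by rewrite /=; ring.
- exact: j0.
- exact: jcontD (jcontM j1 jnq) (jcontM j2 jp).
- exact: jcontD (jcontM j1 jnp) (jcontM j2 jnq).
- exact: jcontD (jcontD (jcontM j1 jnp) (jcontM (jcontD (jcontM j11 jnq) (jcontM j12 jp)) jnq))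
    (jcontD (jcontM j2 jnq) (jcontM (jcontD (jcontM j21 jnq) (jcontM j22 jp)) jp)).
- exact: jcontD (jcontD (jcontM j1 jp) (jcontM (jcontD (jcontM j11 jnp) (jcontM j12 jnq)) jnp))
    (jcontD (jcontM j2 jq) (jcontM (jcontD (jcontM j21 jnp) (jcontM j22 jnq)) jnq)).
Qed.

Lemma C2_polar w : Ck_on 2 disk w -> C2 0 (jpolar w).
Proof.
move=> h2; have h1 := Ck_on12 h2.
have [_ k1] := h2.2 (e1 R) (or_introl erefl).
have [_ k2] := h2.2 (e2 R) (or_intror erefl).
have [_ [c11 _]] := k1.2 (e1 R) (or_introl erefl).
have [_ [c12 _]] := k1.2 (e2 R) (or_intror erefl).
have [_ [c21 _]] := k2.2 (e1 R) (or_introl erefl).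
have [_ [c22 _]] := k2.2 (e2 R) (or_intror erefl).
exact: (C2_pol (Ck_polar_dv h1) (Ck_polar_dv k1) (Ck_polar_dv k2)
  (jcont_zp h1.1) (jcont_zp k1.1) (jcont_zp k2.1)
  (jcont_zp c11) (jcont_zp c12) (jcont_zp c21) (jcont_zp c22)).
Qed.

Lemma cos_sin_2pi : cos (2 * pi) = cos 0 :> R /\ sin (2 * pi) = sin 0 :> R.
Proof.
have e : 2 * pi = 0 + pi *+ 2 :> R by rewrite add0r -(mulr_natl pi).
by rewrite e cosD2pi sinD2pi.
Qed.

Lemma zp_period y : zp 0 y = zp (2 * pi) y.
Proof. by have [c s] := cos_sin_2pi; rewrite /zp /polar c s. Qed.

Lemma periodic_pol w D1 D2 D11 D12 D21 D22 : periodic (jpol w D1 D2 D11 D12 D21 D22).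
Proof.
move=> y; have e := zp_period y; split; first by rewrite /= e.
by have [c s] := cos_sin_2pi; rewrite /= e c s.
Qed.

(** The map [zp] is conformal with derivative of modulus exp (- y). *)
Lemma lap_pol w D1 D2 D11 D12 D21 D22 x y :
  lap (jpol w D1 D2 D11 D12 D21 D22) x y =
  expR (- y) ^+ 2 * (D11 (zp x y) + D22 (zp x y)).
Proof.
transitivity (expR (- y) ^+ 2 * (cos x ^+ 2 + sin x ^+ 2) * (D11 (zp x y) + D22 (zp x y))).
  by rewrite /lap /=; ring.
by rewrite cos2Dsin2 mulr1.
Qed.

Lemma lap_polar w x y :
  lap (jpolar w) x y = expR (- y) ^+ 2 * laplacian w (zp x y).
Proof. exact: lap_pol. Qed.

(* xi is the point of tangency *)
Section Tangent.
Variable xi : plane.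
Hypothesis xi1 : circle xi.

(** The distance from z to the tangent line at [xi]. *)
Definition tgt z : R := 1 - (z.1 * xi.1 + z.2 * xi.2).

Lemma tgt_gt0 z : disk z -> 0 < tgt z.
Proof.
move: xi1; rewrite /circle /disk /tgt /=.
case: z => [a b]; case: xi => [c d] /= h1 h2.
have := sqr_ge0 (a - c); have := sqr_ge0 (b - d); nra.
Qed.

Lemma tgt_cont z : {for z, continuous tgt}.
Proof.
apply: cvgB; first exact: cvg_cst.
by apply: cvgD; apply: cvgM; [exact: cvg_fst | exact: cvg_cst | exact: cvg_snd | exact: cvg_cst].
Qed.

Definition tpow (c p : R) z : R := c * tgt z `^ p.
Definition dotxi (v : plane) : R := v.1 * xi.1 + v.2 * xi.2.

Lemma tpow_cont c p z : disk z -> {for z, continuous (tpow c p)}.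
Proof.
move=> hz; apply: cvgM; first exact: cvg_cst.
have h := @is_derive1_powR R p (tgt z) (tgt_gt0 hz).
exact: (cvg_comp _ _ (@tgt_cont z) (dv_cont h)).
Qed.

(** A directional derivative of a power of [tgt] is again a multiple of such a
power, so smoothness of every order follows by induction ([Ck_tpow]). *)
Lemma tpow_dv c p z v : disk z ->
  is_derive z v (tpow c p) (tpow (- (c * p * dotxi v)) (p - 1) z).
Proof.
move=> hz.
pose g (h : R) := c * (tgt z - h * dotxi v) `^ p.
have dg : is_derive (0 : R) 1 g (- (c * p * dotxi v) * tgt z `^ (p - 1)).
  have p0 : 0 < tgt z - 0 * dotxi v by rewrite mul0r subr0; exact: tgt_gt0.
  have h1 := dvB (dvc (0 : R) (tgt z)) (dvM (dvid (0 : R)) (dvc (0 : R) (dotxi v))).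
  have h2 := dvM (dvc (0 : R) c) (@dvcomp _ (fun x => x `^ p) (fun h => tgt z - h * dotxi v) 0 _ _ (is_derive1_powR p p0) h1).
  apply: (dv_eq h2); rewrite mul0r subr0; ring.
have E : (fun h : R => h^-1 *: ((tpow c p \o shift z) (h *: v) - tpow c p z)) =
   (fun h : R => h^-1 *: ((g \o shift 0) (h *: (1 : R)) - g 0)).
  apply/funext => h; congr (_ *: (_ - _)); last by rewrite /g mul0r subr0.
  rewrite /tpow /g /= (_ : h *: (1 : R) + 0 = h); last by rewrite addr0 [_ *: _]mulr1.
  congr (_ * _ `^ _).
  have -> : h *: v + z = (h * v.1 + z.1, h * v.2 + z.2) by case: (z) (v) => [? ?] [? ?].
  by rewrite /tgt /dotxi /=; ring.
have [d1 d2] := dg.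
split; first by move: d1; rewrite /derivable E.
by rewrite /derive E; exact: d2.
Qed.

Lemma Ck_on_eq k (A : set plane) f g : open A -> (forall z, A z -> f z = g z) ->
  Ck_on k A f -> Ck_on k A g.
Proof.
move=> oA; elim: k f g => [|k ih] f g fg.
  move=> [cf _]; split => // z Az; rewrite /prop_for /continuous_at -fg //.
  apply: cvg_trans (cf z Az); apply: near_eq_cvg.
  have := open_nbhs_nbhs (conj oA Az); apply: filterS => y Ay; exact: fg.
move=> [cf hf]; split.
  move=> z Az; rewrite /prop_for /continuous_at -fg //.
  apply: cvg_trans (cf z Az); apply: near_eq_cvg.
  have := open_nbhs_nbhs (conj oA Az); apply: filterS => y Ay; exact: fg.
move=> v hv; have [d c] := hf v hv; split.
  move=> z Az; have n : \forall y \near z, f y = g y.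
    have := open_nbhs_nbhs (conj oA Az); apply: filterS => y Ay; exact: fg.
  exact: near_eq_derivable n (d z Az).
apply: ih c => z Az; apply: near_eq_derive.
have := open_nbhs_nbhs (conj oA Az); apply: filterS => y Ay; exact: fg.
Qed.

Lemma Ck_tpow k c p : Ck_on k disk (tpow c p).
Proof.
elim: k c p => [|k ih] c p; first by split => // z; exact: tpow_cont.
split; first by move=> z; exact: tpow_cont.
move=> v _; split; first by move=> z hz; case: (tpow_dv c p v hz).
apply: Ck_on_eq (ih (- (c * p * dotxi v)) (p - 1)); first exact: disk_open.
by move=> z hz; case: (tpow_dv c p v hz).
Qed.

Lemma lap_tpow c p z : disk z ->
  laplacian (tpow c p) z = c * p * (p - 1) * tgt z `^ (p - 2).
Proof.
move=> hz.
have h v : 'D_v ('D_v (tpow c p)) z = c * p * (p - 1) * dotxi v ^+ 2 * tgt z `^ (p - 2).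
  have n : \forall y \near z, tpow (- (c * p * dotxi v)) (p - 1) y = 'D_v (tpow c p) y.
    have := open_nbhs_nbhs (conj (@disk_open R) hz); apply: filterS => y Ay.
    by case: (tpow_dv c p v Ay) => _ ->.
  rewrite -(near_eq_derive _ n).
  have [_ ->] := tpow_dv (- (c * p * dotxi v)) (p - 1) v hz.
  by rewrite /tpow (_ : p - 1 - 1 = p - 2); [ring | ring].
have x1 : dotxi (e1 R) = xi.1 by rewrite /dotxi /e1 /= mul1r mul0r addr0.
have x2 : dotxi (e2 R) = xi.2 by rewrite /dotxi /e2 /= mul1r mul0r add0r.
apply: etrans (f_equal2 +%R (h (e1 R)) (h (e2 R))) _.
rewrite x1 x2 -mulrDl -mulrDr.
have -> : xi.1 ^+ 2 + xi.2 ^+ 2 = 1 := xi1.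
by rewrite mulr1.
Qed.

End Tangent.

End Polar.

(** * The difference between the maximal solution and another one *)

Section PDE.
Variable R : realType.
Notation plane := (R * R)%type.

Lemma Ck_sub k (A : set plane) (f g : plane -> R) : open A ->
  Ck_on k A f -> Ck_on k A g -> Ck_on k A (f \- g).
Proof.
move=> oA; elim: k f g => [|k ih] f g.
  by move=> [cf _] [cg _]; split => // z Az; apply: cvgB; [exact: cf | exact: cg].
move=> [cf hf] [cg hg]; split.
  by move=> z Az; apply: cvgB; [exact: cf | exact: cg].
move=> v hv; have [df kf] := hf v hv; have [dg kg] := hg v hv; split.
  by move=> z Az; apply: derivableB; [exact: df | exact: dg].
apply: Ck_on_eq (ih _ _ kf kg) => // z Az.
by rewrite deriveB; [|exact: df|exact: dg].
Qed.

Lemma lap_sub (f g : plane -> R) z : Ck_on 2 disk f -> Ck_on 2 disk g -> disk z ->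
  laplacian (f \- g) z = laplacian f z - laplacian g z.
Proof.
move=> kf kg Dz.
have h v : v = e1 R \/ v = e2 R ->
    'D_v ('D_v (f \- g)) z = 'D_v ('D_v f) z - 'D_v ('D_v g) z.
  move=> hv; have [df kdf] := kf.2 v hv; have [dg kdg] := kg.2 v hv.
  have [ddf _] := kdf.2 v hv; have [ddg _] := kdg.2 v hv.
  have n : \forall y \near z, ('D_v f - 'D_v g) y = 'D_v (f \- g) y.
    have := open_nbhs_nbhs (conj (@disk_open R) Dz); apply: filterS => y Ay.
    by rewrite deriveB; [|exact: df|exact: dg].
  by rewrite -(near_eq_derive _ n) deriveB; [|exact: ddf|exact: ddg].
apply: etrans (f_equal2 +%R (h (e1 R) (or_introl erefl)) (h (e2 R) (or_intror erefl))) _.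
by rewrite /laplacian opprD addrACA.
Qed.

Variable m : R.
Hypothesis hm : 3 < m.
Let kappa : R := 2 / (m - 1).
Let km : kappa * (m - 1) = 2.
Proof. by have h := hm; rewrite /kappa divfK // subr_eq0 gt_eqF //; lra. Qed.
Let k0 : 0 < kappa.
Proof. by have h := hm; rewrite /kappa divr_gt0 //; lra. Qed.

(** The constant A with A^m = A kappa (kappa + 1), which makes A tgt^(- kappa) a
solution. *)
Definition tangent_const : R := (kappa * (kappa + 1)) `^ (m - 1)^-1.

Lemma tangent_const_gt0 : 0 < tangent_const.
Proof. by rewrite powR_gt0 // mulr_gt0 // addr_gt0. Qed.

Lemma tcstE : tangent_const `^ (m - 1) = kappa * (kappa + 1).
Proof.
have h := hm; rewrite -powRrM mulVf ?powRr1 //; last by rewrite subr_eq0 gt_eqF //; lra.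
by rewrite mulr_ge0 ?addr_ge0 // ltW.
Qed.

(** The exponents match because kappa m = kappa + 2. *)
Lemma tangent_solution (xi : plane) : circle xi -> solution m (tpow xi tangent_const (- kappa)).
Proof.
move=> hxi; split; first exact: Ck_tpow.
move=> z hz; rewrite lap_tpow //.
have t0 := tgt_gt0 hxi hz; have A0 := tangent_const_gt0.
have p0 : 0 < tpow xi tangent_const (- kappa) z by rewrite /tpow mulr_gt0 // powR_gt0.
rewrite (max_l (ltW p0)) /tpow powRM ?powR_ge0 ?(ltW A0) // -powRrM.
have -> : - kappa * m = - kappa - 2 by rewrite -km; ring.
have -> : tangent_const `^ m = tangent_const * tangent_const `^ (m - 1).
  by have h := hm; rewrite mulr_powRB1 ?ltW //; lra.
by rewrite tcstE; ring.
Qed.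

(** The comparison is with the tangent solution at the boundary point nearest to
[zp x y], whose tangent line is at distance 1 - exp (- y). *)
Lemma maximal_ge (U : plane -> R) (x y : R) : maximal_solution m U -> 0 < y ->
  tangent_const * (1 - expR (- y)) `^ (- kappa) <= U (zp x y).
Proof.
move=> [_ hU] y0; pose xi : plane := polar 1 x.
have hxi : circle xi by rewrite /circle /xi /polar /= !mul1r cos2Dsin2.
have := hU _ (tangent_solution hxi) _ (disk_zp x y0).
rewrite /tpow (_ : tgt xi (zp x y) = 1 - expR (- y)) //.
rewrite /tgt /xi /zp /polar /=.
transitivity (1 - expR (- y) * (cos x ^+ 2 + sin x ^+ 2)); first by ring.
by rewrite cos2Dsin2 mulr1.
Qed.

(** Convexity of the m-th power.  The minimum is needed because for b < 0 the
positive part stops the growth of the right-hand side at a^m. *)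
Lemma pow_diff (L a b : R) : 0 < L -> L <= a -> b <= a ->
  L `^ (m - 1) * Num.min (a - b) L <= a `^ m - Num.max b 0 `^ m.
Proof.
move=> L0 La ba; have h := hm; have a0 : 0 < a by lra.
have m1 : 0 <= m - 1 by lra.
have split (x : R) : 0 < x -> x `^ m = x * x `^ (m - 1).
  by move=> x0; rewrite mulr_powRB1 ?ltW //; lra.
have LA : L `^ (m - 1) <= a `^ (m - 1) by apply: ge0_ler_powR; rewrite ?nnegrE //; lra.
have P0 : 0 <= L `^ (m - 1) by exact: powR_ge0.
have [b0|b0] := leP b 0.
  have m0 : m != 0 by rewrite gt_eqF //; lra.
  rewrite (powR0 m0) subr0 split //.
  apply: (@le_trans _ _ (L `^ (m - 1) * L)).
    by apply: ler_wpM2l => //; rewrite ge_min lexx orbT.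
  by rewrite mulrC; apply: ler_pM => //; exact: ltW.
rewrite !split //.
have bA : b `^ (m - 1) <= a `^ (m - 1) by apply: ge0_ler_powR; rewrite ?nnegrE //; lra.
apply: (@le_trans _ _ (L `^ (m - 1) * (a - b))).
  by apply: ler_wpM2l => //; rewrite ge_min lexx.
apply: (@le_trans _ _ (a `^ (m - 1) * (a - b))); first by apply: ler_wpM2r => //; lra.
by rewrite mulrBr (mulrC _ a) lerB // (mulrC _ b); apply: ler_wpM2l => //; exact: ltW.
Qed.

Definition decay_const : R := expR (-1) ^+ 2 * tangent_const `^ (m - 1) * Num.min tangent_const 1.

Lemma decay_const_gt0 : 0 < decay_const.
Proof.
rewrite /decay_const; apply: mulr_gt0; last by rewrite lt_min tangent_const_gt0 /=.
by apply: mulr_gt0; [rewrite exprn_gt0 // expR_gt0 | rewrite powR_gt0 // tangent_const_gt0].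
Qed.

Section Difference.
Variables U u : plane -> R.
Hypothesis hU : maximal_solution m U.
Hypothesis hu : solution m u.
Let W := jpolar (U \- u).

Lemma diff_C2 : C2 0 W.
Proof. by apply: C2_polar; apply: Ck_sub; [exact: disk_open | exact: hU.1.1 | exact: hu.1]. Qed.

Lemma diff_ge0 (x y : R) : 0 < y -> 0 <= j0 W x y.
Proof.
move=> y0; have := hU.2 _ hu _ (disk_zp x y0).
by rewrite -subr_ge0.
Qed.

Lemma diff_lap (x y : R) : 0 < y ->
  expR (- y) ^+ 2 * ((tangent_const * (1 - expR (- y)) `^ (- kappa)) `^ (m - 1) *
    Num.min (j0 W x y) (tangent_const * (1 - expR (- y)) `^ (- kappa))) <= lap W x y.
Proof.
move=> y0; have Dz := disk_zp x y0.
have -> : lap W x y = expR (- y) ^+ 2 * laplacian (U \- u) (zp x y) by exact: lap_polar.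
rewrite lap_sub //; [|exact: hU.1.1|exact: hu.1].
rewrite (hU.1.2 _ Dz) (hu.2 _ Dz); apply: ler_wpM2l; first exact: sqr_ge0.
have UL := maximal_ge x hU y0.
have e1 : expR (- y) < 1 by rewrite expR_lt1; lra.
have L0 : 0 < tangent_const * (1 - expR (- y)) `^ (- kappa).
  by rewrite mulr_gt0 ?tangent_const_gt0 // powR_gt0 // subr_gt0.
have U0 : 0 <= U (zp x y) by apply: le_trans UL; exact: ltW.
rewrite (max_l U0); apply: pow_diff => //.
exact: (hU.2 _ hu _ Dz).
Qed.

Lemma diff_lap_ge0 (x y : R) : 0 < y -> 0 <= lap W x y.
Proof.
move=> y0; apply: le_trans (diff_lap x y0).
apply: mulr_ge0; first exact: sqr_ge0.
apply: mulr_ge0; first exact: powR_ge0.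
rewrite le_min diff_ge0 //=; apply: mulr_ge0; [exact: ltW tangent_const_gt0 | exact: powR_ge0].
Qed.

(** Since kappa (m - 1) = 2, the lower bound A (1 - exp (- y))^(- kappa) of [U]
becomes y^(-2) when raised to the power m - 1, and 1 - exp (- y) <= y. *)
Lemma diff_lap_lower (x y : R) : 0 < y -> y <= 1 ->
  decay_const * y ^- 2 * Num.min (j0 W x y) (y `^ (- kappa)) <= lap W x y.
Proof.
move=> y0 y1; apply: le_trans (diff_lap x y0).
have h := hm; have A0 := tangent_const_gt0; have w0 := diff_ge0 x y0.
have e1 : expR (- y) < 1 by rewrite expR_lt1; lra.
have s0 : 0 < 1 - expR (- y) by lra.
have sy : 1 - expR (- y) <= y by have := expR_ge1Dx (- y); lra.
have pk : y `^ (- kappa) <= (1 - expR (- y)) `^ (- kappa).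
  rewrite !powRN lef_pV2 ?posrE ?powR_gt0 //.
  by apply: ge0_ler_powR; rewrite ?nnegrE; first [exact: ltW | lra].
set L := tangent_const * _; have LL : tangent_const * y `^ (- kappa) <= L by rewrite /L ler_pM2l.
have L0 : 0 < tangent_const * y `^ (- kappa) by rewrite mulr_gt0 // powR_gt0.
have Lm : tangent_const `^ (m - 1) * y ^- 2 <= L `^ (m - 1).
  apply: (@le_trans _ _ ((tangent_const * y `^ (- kappa)) `^ (m - 1))).
    rewrite powRM ?powR_ge0 ?(ltW A0) // -powRrM.
    have -> : - kappa * (m - 1) = - 2%:R by rewrite mulNr km.
    by rewrite powRN powR_mulrn // ltW.
  by apply: ge0_ler_powR; rewrite ?nnegrE; lra.
have e2 : expR (-1) ^+ 2 <= expR (- y) ^+ 2.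
  by apply: lerXn2r; rewrite ?nnegrE ?expR_ge0 // ler_expR; lra.
have mm : Num.min tangent_const 1 * Num.min (j0 W x y) (y `^ (- kappa)) <= Num.min (j0 W x y) L.
  have m0 : 0 <= Num.min tangent_const 1 by rewrite le_min ltW //= .
  rewrite le_min; apply/andP; split.
    apply: (@le_trans _ _ (1 * j0 W x y)); last by rewrite mul1r.
    apply: ler_pM => //; rewrite ?ge_min ?lexx ?orbT //.
    by rewrite le_min w0 powR_ge0.
  apply: le_trans LL; apply: ler_pM => //; rewrite ?ge_min ?lexx ?orbT //.
  by rewrite le_min w0 powR_ge0.
have y2 : 0 <= y ^- 2 by rewrite invr_ge0 sqr_ge0.
have -> : decay_const * y ^- 2 * Num.min (j0 W x y) (y `^ (- kappa)) =
   expR (-1) ^+ 2 * ((tangent_const `^ (m - 1) * y ^- 2) *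
   (Num.min tangent_const 1 * Num.min (j0 W x y) (y `^ (- kappa)))) by rewrite /decay_const; ring.
have n0 : 0 <= Num.min tangent_const 1 * Num.min (j0 W x y) (y `^ (- kappa)).
  by apply: mulr_ge0; rewrite le_min ?w0 ?powR_ge0 // ltW //=.
have t0 : 0 <= tangent_const `^ (m - 1) * y ^- 2 by apply: mulr_ge0 => //; exact: powR_ge0.
by apply: ler_pM => //; [exact: mulr_ge0 | exact: ler_pM].
Qed.

End Difference.
End PDE.

(** * The parameters of the Cantor set *)

Section Sequences.
Variable R : realType.

(** The weights a_k of the stages: their sum diverges, but the sum of their powers
of exponent 2 - alpha > 1 converges. *)
Definition weight (k : nat) : R := (20 * k.+1%:R)^-1.

Lemma weight_gt0 k : 0 < weight k.
Proof. by rewrite invr_gt0 mulr_gt0 // ltr0n. Qed.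

Lemma weight_le k : weight k <= 1 / 20.
Proof.
rewrite div1r lef_pV2 ?posrE ?mulr_gt0 ?ltr0n // ler_peMr ?ler0n //.
by rewrite ler1n.
Qed.

Lemma weight_dvg (A : R) : exists N, A <= \sum_(k < N) weight k.
Proof.
apply: contrapT => /forallNP h; apply: (@dvg_harmonic R).
apply: nondecreasing_is_cvgn.
  apply/nondecreasing_seqP => n; rewrite /series /= big_nat_recr //= lerDl.
  by rewrite invr_ge0 ler0n.
exists (20 * A) => _ [n _ <-].
have /negP := h n; rewrite -ltNge => /ltW hn.
have -> : series harmonic n = 20 * \sum_(k < n) weight k :> R.
  rewrite /series /= big_mkord mulr_sumr; apply: eq_bigr => k _.
  by rewrite /weight /harmonic invfM mulrA mulfV ?mul1r // pnatr_eq0.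
by rewrite ler_pM2l // ltr0n.
Qed.

(** Telescoping comparison with the differences of k^(- kappa). *)
Lemma pseries_le (kappa : R) (n : nat) : 0 < kappa ->
  \sum_(k < n) (k.+2%:R : R) `^ (- (1 + kappa)) <= kappa^-1.
Proof.
move=> k0.
have step (k : nat) : (k.+2%:R : R) `^ (- (1 + kappa)) <=
    kappa^-1 * ((k.+1%:R : R) `^ (- kappa) - (k.+2%:R : R) `^ (- kappa)).
  have p2 : 0 < (k.+2%:R : R) by rewrite ltr0n.
  have p1 : 0 < (k.+1%:R : R) by rewrite ltr0n.
  rewrite -(ler_pM2l k0) mulrA mulfV ?gt_eqF // mul1r.
  have -> : (k.+1%:R : R) = k.+2%:R * (1 - k.+2%:R^-1).
    by rewrite mulrBr mulr1 mulfV ?gt_eqF // -[k.+2]addn1 natrD addrK.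
  have u0 : 0 < (1 - k.+2%:R^-1 : R).
    by rewrite subr_gt0 invf_lt1 // ltr1n.
  rewrite powRM ?ler0n ?(ltW u0) //.
  have -> : (k.+2%:R : R) `^ (- (1 + kappa)) = k.+2%:R `^ (- kappa) * k.+2%:R^-1.
    rewrite opprD addrC powRD; last by apply/implyP => _; rewrite gt_eqF.
    by rewrite powR_inv1 // ltW.
  have key : kappa * k.+2%:R^-1 <= (1 - k.+2%:R^-1) `^ (- kappa) - 1.
    rewrite /powR gt_eqF //.
    have h1 := expR_ge1Dx (- kappa * ln (1 - k.+2%:R^-1) : R).
    have h2 : ln (1 - k.+2%:R^-1) <= - k.+2%:R^-1 :> R.
      by apply: le_ln1Dx; rewrite ltrN2 invf_lt1 // ltr1n.
    have h3 := ler_wpM2l (ltW k0) h2.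
    move: h1 h3; set l := ln _; set r := k.+2%:R^-1; set E := expR _ => h1 h3.
    rewrite mulNr in h1; rewrite mulrN in h3.
    by rewrite lerBrDr; apply: le_trans h1; rewrite addrC lerD2l lerNr.
  have h4 := ler_wpM2l (powR_ge0 k.+2%:R (- kappa)) key.
  by rewrite mulrBr mulr1 mulrCA in h4.
apply: (@le_trans _ _ (\sum_(k < n) (kappa^-1 * ((k.+1%:R : R) `^ (- kappa) - (k.+2%:R : R) `^ (- kappa))))).
  by apply: ler_sum => k _; exact: step.
rewrite -mulr_sumr; apply: ler_piMr; first by rewrite invr_ge0 ltW.
have -> : \sum_(i < n) ((i.+1%:R : R) `^ (- kappa) - i.+2%:R `^ (- kappa)) =
   1 - (n.+1%:R : R) `^ (- kappa).
  elim: n => [|n ih]; first by rewrite big_ord0 powR1 subrr.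
  by rewrite big_ord_recr /= ih; ring.
by rewrite gerBl powR_ge0.
Qed.

Lemma weight_pow_sum (alpha : R) (n : nat) : alpha < 1 ->
  \sum_(k < n) weight k.+1 `^ (2 - alpha) <= (1 - alpha)^-1.
Proof.
move=> a1; have k0 : 0 < 1 - alpha by lra.
apply: le_trans (pseries_le n k0); apply: ler_sum => k _.
have -> : 1 + (1 - alpha) = 2 - alpha by ring.
have p2 : 0 < (k.+2%:R : R) by rewrite ltr0n.
have -> : (k.+2%:R : R) `^ (- (2 - alpha)) = k.+2%:R^-1 `^ (2 - alpha).
  by rewrite -[k.+2%:R^-1]powR_inv1 ?ler0n // -powRrM mulN1r.
have h20 : 1 <= 20 :> R by rewrite ler1n.
apply: ge0_ler_powR; rewrite ?nnegrE.
- by lra.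
- exact: ltW (weight_gt0 _).
- by rewrite invr_ge0 ler0n.
by rewrite lef_pV2 ?posrE ?mulr_gt0 ?ltr0n // ler_peMl // ltW.
Qed.

(** Take q huge, then for M the integer part of the number that turns the last
condition into an equality.  Since alpha > 0 this number is large, and since
alpha < 1 it is small with respect to q. *)
Lemma cantor_step (alpha : R) (a B : R) (n N : nat) : 0 < alpha -> alpha < 1 ->
  0 < a -> a <= 1 -> (0 < n)%N -> (0 < N)%N ->
  exists q M : nat, [/\ (2 <= M)%N, (100 * M <= q)%N, B <= q%:R &
    (N * M)%N%:R <= (n * q)%N%:R `^ alpha * a `^ (2 - alpha) <= 2 * (N * M)%N%:R].
Proof.
move=> al0 al1 a0 a1 n0 N0.
have nR : 1 <= (n%:R : R) by rewrite ler1n.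
have NR : 1 <= (N%:R : R) by rewrite ler1n.
have ap0 : 0 < a `^ (2 - alpha) by rewrite powR_gt0.
have ap1 : a `^ (2 - alpha) <= 1.
  have e : (1 : R) `^ (2 - alpha) = 1 by rewrite powR1.
  by rewrite -[leRHS]e; apply: ge0_ler_powR; rewrite ?nnegrE; lra.
have kap : 0 < 1 - alpha by lra.
pose X1 : R := (100 * n%:R) `^ (1 - alpha)^-1.
pose X2 : R := (2 * N%:R / a `^ (2 - alpha)) `^ alpha^-1.
have X10 : 0 <= X1 by exact: powR_ge0.
have X20 : 0 <= X2 by exact: powR_ge0.
pose q := (Num.Def.truncn (X1 + X2 + `|B| + 1)).+1.
have qge : X1 + X2 + `|B| + 1 <= q%:R by apply: ltW; exact: truncnS_gt.
have B0 := normr_ge0 B; have BB := ler_norm B.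
have q1 : X1 <= q%:R by lra.
have q2 : X2 <= q%:R by lra.
have q0 : 0 < q%:R :> R by lra.
have e1 : 100 * n%:R <= (q%:R : R) `^ (1 - alpha).
  have -> : 100 * n%:R = X1 `^ (1 - alpha).
    have kn : 1 - alpha != 0 by rewrite gt_eqF.
    by rewrite /X1 -powRrM (mulVf kn) powRr1 // mulr_ge0 // ler0n.
  by apply: ge0_ler_powR; rewrite ?nnegrE // ltW.
have e2 : 2 * N%:R / a `^ (2 - alpha) <= (q%:R : R) `^ alpha.
  have -> : 2 * N%:R / a `^ (2 - alpha) = X2 `^ alpha.
    have aln : alpha != 0 by rewrite gt_eqF.
    rewrite /X2 -powRrM (mulVf aln) powRr1 //.
    by apply: divr_ge0; [lra | exact: ltW].
  by apply: ge0_ler_powR; rewrite ?nnegrE // ltW.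
pose x : R := (n * q)%N%:R `^ alpha * a `^ (2 - alpha) / N%:R.
have N0R : 0 < (N%:R : R) by lra.
have nq : (q%:R : R) `^ alpha <= (n * q)%N%:R `^ alpha.
  apply: ge0_ler_powR; rewrite ?nnegrE ?ler0n //; first exact: ltW.
  by rewrite ler_nat leq_pmull.
have x2 : 2 <= x.
  rewrite /x ler_pdivlMr // -ler_pdivrMr //.
  exact: le_trans e2 nq.
have x0 : 0 <= x by lra.
pose M := Num.Def.truncn x.
have /andP[M1 M2] : M%:R <= x < M.+1%:R by exact: truncn_itv.
have Mge2 : (2 <= M)%N.
  by rewrite -ltnS -(ltr_nat R); exact: le_lt_trans x2 M2.
have xN : x * N%:R = (n * q)%N%:R `^ alpha * a `^ (2 - alpha) by rewrite /x divfK // gt_eqF.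
exists q, M; split => //.
- rewrite -(ler_nat R) natrM.
  have xq : x <= n%:R * q%:R `^ alpha.
    rewrite /x natrM powRM ?ler0n // ler_pdivrMr //.
    have hn : (n%:R : R) `^ alpha <= n%:R.
      by rewrite -[leRHS](powRr1 (ler0n _ _)); apply: ler_powR => //; exact: ltW.
    have qa := powR_ge0 (q%:R : R) alpha.
    apply: (@le_trans _ _ (n%:R * q%:R `^ alpha)).
      apply: (@le_trans _ _ (n%:R `^ alpha * q%:R `^ alpha)).
        by apply: ler_piMr => //; apply: mulr_ge0 => //; exact: powR_ge0.
      exact: ler_wpM2r.
    by apply: ler_peMr => //; apply: mulr_ge0 => //; exact: ler0n.
  have qq : (q%:R : R) = q%:R `^ (1 - alpha) * q%:R `^ alpha.
    rewrite -powRD; last by apply/implyP => _; rewrite gt_eqF.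
    by rewrite subrK powRr1 // ltW.
  rewrite qq; apply: (@le_trans _ _ (100 * (n%:R * q%:R `^ alpha))).
    by rewrite ler_pM2l ?ltr0n //; exact: le_trans xq.
  by rewrite mulrA; apply: ler_wpM2r => //; exact: powR_ge0.
- by lra.
- rewrite -xN natrM; apply/andP; split; first by rewrite mulrC ler_pM2r.
  rewrite (_ : 2 * (N%:R * M%:R) = 2 * M%:R * N%:R); last by ring.
  rewrite ler_pM2r //.
  have : (1 : R) <= M%:R by rewrite ler1n (leq_trans _ Mge2).
  move: M2; rewrite -natr1; lra.
Qed.

End Sequences.

(** Level k has [N k] intervals, at points of the lattice with [n k] points on the
circle, and each has [M k] children.  By [c_lo] and [c_hi], N is comparable
with n^alpha a^(2 - alpha): the upper bound makes the lengths of the gaps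
summable to the power alpha, the lower bound makes the measure thin enough for
the stages.  The ranges of heights of successive stages are disjoint by [c_a]. *)
Record cantor (R : realType) (alpha : R) (n N M : nat -> nat) : Prop := Cantor {
  c_n0 : n 0 = 2;
  c_N0 : N 0 = 1;
  c_N : forall k, N k.+1 = (N k * M k)%N;
  c_n : forall k, exists2 q, n k.+1 = (n k * q)%N & (100 * M k <= q)%N;
  c_M : forall k, (2 <= M k)%N;
  c_a : forall k, 18 / (n k.+1)%:R <= weight R k / (n k)%:R / 2;
  c_lo : forall k, (N k.+1)%:R <= (n k.+1)%:R `^ alpha * weight R k.+1 `^ (2 - alpha);
  c_hi : forall k, (n k.+1)%:R `^ alpha * weight R k.+1 `^ (2 - alpha) <= 2 * (N k.+1)%:R }.

Lemma cantor_exists (R : realType) (alpha : R) : 0 < alpha -> alpha < 1 ->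
  exists n N M, cantor alpha n N M.
Proof.
move=> al0 al1.
pose P (x : nat * nat * nat) (y : nat * nat) :=
  let: (k, n, N) := x in let: (q, M) := y in (0 < n)%N -> (0 < N)%N ->
  [/\ (2 <= M)%N, (100 * M <= q)%N, 36 / weight R k <= q%:R &
    (N * M)%N%:R <= (n * q)%N%:R `^ alpha * weight R k.+1 `^ (2 - alpha) <= 2 * (N * M)%N%:R].
have [f hf] : {f & forall x, P x (f x)}.
  apply: (@choice _ _ P) => -[[k n] N]; rewrite /P.
  have [n0|n0] := ltnP 0 n; last by exists (0, 0)%N.
  have [N0|N0] := ltnP 0 N; last by exists (0, 0)%N.
  have a1 : weight R k.+1 <= 1 by have := weight_le R k.+1; lra.
  have [q [M h]] := cantor_step (36 / weight R k) al0 al1 (weight_gt0 R k.+1) a1 n0 N0.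
  by exists (q, M).
pose st := fix st k := if k is j.+1 then
   let: (n, N) := st j in let: (q, M) := f (j, n, N) in ((n * q)%N, (N * M)%N)
   else (2, 1)%N.
pose n k := (st k).1; pose N k := (st k).2.
pose q k := (f (k, n k, N k)).1; pose M k := (f (k, n k, N k)).2.
have stE k : st k.+1 = ((n k * q k)%N, (N k * M k)%N).
  rewrite /q /M /n /N [st k.+1]/=; case: (st k) => [a b] /=.
  by case: (f (k, a, b)) => c d.
have nS k : n k.+1 = (n k * q k)%N by rewrite {1}/n stE.
have NS k : N k.+1 = (N k * M k)%N by rewrite {1}/N stE.
have hP k : P (k, n k, N k) (q k, M k) by rewrite /q /M -surjective_pairing; exact: hf.
have pos k : (0 < n k)%N /\ (0 < N k)%N.
  elim: k => [|k [n0 N0]] //.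
  have [M2 Mq _ _] := hP k n0 N0.
  rewrite nS NS !muln_gt0 n0 N0 (leq_trans _ M2) //=; split => //.
  by apply: leq_trans Mq; rewrite muln_gt0 /= (leq_trans _ M2).
have hP' k := let: conj n0 N0 := pos k in hP k n0 N0.
exists n, N, M; split.
- by [].
- by [].
- exact: NS.
- by move=> k; have [_ Mq _ _] := hP' k; exists (q k).
- by move=> k; have [] := hP' k.
- move=> k; have [n0 N0] := pos k; have [_ _ Bq _] := hP' k.
  have a0 := weight_gt0 R k; have nR : 0 < (n k)%:R :> R by rewrite ltr0n.
  have q0 : 0 < (q k)%:R :> R by apply: lt_le_trans Bq; rewrite divr_gt0 ?ltr0n.
  rewrite nS natrM ler_pdivrMr ?mulr_gt0 //.
  rewrite (_ : _ * (_ * _) = weight R k * (q k)%:R / 2); last by field; rewrite gt_eqF.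
  move: Bq; rewrite ler_pdivrMr // mulrC => Bq; lra.
- by move=> k; have [_ _ _ /andP[+ _]] := hP' k; rewrite nS NS.
- by move=> k; have [_ _ _ /andP[_ +]] := hP' k; rewrite nS NS.
Qed.

(** * The Cantor set *)

Lemma pi_le4 (R : realType) : pi <= 4 :> R.
Proof. by have /andP[_] := @pihalf_02 R; rewrite ltr_pdivrMr //; lra. Qed.

Section Cantor.
Variables (R : realType) (alpha : R) (n N M : nat -> nat).
Hypothesis hc : cantor alpha n N M.

Definition mesh k : R := 2 * pi / (n k)%:R.

(** The children of an interval start at consecutive points of the finer lattice,
the first one at the left end of the parent. *)
Fixpoint left_end k i : R :=
  if k is j.+1 then left_end j (i %/ M j)%N + (i %% M j)%N%:R * mesh j.+1 else pi.

Definition child_span k : R := (M k).-1%:R * mesh k.+1.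
Definition span_sum k : R := \sum_(j < k) child_span j.
(** The length of the hull of the part of the Cantor set that descends from one
interval of level k, a tail of the series of the [child_span].  Taking these
hulls as the intervals of level k makes their ends points of the set. *)
Definition hull k : R := sup (range span_sum) - span_sum k.

Lemma M_gt0 k : (0 < M k)%N. Proof. by apply: leq_trans (c_M hc k). Qed.

Lemma n_gt0 k : (0 < n k)%N.
Proof.
elim: k => [|k ih]; first by rewrite (c_n0 hc).
have [q -> hq] := c_n hc k; rewrite muln_gt0 ih /=.
by apply: leq_trans hq; rewrite muln_gt0 M_gt0.
Qed.

Lemma N_gt0 k : (0 < N k)%N.
Proof.
by elim: k => [|k ih]; [rewrite (c_N0 hc) | rewrite (c_N hc) muln_gt0 ih M_gt0].
Qed.

Lemma nR_gt0 k : 0 < (n k)%:R :> R. Proof. by rewrite ltr0n n_gt0. Qed.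

Lemma mesh_gt0 k : 0 < mesh k.
Proof. by rewrite divr_gt0 ?nR_gt0 // mulr_gt0 // pi_gt0. Qed.

Lemma mesh_S k : (M k)%:R * mesh k.+1 <= mesh k / 100.
Proof.
have [q e hq] := c_n hc k; have s0 := mesh_gt0 k.
have Mq : 100 * (M k)%:R <= q%:R :> R by rewrite -natrM ler_nat.
have M0 : 0 < (M k)%:R :> R by rewrite ltr0n M_gt0.
have q0 : 0 < q%:R :> R by apply: lt_le_trans Mq; apply: mulr_gt0 M0; rewrite ltr0n.
have -> : mesh k.+1 = mesh k / q%:R.
  by rewrite /mesh e natrM invfM mulrA.
rewrite mulrCA ler_pM2l // ler_pdivrMr //.
by lra.
Qed.

Lemma mesh_S2 k : mesh k.+1 <= mesh k / 100.
Proof.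
apply: le_trans (mesh_S k); apply: ler_peMl; first exact: ltW (mesh_gt0 _).
by rewrite ler1n; exact: M_gt0.
Qed.

Lemma child_span_ge0 k : 0 <= child_span k.
Proof. by apply: mulr_ge0; [exact: ler0n | exact: ltW (mesh_gt0 _)]. Qed.

Lemma child_span_le k : child_span k <= mesh k / 100.
Proof.
apply: le_trans (mesh_S k); apply: ler_wpM2r; first exact: ltW (mesh_gt0 _).
by rewrite ler_nat leq_pred.
Qed.

Lemma span_sum_S k : span_sum k.+1 = span_sum k + child_span k.
Proof. by rewrite /span_sum big_ord_recr. Qed.

Lemma span_sum_le k j : span_sum (k + j) - span_sum k <= mesh k / 50 - mesh (k + j) / 50.
Proof.
elim: j => [|j ih]; first by rewrite addn0 !subrr.
rewrite addnS span_sum_S.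
have := child_span_le (k + j); have := mesh_S2 (k + j); have := mesh_gt0 (k + j).+1; lra.
Qed.

Lemma span_sum_nd k j : span_sum k <= span_sum (k + j).
Proof.
elim: j => [|j ih]; first by rewrite addn0.
by rewrite addnS span_sum_S; apply: le_trans ih _; rewrite lerDl child_span_ge0.
Qed.

Lemma span_sum_ub k j : span_sum j <= span_sum k + mesh k / 50.
Proof.
have s0 := mesh_gt0 k; have [kj|jk] := leqP k j.
  by have := span_sum_le k (j - k); rewrite subnKC //; have := mesh_gt0 j; lra.
by have := span_sum_nd j (k - j); rewrite subnKC ?(ltnW jk) //; lra.
Qed.

Lemma hull_bounds k : 0 <= hull k <= mesh k / 50.
Proof.
rewrite /hull subr_ge0 lerBlDl; apply/andP; split.
  by apply: ub_le_sup; [exists (span_sum k + mesh k / 50) => _ [j _ <-]; exact: span_sum_ub | exists k].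
by apply: ge_sup; [exists (span_sum 0), 0%N | move=> _ [j _ <-]; exact: span_sum_ub].
Qed.

Lemma hull_S k : hull k = child_span k + hull k.+1.
Proof. by rewrite /hull span_sum_S; ring. Qed.

Lemma left_end_child k i r : (r < M k)%N ->
  left_end k.+1 (i * M k + r) = left_end k i + r%:R * mesh k.+1.
Proof.
by move=> rM; rewrite /= divnMDl ?M_gt0 // divn_small // addn0 modnMDl modn_small.
Qed.

Lemma left_end_lattice k i : exists b : nat, left_end k i = pi + b%:R * mesh k.
Proof.
elim: k i => [|k ih] i; first by exists 0%N; rewrite mul0r addr0.
have [b e] := ih (i %/ M k)%N; have [q eq _] := c_n hc k.
have q0 : q%:R != 0 :> R.
  by have := n_gt0 k.+1; rewrite eq muln_gt0 pnatr_eq0 => /andP[_]; rewrite lt0n.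
have hs : mesh k = q%:R * mesh k.+1.
  by rewrite /mesh eq natrM; field; rewrite q0 gt_eqF ?nR_gt0.
by exists (b * q + i %% M k)%N; rewrite [LHS]/= e hs natrD natrM; ring.
Qed.

(** The descendants of an interval stay within less than one step of the lattice
of its own level, so the order of the ends is lexicographic. *)
Lemma left_end_sep k i j : (i <= j)%N -> (j < N k)%N ->
  (j%:R - i%:R) * mesh k <= left_end k j - left_end k i.
Proof.
elim: k i j => [|k ih] i j ij jN.
  have j0 : j = 0%N by move: jN; rewrite (c_N0 hc); case: (j).
  by have i0 : i = 0%N by [move: ij; rewrite j0; case: (i)]; rewrite i0 j0 !subrr mul0r.
have ij' : (i %/ M k <= j %/ M k)%N by exact: leq_div2r.
have jN' : (j %/ M k < N k)%N by rewrite ltn_divLR ?M_gt0 // -(c_N hc).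
have := ih _ _ ij' jN'; rewrite /=.
have eM (x : nat) : x%:R = (x %/ M k)%N%:R * (M k)%:R + (x %% M k)%N%:R :> R.
  by rewrite {1}(divn_eq x (M k)) natrD natrM.
rewrite (eM i) (eM j).
have : (i %/ M k)%N%:R <= (j %/ M k)%N%:R :> R by rewrite ler_nat.
have := mesh_S k; have := mesh_gt0 k; move: (left_end _ _) (left_end _ _) => P Q.
move: ((i %/ M k)%N%:R) ((j %/ M k)%N%:R) ((i %% M k)%N%:R) ((j %% M k)%N%:R) => a b c d.
move: (mesh k) (mesh k.+1) ((M k)%:R) => s s' m s0 h1 ab h2.
have h3 : (b - a) * (m * s') <= (b - a) * s by apply: ler_wpM2l; lra.
lra.
Qed.

Definition cantor_level k : set R := [set t | exists2 i, (i < N k)%N & left_end k i <= t <= left_end k i + hull k].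
Definition cantor_set : set R := [set t | forall k, cantor_level k t].

Lemma cantor_level_nest k t : cantor_level k.+1 t -> cantor_level k t.
Proof.
move=> [i iN /andP[h1 h2]]; exists (i %/ M k)%N.
  by rewrite ltn_divLR ?M_gt0 // -(c_N hc).
move: h1 h2; rewrite /= (hull_S k) => h1 h2.
have r0 : 0 <= (i %% M k)%N%:R * mesh k.+1 :> R.
  by apply: mulr_ge0; [exact: ler0n | exact: ltW (mesh_gt0 _)].
have r1 : (i %% M k)%N%:R * mesh k.+1 <= child_span k.
  apply: ler_wpM2r; first exact: ltW (mesh_gt0 _).
  by rewrite ler_nat -ltnS prednK ?M_gt0 // ltn_pmod // M_gt0.
by apply/andP; split; lra.
Qed.

Lemma cantor_level_le k j t : (k <= j)%N -> cantor_level j t -> cantor_level k t.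
Proof.
move=> /subnK <-; elim: (j - k)%N => [|d ih] //.
by rewrite addSn => /cantor_level_nest.
Qed.

Lemma left_end_down k i j : (i < N k)%N -> (k <= j)%N ->
  exists2 i', (i' < N j)%N & left_end j i' = left_end k i.
Proof.
move=> iN /subnK <-; elim: (j - k)%N => [|d [i' i'N e]]; first by exists i.
rewrite addSn; exists (i' * M (d + k) + 0)%N.
  by rewrite addn0 (c_N hc) ltn_pmul2r ?M_gt0.
by rewrite left_end_child ?M_gt0 // mul0r addr0.
Qed.

Lemma left_end_down_r k i j : (i < N k)%N -> (k <= j)%N ->
  exists2 i', (i' < N j)%N & left_end j i' + hull j = left_end k i + hull k.
Proof.
move=> iN /subnK <-; elim: (j - k)%N => [|d [i' i'N e]]; first by exists i.
rewrite addSn; exists (i' * M (d + k) + (M (d + k)).-1)%N.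
  rewrite (c_N hc); apply: (@leq_trans ((i'.+1) * M (d + k))).
    by rewrite mulSnr ltn_add2l prednK ?M_gt0.
  by rewrite leq_pmul2r ?M_gt0.
have lM : ((M (d + k)).-1 < M (d + k))%N by rewrite ltn_predL M_gt0.
by rewrite (left_end_child _ lM) -e (hull_S (d + k)) /child_span; ring.
Qed.

(** A left end is the left end of a descendant at each later level. *)
Lemma left_end_in k i : (i < N k)%N -> cantor_set (left_end k i).
Proof.
move=> iN j; have /andP[l0 _] := hull_bounds j.
have [jk|kj] := leqP k j.
  by have [i' i'N e] := left_end_down iN jk; exists i' => //; rewrite e; apply/andP; split; lra.
apply: (@cantor_level_le j k); first exact: ltnW.
have /andP[l1 _] := hull_bounds k.
by exists i => //; apply/andP; split; lra.
Qed.

(** A right end is the right end of a descendant at each later level. *)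
Lemma right_end_in k i : (i < N k)%N -> cantor_set (left_end k i + hull k).
Proof.
move=> iN j; have /andP[l0 _] := hull_bounds j.
have [jk|kj] := leqP k j.
  by have [i' i'N e] := left_end_down_r iN jk; exists i' => //; rewrite -e; apply/andP; split; lra.
apply: (@cantor_level_le j k); first exact: ltnW.
have /andP[l1 _] := hull_bounds k.
by exists i => //; apply/andP; split; lra.
Qed.

Lemma cantor_set_range t : cantor_set t -> pi <= t <= pi + 1.
Proof.
move=> /(_ 0%N) [i]; rewrite (c_N0 hc) => iN /=.
have /andP[_ l] := hull_bounds 0; have p4 := pi_le4 R.
move: l; rewrite /mesh (c_n0 hc) => l /andP[h1 h2]; apply/andP; split; lra.
Qed.

Lemma cantor_set_closed : closed cantor_set.
Proof.
have -> : cantor_set = \bigcap_k cantor_level k by apply/seteqP; split => [t h k _|t h k]; exact: h.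
apply: closed_bigI => k _.
have -> : cantor_level k = \bigcup_(i in [set i | (i < N k)%N]) `[left_end k i, left_end k i + hull k]%classic.
  apply/seteqP; split => t [i iN hi]; exists i => //; by move: hi; rewrite /= in_itv.
apply: closed_bigcup => [|i _]; last exact: itv_closed.
exact: finite_II.
Qed.

(** The index of the interval of level [k] that carries the parameter [tau] in
[0, 1]; the minimum only serves tau = 1. *)
Definition cell k (tau : R) : nat := minn (Num.Def.truncn ((N k)%:R * tau)) (N k).-1.

Lemma cell_lt k tau : (cell k tau < N k)%N.
Proof. by rewrite /cell gtn_min prednK ?N_gt0 // leqnn orbT. Qed.

Lemma cell_div k tau : (cell k.+1 tau %/ M k)%N = cell k tau.
Proof.
have Mk := M_gt0 k; have Nk := N_gt0 k.
have hdiv : (Num.Def.truncn ((N k.+1)%:R * tau) %/ M k)%N = Num.Def.truncn ((N k)%:R * tau).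
  have [t0|t0] := leP 0 tau; last first.
    have neg (m : nat) : Num.Def.truncn (m%:R * tau) = 0%N.
      apply/truncn0Pn; rewrite -ltNge; apply: (@le_lt_trans _ _ 0) => //.
      by apply: mulr_ge0_le0; [exact: ler0n | exact: ltW].
    by rewrite !neg div0n.
  have p0 (m : nat) : 0 <= m%:R * tau by rewrite mulr_ge0.
  have /andP[h1 h2] := truncn_itv (p0 (N k.+1)).
  apply/esym/truncn_def.
  set x := Num.Def.truncn _ in h1 h2 *.
  have M0 : 0 < (M k)%:R :> R by rewrite ltr0n.
  have e : (N k.+1)%:R * tau = (M k)%:R * ((N k)%:R * tau) by rewrite (c_N hc) natrM; ring.
  rewrite e in h1 h2.
  apply/andP; split.
    rewrite -(ler_pM2l M0); apply: le_trans h1.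
    by rewrite -natrM ler_nat mulnC leq_trunc_div.
  rewrite -(ltr_pM2l M0); apply: lt_le_trans h2 _.
  by rewrite -natrM ler_nat mulnC ltn_ceil.
have hN : ((N k.+1).-1 %/ M k)%N = (N k).-1.
  by rewrite (c_N hc) -{1}(prednK Nk) mulSn addnC -subn1 -addnBA // divnMDl // subn1 divn_small ?addn0 // prednK.
rewrite /cell; have [h|h] := leqP (Num.Def.truncn ((N k.+1)%:R * tau)) (N k.+1).-1.
  by rewrite hdiv (minn_idPl _) // -hdiv -hN leq_div2r.
by rewrite hN (minn_idPr _) // -hdiv -hN leq_div2r // ltnW.
Qed.

(** The increasing map from [0, 1] to the Cantor set that gives each interval of
level k the same measure. *)
Definition cantor_fun (tau : R) : R := sup (range (fun k => left_end k (cell k tau))).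

Lemma left_end_idx_nd k j tau : left_end k (cell k tau) <= left_end (k + j) (cell (k + j) tau).
Proof.
elim: j => [|j ih]; first by rewrite addn0.
rewrite addnS; apply: le_trans ih _.
rewrite [leRHS]/= cell_div lerDl; apply: mulr_ge0; [exact: ler0n | exact: ltW (mesh_gt0 _)].
Qed.

Lemma left_end_idx_ni k j tau :
  left_end (k + j) (cell (k + j) tau) + hull (k + j) <= left_end k (cell k tau) + hull k.
Proof.
elim: j => [|j ih]; first by rewrite addn0.
rewrite addnS; apply: le_trans ih.
have h : (cell (k + j).+1 tau %% M (k + j))%N%:R * mesh (k + j).+1 <= child_span (k + j).
  apply: ler_wpM2r; first exact: ltW (mesh_gt0 _).
  by rewrite ler_nat -ltnS prednK ?M_gt0 // ltn_pmod // M_gt0.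
have -> : left_end (k + j).+1 (cell (k + j).+1 tau) = left_end (k + j) (cell (k + j) tau) +
   (cell (k + j).+1 tau %% M (k + j))%N%:R * mesh (k + j).+1 by rewrite [LHS]/= cell_div.
by rewrite (hull_S (k + j)) -addrA lerD2l lerD2r.
Qed.

Lemma left_end_idx_ub k j tau : left_end j (cell j tau) <= left_end k (cell k tau) + hull k.
Proof.
have [kj|jk] := leqP k j.
  have := left_end_idx_ni k (j - k) tau; rewrite subnKC //.
  by have /andP[] := hull_bounds j; lra.
have := left_end_idx_nd j (k - j) tau; rewrite subnKC ?(ltnW jk) //.
by have /andP[] := hull_bounds k; lra.
Qed.

Lemma cantor_fun_bounds k tau : left_end k (cell k tau) <= cantor_fun tau <= left_end k (cell k tau) + hull k.
Proof.
apply/andP; split.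
  apply: ub_le_sup; last by exists k.
  by exists (left_end 0 (cell 0 tau) + hull 0) => _ [j _ <-]; exact: left_end_idx_ub.
by apply: ge_sup; [exists (left_end 0 (cell 0 tau)), 0%N | move=> _ [j _ <-]; exact: left_end_idx_ub].
Qed.

Lemma cantor_fun_in tau : cantor_set (cantor_fun tau).
Proof. by move=> k; exists (cell k tau); [exact: cell_lt | exact: cantor_fun_bounds]. Qed.

Lemma cantor_fun_nd : {homo cantor_fun : x y / x <= y}.
Proof.
move=> x y xy; apply: ge_sup; first by exists (left_end 0 (cell 0 x)), 0%N.
move=> _ [k _ <-]; have /andP[h _] := cantor_fun_bounds k y; apply: le_trans h.
have ixy : (cell k x <= cell k y)%N.
  rewrite /cell leq_min geq_minr andbT; apply: leq_trans (geq_minl _ _) _.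
  by apply: le_truncn; apply: ler_wpM2l.
have := left_end_sep ixy (cell_lt k y).
have : 0 <= ((cell k y)%:R - (cell k x)%:R) * mesh k.
  by apply: mulr_ge0; [rewrite subr_ge0 ler_nat | exact: ltW (mesh_gt0 _)].
lra.
Qed.

End Cantor.

(** * The set on the circle and its measure *)

Section Circle.
Variable R : realType.

Lemma polar1_circle (t : R) : circle (polar 1 t).
Proof. by rewrite /circle/= !mul1r cos2Dsin2. Qed.

Lemma polar1_cont : continuous (polar (1 : R)).
Proof.
move=> t; have c1 : (1 * cos s : R) @[s --> t] --> (1 * cos t : R).
  by apply: cvgM; [exact: cvg_cst | exact: continuous_cos].
have c2 : (1 * sin s : R) @[s --> t] --> (1 * sin t : R).
  by apply: cvgM; [exact: cvg_cst | exact: continuous_sin].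
apply: (@continuous2_cvg _ _ _ _ _ _ (fun s => 1 * cos s) (fun s => 1 * sin s) (fun u v => (u, v))) => //.
by under [in X in X --> _]eq_fun do rewrite -surjective_pairing; exact: cvg_id.
Qed.

Lemma cos_eq1 (d : R) : - (2 * pi) < d < 2 * pi -> cos d = 1 -> d = 0.
Proof.
move=> /andP[d1 d2] h.
have e : cos d = 1 - 2 * sin (d / 2) ^+ 2.
  rewrite [in LHS](_ : d = d / 2 + d / 2); last by field.
  rewrite cosD -!expr2; have := cos2Dsin2 (d / 2); lra.
have s0 : sin (d / 2) = 0.
  by apply/eqP; rewrite -sqrf_eq0; apply/eqP; lra.
have [d0|d0|//] := ltgtP d 0.
- have : 0 < sin (- (d / 2)) by apply: sin_gt0_pi; apply/andP; split; lra.
  by rewrite sinN s0 oppr0 ltxx.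
- have : 0 < sin (d / 2) by apply: sin_gt0_pi; apply/andP; split; lra.
  by rewrite s0 ltxx.
Qed.

Lemma polar1_inj (s t : R) : 0 <= s < 2 * pi -> 0 <= t < 2 * pi ->
  polar 1 s = polar 1 t -> s = t.
Proof.
move=> /andP[s0 s1] /andP[t0 t1] [] ; rewrite !mul1r => ec es.
apply/eqP; rewrite -subr_eq0; apply/eqP; apply: cos_eq1.
  by apply/andP; split; lra.
by rewrite cosB ec es -!expr2 cos2Dsin2.
Qed.

Lemma polar1_surj (z : R * R) : circle z -> exists2 t : R, 0 <= t < 2 * pi & z = polar 1 t.
Proof.
case: z => x y; rewrite /circle/= => h.
have x1 : -1 <= x <= 1.
  have y2 := sqr_ge0 y; apply/andP; split; nra.
have [/andP[a0 a1] ea] := acos_def x1.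
have p0 := @pi_gt0 R.
have es : sin (acos x) = `|y|.
  rewrite sin_acos // -sqrtr_sqr; congr Num.sqrt; lra.
have [y0|y0] := leP 0 y.
  exists (acos x); first by apply/andP; split; lra.
  by rewrite /polar !mul1r ea es ger0_norm.
have an0 : acos x != 0.
  by apply/eqP => e0; move: es; rewrite e0 sin0 ltr0_norm //; lra.
exists (2 * pi - acos x).
  by apply/andP; split; [lra | rewrite ltrBlDr ltrDl lt_neqAle eq_sym an0].
rewrite /polar !mul1r mulr_natl cosB sinB cos2pi sin2pi !mul0r !mul1r addr0 sub0r ea es.
by rewrite ltr0_norm // opprK.
Qed.

End Circle.

Section Cantor.
Variables (R : realType) (alpha : R) (n N M : nat -> nat).
Hypothesis hc : cantor alpha n N M.
Let cantor_set : set R := cantor_set n N M.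
Definition cantor_arc_set : set (R * R) := polar 1 @` cantor_set.

Lemma cantor_set_2pi t : cantor_set t -> 0 <= t < 2 * pi.
Proof.
move=> /(cantor_set_range hc)/andP[h1 h2]; have p := @pi_ge2 R.
by apply/andP; split; lra.
Qed.

Lemma cantor_arc_set_circle : cantor_arc_set `<=` circle.
Proof. by move=> _ [t _ <-]; exact: polar1_circle. Qed.

Lemma cantor_arc_set_closed : closed cantor_arc_set.
Proof.
apply: compact_closed; first exact: norm_hausdorff.
apply: continuous_compact.
  by apply: continuous_subspaceT => t; exact: polar1_cont.
apply: (@subclosed_compact _ _ `[pi, pi + 1]%classic).
- exact: (@cantor_set_closed R n N M).
- exact: segment_compact.
- by move=> t /(cantor_set_range hc); rewrite /= in_itv.
Qed.

Lemma cantor_arc_set_polar (t : R) : 0 <= t < 2 * pi -> cantor_arc_set (polar 1 t) <-> cantor_set t.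
Proof.
move=> t0; split => [[s Ts e]|]; last by exists t.
by rewrite -(polar1_inj (cantor_set_2pi Ts) t0 e).
Qed.

Lemma Nsp_le k : (N k)%:R * mesh R n k <= 4 / (k.+1)%:R.
Proof.
elim: k => [|k ih].
  rewrite (c_N0 hc) /mesh (c_n0 hc) mul1r; have := pi_le4 R; lra.
have h : (N k.+1)%:R * mesh R n k.+1 <= ((N k)%:R * mesh R n k) / 100.
  rewrite (c_N hc) natrM -mulrA -[leRHS]mulrA; apply: ler_wpM2l; [exact: ler0n | exact: (mesh_S hc)].
apply: le_trans h _.
have := ih; rewrite !ler_pdivlMr ?ltr0n // => h.
have p0 : 0 <= (N k)%:R * mesh R n k by rewrite mulr_ge0 // ltW // (mesh_gt0 hc).
rewrite -[k.+2%:R]natr1; move: p0 h; rewrite -[k.+1%:R]natr1; have := ler0n R k.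
move: ((N k)%:R * _) (k%:R) => a b b0 a0 h.
have : 0 <= a * b by exact: mulr_ge0.
by move: h; rewrite mulrDr mulr1 => h ab; lra.
Qed.

(** Level k is covered by N_k intervals of length at most mesh / 50, and
N_k mesh tends to 0. *)
Lemma cantor_set_null : lebesgue_measure cantor_set = 0%E.
Proof.
apply/eqP; rewrite eq_le measure_ge0 andbT.
apply/lee_addgt0Pr => e e0; rewrite add0e.
have [k hk] : exists k : nat, 4 / k.+1%:R <= e.
  exists (Num.Def.truncn (4 / e)).
  rewrite ler_pdivrMr ?ltr0n // -ler_pdivrMl // mulrC.
  by apply/ltW/truncnS_gt.
pose I i : set R := `[left_end R n M k i, left_end R n M k i + hull R n M k]%classic.
have mI i : measurable (I i) by exact: measurable_itv.
apply: (@le_trans _ _ (lebesgue_measure (\big[setU/set0]_(i < N k) I i))).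
  apply: le_measure; rewrite ?inE.
  - by apply: closed_measurable; exact: (@cantor_set_closed R n N M).
  - by apply: bigsetU_measurable => i _; exact: mI.
  - move=> t /(_ k)[i iN hi]; rewrite -(bigcup_mkord _ I); exists i; first by [].
    by move: hi; rewrite /I /= in_itv.
apply: le_trans; first by apply: Boole_inequality => i _; exact: mI.
have /andP[l0 l1] := hull_bounds hc k.
have lI i : lebesgue_measure (I i) = (hull R n M k)%:E.
  rewrite /I lebesgue_measure_itv /= lte_fin ltrDl.
  case: ltP => h; first by rewrite -EFinB addrAC subrr add0r.
  by congr EFin; apply/eqP; rewrite eq_le h l0.
apply: (@le_trans _ _ (\sum_(i < N k) (hull R n M k)%:E)%E).
  by apply: lee_sum => i _; rewrite -(lI i).
rewrite sumEFin lee_fin sumr_const card_ord -[leLHS]mulr_natl; apply: le_trans hk.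
have := Nsp_le k; have := mesh_gt0 hc k.
have : 0 <= (N k)%:R :> R by []; move: l1 l0.
move: (hull _ _ _ _) (mesh _ _ _) ((N k)%:R) (4 / _) => a b c d h1 h2 h3 h4 h5.
apply: le_trans h5; apply: ler_wpM2l => //; lra.
Qed.

Lemma cantor_arc_set_length : arc_length cantor_arc_set = 0.
Proof.
rewrite /arc_length (_ : [set t | _] = cantor_set) ?cantor_set_null ?mul0r //.
apply/seteqP; split => [t [t0]|t Tt]; first by rewrite cantor_arc_set_polar.
by have t0 := cantor_set_2pi Tt; split => //; rewrite cantor_arc_set_polar.
Qed.

(** About N_k (t - s) intervals of level k lie between the images of s and t. *)
Lemma cantor_fun_sep k (s t : R) : 0 <= s -> s <= t -> t <= 1 ->
  ((N k)%:R * (t - s) - 2) * mesh R n k <= cantor_fun n N M t - cantor_fun n N M s.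
Proof.
move=> s0 st t1.
have /andP[g1 g2] := cantor_fun_bounds hc k s; have /andP[g3 g4] := cantor_fun_bounds hc k t.
have /andP[l0 l1] := hull_bounds hc k; have sp0 := mesh_gt0 hc k.
have Nk := N_gt0 hc k.
have ixy : (cell N k s <= cell N k t)%N.
  rewrite /cell leq_min geq_minr andbT; apply: leq_trans (geq_minl _ _) _.
  by apply: le_truncn; apply: ler_wpM2l.
have h := left_end_sep hc ixy (cell_lt hc k t).
have hs : (cell N k s)%:R <= (N k)%:R * s.
  apply: (@le_trans _ _ (Num.Def.truncn ((N k)%:R * s))%:R); first by rewrite ler_nat geq_minl.
  by have /andP[] := truncn_itv (mulr_ge0 (ler0n R (N k)) s0).
have ht : (N k)%:R * t - 1 <= (cell N k t)%:R.
  rewrite /cell; have t0 : 0 <= t by lra.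
  have /andP[_ h2] := truncn_itv (mulr_ge0 (ler0n R (N k)) t0).
  have [_|_] := leqP (Num.Def.truncn ((N k)%:R * t)) (N k).-1.
    by move: h2; rewrite -natr1; lra.
  rewrite lerBlDr natr1 prednK //; apply: ler_piMr => //.
have h3 : ((N k)%:R * (t - s) - 1) * mesh R n k <= ((cell N k t)%:R - (cell N k s)%:R) * mesh R n k.
  by apply: ler_wpM2r; [exact: ltW | rewrite mulrBr; lra].
lra.
Qed.

Lemma N_ge k : (k < N k)%N.
Proof.
elim: k => [|k ih]; first by rewrite (c_N0 hc).
rewrite (c_N hc); apply: (@leq_trans (k.+1 * 2)); first by rewrite muln2 -addnn addnS ltnS leq_addr.
by apply: leq_mul => //; exact: (c_M hc).
Qed.

Lemma cantor_fun_lt (s t : R) : 0 <= s -> s < t -> t <= 1 -> cantor_fun n N M s < cantor_fun n N M t.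
Proof.
move=> s0 st t1.
pose k := Num.Def.truncn (2 / (t - s)).
have h : 2 < (N k)%:R * (t - s).
  rewrite mulrC -ltr_pdivrMl ?subr_gt0 // mulrC.
  apply: (lt_le_trans (truncnS_gt _)); rewrite ler_nat; exact: N_ge.
have := cantor_fun_sep k s0 (ltW st) t1.
rewrite -subr_gt0; apply: lt_le_trans; apply: mulr_gt0; last exact: (mesh_gt0 hc).
by rewrite subr_gt0.
Qed.

End Cantor.

Section CantorMeasure.
Variables (R : realType) (alpha : R) (n N M : nat -> nat).
Hypothesis hc : cantor alpha n N M.

Definition cantor_point (tau : R) : R * R := polar 1 (cantor_fun n N M tau).

Lemma cantor_point_measurable : measurable_fun setT cantor_point.
Proof.
have mg : measurable_fun setT (cantor_fun n N M : R -> R).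
  by apply: nondecreasing_measurable => // x y; exact: (cantor_fun_nd hc).
apply: measurable_fun_pair; apply: measurable_funM => //.
  apply: (@measurableT_comp _ _ _ _ _ _ (@cos R)) => //.
  by apply: continuous_measurable_fun; exact: continuous_cos.
apply: (@measurableT_comp _ _ _ _ _ _ (@sin R)) => //.
by apply: continuous_measurable_fun; exact: continuous_sin.
Qed.

(** The uniform law is defined on the sigma-algebra generated by the half-open
intervals; the measurable sets are the same, the structures are not. *)
Lemma cantor_point_measurable' : @measurable_fun _ _ (measurableTypeR R) (R * R)%type setT cantor_point.
Proof. exact: cantor_point_measurable. Qed.

Definition cantor_rv : {mfun (measurableTypeR R) >-> (R * R)%type} :=
  @mfun_Sub _ _ (measurableTypeR R) (R * R)%type cantor_point (mem_set cantor_point_measurable').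
(** The law of exp (i cantor_fun tau) for tau uniform in [0, 1]. *)
Definition cantor_law : probability (R * R)%type R := distribution (uniform_prob (@ltr01 R)) cantor_rv.

Lemma cantor_law_E (A : set (R * R)) : cantor_law A = uniform_prob (@ltr01 R) (cantor_point @^-1` A).
Proof. by []. Qed.

Lemma cantor_law_carried (A : set (R * R)) : (forall tau, A (cantor_point tau)) -> carried_by cantor_law A.
Proof.
move=> hA; rewrite /carried_by cantor_law_E (_ : _ @^-1` _ = set0) ?measure0 //.
by apply/seteqP; split => // tau; apply; exact: hA.
Qed.

Lemma cantor_point_in tau : cantor_arc_set n N M (cantor_point tau).
Proof. by exists (cantor_fun n N M tau) => //; exact: (cantor_fun_in hc). Qed.

(** The parametrization is injective on [0, 1]. *)
Lemma cantor_law_nonatomic : nonatomic cantor_law.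
Proof.
move=> z; rewrite cantor_law_E /uniform_prob integral_uniform_pdf.
set A := (X in (\int[_]_(x in X) _)%E).
have [->|/set0P] := eqVneq A set0; first by rewrite integral_set0.
case=> s [zs]; rewrite /= in_itv /= => /andP[s0 s1].
apply: (integral_Sset1 s) => t [zt]; rewrite /= in_itv /= => /andP[t0 t1].
have e : cantor_fun n N M s = cantor_fun n N M t.
  apply: polar1_inj; [exact: (cantor_set_2pi hc (cantor_fun_in hc _)) | exact: (cantor_set_2pi hc (cantor_fun_in hc _)) |].
  by apply: etrans (etrans _ (esym zt)); [exact: zs | exact: erefl].
have [st|ts|//] := ltgtP s t.
- by have := cantor_fun_lt hc s0 st t1; rewrite e ltxx.
- by have := cantor_fun_lt hc t0 ts s1; rewrite e ltxx.
Qed.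

Lemma measurable_circle : measurable (circle : set (R * R)).
Proof.
have mc : measurable_fun setT (fun z : R * R => z.1 ^+ 2 + z.2 ^+ 2).
  by apply: measurable_funD; apply: measurable_funX.
rewrite (_ : circle = setT `&` (fun z : R * R => z.1 ^+ 2 + z.2 ^+ 2) @^-1` [set 1]).
  by apply: mc => //; exact: measurable_set1.
by rewrite setTI.
Qed.

Lemma cantor_law_integral (f : R * R -> R) : measurable_fun setT f -> (forall z, 0 <= f z) ->
  (\int[cantor_law]_(z in circle) (f z)%:E = \int[lebesgue_measure]_(t in `[0%R, 1%R]) (f (cantor_point t))%:E)%E.
Proof.
move=> mf f0; rewrite integral_mkcond.
have mg : measurable_fun setT ((fun z => (f z)%:E) \_ circle).
  apply/(measurable_restrictT _ measurable_circle); apply: measurable_funTS.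
  exact/measurable_EFinP.
have g0 z : (0 <= ((fun z => (f z)%:E) \_ circle) z)%E.
  by rewrite patchE; case: ifP => // _; rewrite lee_fin.
rewrite /cantor_law (ge0_integral_distribution _ mg g0).
rewrite integral_uniform.
- rewrite subr0 invr1 mul1e; apply: eq_integral => t _ /=.
  by rewrite patchE mem_set //; exact: polar1_circle.
- by apply: (measurableT_comp mg); exact: cantor_point_measurable'.
- by move=> t; exact: g0.
Qed.

End CantorMeasure.

(** * The Poisson integral of the Cantor measure *)

Section Trig.
Variable R : realType.
Implicit Types x d u : R.

Lemma sin_ge3 u : 0 <= u -> u - u ^+ 3 / 6 <= sin u.
Proof.
move=> u0; suff : sin 0 - (0 - 0 ^+ 3 / 6) <= sin u - (u - u ^+ 3 / 6) :> R.
  by rewrite sin0 expr0n /=; lra.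
have D (t : R) : 0 <= t <= u ->
    is_derive t 1 (fun t => sin t - (t - t ^+ 3 / 6)) (cos t - (1 - t ^+ 2 / 2)).
  move=> _; apply: (dv_eq (dvB (dv_sin (dvid t))
    (dvB (dvid t) (dvM (dvX 3 (dvid t)) (dvc t 6^-1))))).
  by rewrite /=; field.
by apply: (@le_of_dv _ _ _ _ _ u0 D) => t _; rewrite subr_ge0 cos_ge.
Qed.

(** On [0, pi / 2] by the cubic Taylor bound; beyond, by symmetry about pi / 2. *)
Lemma sin_ge_lin u : 0 <= u -> u <= (pi + 1) / 2 -> u / 15 <= sin u.
Proof.
move=> u0 u1; have p2 := @pi_ge2 R; have p4 := pi_le4 R.
have lo (v : R) : 0 <= v -> v <= 2 -> v / 3 <= sin v.
  move=> v0 v2; apply: le_trans (sin_ge3 v0).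
  have : 0 <= v * ((2 - v) * (2 + v)) by rewrite !mulr_ge0 //; lra.
  lra.
have [h|h] := leP u (pi / 2).
  have := lo u u0; lra.
have e : sin u = sin (pi - u) by rewrite sinB sinpi cospi; ring.
have := lo (pi - u); rewrite -e; lra.
Qed.

Lemma cos_le_quad d : `|d| <= pi + 1 -> d ^+ 2 / 450 <= 1 - cos d.
Proof.
wlog d0 : d / 0 <= d.
  move=> h; have [d0|d0] := leP 0 d; first exact: h.
  by have := h (- d); rewrite sqrrN cosN normrN; apply; lra.
rewrite ger0_norm // => d1.
have e : 1 - cos d = 2 * sin (d / 2) ^+ 2.
  rewrite [X in cos X](_ : d = d / 2 + d / 2); last by field.
  rewrite cosD -!expr2; have := cos2Dsin2 (d / 2); lra.
have h : (d / 2) / 15 <= sin (d / 2) by apply: sin_ge_lin; lra.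
have h2 : ((d / 2) / 15) ^+ 2 <= sin (d / 2) ^+ 2.
  by rewrite lerXn2r ?nnegrE //; lra.
rewrite e; move: h2; rewrite !expr2; lra.
Qed.

(** The primitive is atan (c (t - s)) / c, and the oscillation of atan is pi. *)
Lemma integral_atan (c s : R) : 0 < c ->
  (\int[lebesgue_measure]_(t in `[0%R, 1%R]) ((1 + (c * (t - s)) ^+ 2)^-1)%:E <= (4 / c)%:E)%E.
Proof.
move=> c0.
have F (t : R) : is_derive t 1 (fun t => atan (c * (t - s)) / c) ((1 + (c * (t - s)) ^+ 2)^-1).
  apply: (dv_eq (dvM (@dvcomp _ atan (fun t => c * (t - s)) t _ _ _
     (dvM (dvc t c) (dvB (dvid t) (dvc t s)))) (dvc t c^-1))).
  by move: (_ ^-1) => a; field; rewrite gt_eqF.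
have Fc (t : R) : {for t, continuous (fun t => atan (c * (t - s)) / c)} by exact: dv_cont.
have Gc (t : R) : {for t, continuous (fun t => (1 + (c * (t - s)) ^+ 2)^-1)}.
  have p : 0 < 1 + (c * (t - s)) ^+ 2 by rewrite ltr_wpDr // sqr_ge0.
  apply: cvgV; first by rewrite gt_eqF.
  exact: (dv_cont (dvD (dvc t 1) (dvX 2 (dvM (dvc t c) (dvB (dvid t) (dvc t s)))))).
rewrite (@continuous_FTC2 _ _ (fun t => atan (c * (t - s)) / c)) //.
- rewrite -EFinB lee_fin -mulrBl ler_pM2r ?invr_gt0 //.
  have := atan_ltpi2 (c * (1 - s)); have := atan_gtNpi2 (c * (0 - s)).
  have := pi_le4 R; lra.
- by apply: continuous_subspaceT => t; exact: Gc.
- split.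
  + by move=> t _; exact: (@ex_derive _ _ _ _ _ _ _ (F t)).
  + by apply: cvg_at_right_filter; exact: Fc.
  + by apply: cvg_at_left_filter; exact: Fc.
- by move=> t _; rewrite derive1E; exact: (@derive_val _ _ _ _ _ _ _ (F t)).
Qed.

End Trig.

Section Kernel.
Variables (R : realType) (alpha : R) (n N M : nat -> nat).
Hypothesis hc : cantor alpha n N M.
Let g := cantor_fun (R := R) n N M.
Let s k := mesh R n k.

Lemma n_even k : exists q, n k = (2 * q)%N.
Proof.
elim: k => [|k [q e]]; first by exists 1%N; rewrite (c_n0 hc).
by have [q' -> _] := c_n hc k; exists (q * q')%N; rewrite e mulnA.
Qed.

(** For p in the lattice cos (n x) = cos (n (x - p)): the lattice starts at pi,
and n is even.  Then cos v >= 1 - v^2 / 2. *)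
Lemma far_from_lattice k i x : cos ((n k)%:R * x) <= 9 / 10 ->
  s k / 18 <= `|x - left_end R n M k i|.
Proof.
move=> hx; have [b e] := left_end_lattice hc k i.
have [q eq] := n_even k.
have n0 := nR_gt0 hc k; have p0 := @pi_gt0 R; have p4 := pi_le4 R.
set d := x - _.
have ed : cos ((n k)%:R * x) = cos ((n k)%:R * d).
  have -> : (n k)%:R * x = (n k)%:R * d + (q + b)%:R * (2 * pi).
    have eq' : q%:R = (n k)%:R / 2 :> R by rewrite eq natrM; field.
    rewrite /d e /mesh natrD eq'.
    by field; rewrite gt_eqF.
  exact: cos_period.
have h := cos_ge ((n k)%:R * d); rewrite -ed in h.
have h2 : 1 / 5 <= ((n k)%:R * d) ^+ 2 by lra.
rewrite -(@ler_pM2l _ (n k)%:R) //.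
have -> : (n k)%:R * (s k / 18) = pi / 9 by rewrite /s /mesh; field; rewrite gt_eqF.
have -> : (n k)%:R * `|d| = `|(n k)%:R * d| by rewrite normrM gtr0_norm.
apply: (@le_trans _ _ (4 / 9)); first by rewrite ler_pM2r.
rewrite -(@ler_pXn2r _ 2) ?nnegrE //; rewrite real_normK ?num_real //; move: h2; rewrite !expr2; lra.
Qed.

Lemma cantor_fun_far k x t : cos ((n k)%:R * x) <= 9 / 10 -> s k / 30 <= `|x - g t|.
Proof.
move=> hx; have h := far_from_lattice (cell N k t) hx.
have /andP[g1 g2] := cantor_fun_bounds hc k t; have /andP[_ l1] := hull_bounds hc k.
have s0 := mesh_gt0 hc k; rewrite -/(s k) in l1 s0.
have : `|g t - left_end R n M k (cell N k t)| <= s k / 50.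
  by rewrite ger0_norm /g; lra.
have := ler_normD (x - g t) (g t - left_end R n M k (cell N k t)).
rewrite addrA subrK; lra.
Qed.

(** Close to x the distance is bounded below because x is far from the lattice;
far from x it grows with the number of intervals in between.  The parameter
[t0] is a near-minimizer of the distance, so that both bounds are centred at
the same place. *)
Lemma cantor_fun_spread k x : cos ((n k)%:R * x) <= 9 / 10 ->
  exists t0 : R, forall t, 0 <= t <= 1 ->
    s k * (1 + `|(N k)%:R * (t - t0)|) / 150 <= `|x - g t|.
Proof.
move=> hx; have s0 := mesh_gt0 hc k; rewrite -/(s k) in s0.
pose A := [set `|x - g t| | t in [set t : R | 0 <= t <= 1]].
have hA : has_inf A.
  split; first by exists `|x - g 0|, 0 => //=; rewrite lexx ler01.
  by exists 0 => _ [t _ <-].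
have [_ [t0 /andP[t00 t01] <-] h0] := inf_adherent s0 hA.
exists t0 => t /andP[t1 t2].
have h1 : inf A <= `|x - g t|.
  by apply: ge_inf; [exact: hA.2 | exists t => //=; apply/andP].
have h2 := cantor_fun_far t hx.
have h3 : (`|(N k)%:R * (t - t0)| - 2) * s k <= `|g t - g t0|.
  rewrite normrM (ger0_norm (ler0n _ _)).
  have [tt|tt] := leP t0 t.
    rewrite (ger0_norm (_ : 0 <= t - t0)) ?subr_ge0 //.
    by apply: le_trans (cantor_fun_sep hc k t00 tt t2) (ler_norm _).
  rewrite distrC (ger0_norm (_ : 0 <= t0 - t)) ?subr_ge0 ?(ltW tt) // distrC.
  by apply: le_trans (cantor_fun_sep hc k t1 (ltW tt) t01) (ler_norm _).
have h4 : `|g t - g t0| <= `|x - g t| + `|x - g t0|.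
  have := ler_normB (x - g t0) (x - g t).
  have -> : x - g t0 - (x - g t) = g t - g t0 by ring.
  by rewrite [leRHS]addrC.
have h5 : 0 <= `|(N k)%:R * (t - t0)| by [].
move: (`|(N k)%:R * (t - t0)|) h3 h5 => a h3 h5.
have h6 : (a - 3) * s k <= 2 * `|x - g t| by lra.
have [a4|a4] := leP a 4.
  have : s k * (1 + a) <= s k * 5 by rewrite ler_pM2l //; lra.
  lra.
have : s k * (4 - a) <= 0 by rewrite pmulr_rle0 //; lra.
lra.
Qed.

(** The Poisson kernel, up to a constant factor. *)
Definition kern (y x v : R) := sh2 y / (ch y - cos (x - v)).

Lemma ch_gt1 (y : R) : 0 < y -> y <= 1 -> 1 < ch y.
Proof.
move=> y0 y1; have := ch_ge (ltW y0) y1; apply: lt_le_trans.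
by rewrite ltrDl divr_gt0 // exprn_gt0.
Qed.

Lemma kern_den (y x v : R) : 0 < y -> y <= 1 -> 0 < ch y - cos (x - v).
Proof.
by move=> y0 y1; have := ch_gt1 y0 y1; have := cos_le1 (x - v); lra.
Qed.

(** Since 1 - cos d >= d^2 / 450, the kernel at cantor_fun t is at most a multiple
of y / (s^2 (1 + N^2 (t - t0)^2)) with s the mesh ([cantor_fun_spread]), and
the integral in t gives the factor 1 / N. *)
Lemma kern_integral k x y : 0 <= x <= 2 * pi -> cos ((n k)%:R * x) <= 9 / 10 ->
  0 < y -> y <= 1 / 2 ->
  (\int[lebesgue_measure]_(t in `[0%R, 1%R]) (kern y x (g t))%:E <=
    (150 ^+ 2 * 450 * (y * (n k)%:R ^+ 2 / (N k)%:R))%:E)%E.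
Proof.
move=> /andP[x0 x1] hx y0 y1.
have [t0 ht0] := cantor_fun_spread hx.
have s0 := mesh_gt0 hc k; rewrite -/(s k) in s0.
have N0 : 0 < (N k)%:R :> R by rewrite ltr0n (N_gt0 hc).
have n0 := nR_gt0 hc k.
have y1' : y <= 1 by lra.
have /andP[sh0 sh1] := sh2_bounds (ltW y0) y1.
have [B B0 eB] : exists2 B : R, 0 < B & 150 ^+ 2 * 450 = B.
  by eexists; last reflexivity; apply: mulr_gt0; [apply: exprn_gt0 |]; exact: ltr0Sn.
rewrite eB.
pose C := 3 * B * y / s k ^+ 2.
have C0 : 0 <= C by rewrite /C divr_ge0 ?sqr_ge0 // !mulr_ge0 // ?(ltW B0) ?(ltW y0).
have kle t : 0 <= t <= 1 -> kern y x (g t) <= C * (1 + ((N k)%:R * (t - t0)) ^+ 2)^-1.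
  move=> ht; have h := ht0 t ht.
  set a := `|_| in h; have a0 : 0 <= a by exact: normr_ge0.
  have -> : ((N k)%:R * (t - t0)) ^+ 2 = a ^+ 2 by rewrite real_normK ?num_real.
  have dd : `|x - g t| <= pi + 1.
    have /andP[g1 g2] := cantor_set_range hc (cantor_fun_in hc t); have p := @pi_ge2 R.
    by rewrite ler_norml; apply/andP; split; rewrite /g; lra.
  have h1 := cos_le_quad dd.
  have h2 : (s k * (1 + a) / 150) ^+ 2 <= (x - g t) ^+ 2.
    rewrite -[leRHS]real_normK ?num_real // lerXn2r ?nnegrE //.
    by rewrite divr_ge0 // mulr_ge0 ?addr_ge0 // ltW.
  have c1 := ch_gt1 y0 y1'.
  have a2 := sqr_ge0 a.
  have D0 : 0 < s k ^+ 2 * (1 + a ^+ 2) / B.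
    by rewrite divr_gt0 // mulr_gt0 ?exprn_gt0 // ltr_wpDr.
  have D1 : s k ^+ 2 * (1 + a ^+ 2) / B <= ch y - cos (x - g t).
    have h3 : s k ^+ 2 * (1 + a ^+ 2) <= (s k * (1 + a)) ^+ 2.
      rewrite [leRHS]exprMn; apply: ler_wpM2l; first exact: sqr_ge0.
      by rewrite sqrrD expr1n mul1r addrAC lerDl mulrn_wge0.
    have h4 : (s k * (1 + a)) ^+ 2 / B = (s k * (1 + a) / 150) ^+ 2 / 450.
      by rewrite -eB; field.
    have h5 : s k ^+ 2 * (1 + a ^+ 2) / B <= (s k * (1 + a)) ^+ 2 / B.
      by rewrite ler_pM2r ?invr_gt0.
    move: h1 h2 h4 h5 c1; move: (_ / B) (_ / B) (_ ^+ 2) (_ ^+ 2) (cos _) (ch y).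
    by move=> q1 q2 q3 q4 q5 q6; lra.
  rewrite /kern; apply: (@le_trans _ _ (3 * y / (s k ^+ 2 * (1 + a ^+ 2) / B))).
    apply: ler_pM; [lra | rewrite invr_ge0; lra | exact: sh1 |].
    by rewrite lef_pV2 ?posrE //; lra.
  rewrite le_eqVlt; apply/orP; left; apply/eqP; rewrite /C.
  by field; rewrite !gt_eqF //= ltr_wpDr.
have mq : measurable_fun setT (fun t : R => (1 + ((N k)%:R * (t - t0)) ^+ 2)^-1).
  apply: continuous_measurable_fun => t.
  apply: cvgV; first by rewrite gt_eqF // ltr_wpDr // sqr_ge0.
  exact: (dv_cont (dvD (dvc t 1) (dvX 2 (dvM (dvc t (N k)%:R) (dvB (dvid t) (dvc t t0)))))).
have mg : measurable_fun setT g.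
  by apply: nondecreasing_measurable => // u v; exact: (cantor_fun_nd hc).
apply: (@le_trans _ _ (\int[lebesgue_measure]_(t in `[0%R, 1%R])
    (C * (1 + ((N k)%:R * (t - t0)) ^+ 2)^-1)%:E)%E).
  apply: ge0_le_integral => //.
  - move=> t _; rewrite lee_fin divr_ge0 //; first by lra.
    exact: ltW (kern_den _ _ y0 y1').
  - apply: measurable_funTS; apply/measurable_EFinP.
    have mk : measurable_fun setT (kern y x \o g).
      apply: measurableT_comp mg.
      apply: continuous_measurable_fun => v; apply: cvgM; first exact: cvg_cst.
    apply: cvgV; first by rewrite gt_eqF // kern_den.
    exact: (dv_cont (dvB (dvc v (ch y)) (dv_cos (dvB (dvc v x) (dvid v))))).
    exact: mk.
  - apply: measurable_funTS; apply/measurable_EFinP.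
    by apply: measurable_funM; [exact: measurable_cst | exact: mq].
under eq_integral do rewrite EFinM.
rewrite ge0_integralZl_EFin //; last 2 first.
- by move=> t _; rewrite lee_fin invr_ge0 addr_ge0 // sqr_ge0.
- by apply: measurable_funTS; apply/measurable_EFinP; exact: mq.
apply: (le_trans (lee_wpmul2l _ (integral_atan t0 N0))); first by rewrite lee_fin.
rewrite -EFinM lee_fin /C.
have -> : 3 * B * y / s k ^+ 2 * (4 / (N k)%:R) =
   12 * B / (2 * pi) ^+ 2 * (y * (n k)%:R ^+ 2 / (N k)%:R).
  have pp := @pi_gt0 R; rewrite /s /mesh; move: (@pi R) pp => p pp.
  by field; rewrite !gt_eqF.
apply: ler_wpM2r.
  by apply: divr_ge0; [apply: mulr_ge0; [exact: ltW | exact: sqr_ge0] | exact: ltW].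
have p2 := @pi_ge2 R; rewrite ler_pdivrMr; last by rewrite exprn_gt0 // mulr_gt0 //; lra.
have : 4 <= 2 * pi :> R by lra.
move: (2 * pi) => p p4.
have : 4 * 4 <= p * p by apply: ler_pM => //; lra.
move=> hp; rewrite expr2 [12 * B]mulrC; apply: ler_wpM2l; first exact: ltW.
by apply: le_trans hp; rewrite -natrM ler_nat.
Qed.

End Kernel.

(** * Complementary arcs *)

(** Choosing an index for each element of [S] is injective, so the sum over [S] is
at most the double sum of the bounds. *)
Lemma esum_cover (R : realType) (T : choiceType) (S : set T) (f : T -> \bar R)
    (c : nat * nat -> T) (K : nat -> nat) (b : nat -> R) (B : R) :
  (forall x, S x -> exists2 p, (p.2 < K p.1)%N & c p = x) ->
  (forall p, (p.2 < K p.1)%N -> (f (c p) <= (b p.1)%:E)%E) ->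
  (forall k, 0 <= b k) ->
  (forall m, \sum_(k < m) (K k)%:R * b k <= B) ->
  (\esum_(x in S) f x <= B%:E)%E.
Proof.
move=> hS hf b0 hB.
have hS' x : exists p, S x -> (p.2 < K p.1)%N /\ c p = x.
  have [Sx|nSx] := pselect (S x); last by exists (0, 0)%N.
  by have [p p1 p2] := hS x Sx; exists p.
have [h hh] : {h & forall x, S x -> ((h x).2 < K (h x).1)%N /\ c (h x) = x}.
  by apply: (@choice _ _ (fun x p => S x -> (p.2 < K p.1)%N /\ c p = x)).
have -> : (\esum_(x in S) f x = \esum_(x in S) f (c (h x)))%E.
  by apply: eq_esum => x Sx; have [_ ->] := hh x Sx.
have hinj : set_inj S h.
  move=> x y /set_mem Sx /set_mem Sy e.
  by have [_ <-] := hh x Sx; have [_ <-] := hh y Sy; rewrite e.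
rewrite -(@esum_image _ _ _ S h (f \o c) hinj).
apply: (@le_trans _ _ (\esum_(p in [set: nat] `*`` (fun k => `I_(K k))) (b p.1)%:E)%E).
  rewrite esum_mkcond [leRHS]esum_mkcond; apply: le_esum => p _.
  case: ifPn => [/set_mem [x Sx <-]|_].
    have [h1 h2] := hh x Sx; rewrite mem_set; last by split.
    exact: hf.
  by case: ifP => // _; rewrite lee_fin.
have e1 := @esum_esum R _ _ [set: nat] (fun k => `I_(K k)) (fun k _ => (b k)%:E).
rewrite -e1; last by move=> *; rewrite lee_fin.
have e2 k : (\esum_(j in `I_(K k)) (b k)%:E = ((K k)%:R * b k)%:E)%E.
  rewrite esum_fset //; last by move=> *; rewrite lee_fin.
  by rewrite -fsbig_ord sumEFin sumr_const card_ord mulr_natl.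
under eq_esum do rewrite e2.
rewrite -nneseries_esumT; last by move=> k; rewrite lee_fin mulr_ge0.
apply: lime_le.
  by apply: is_cvg_nneseries => k _ _; rewrite lee_fin mulr_ge0.
by near=> m; rewrite sumEFin lee_fin big_mkord.
Unshelve. all: by end_near.
Qed.

Section Arc.
Variable R : realType.

Lemma connected_arc (a b : R) : connected (polar (1 : R) @` `]a, b[%classic).
Proof.
apply: connected_continuous_connected.
  exact/connected_intervalP/interval_is_interval.
by apply: continuous_subspaceT => t; exact: polar1_cont.
Qed.

(** The open arc is connected and misses [E].  Conversely the affine function H
that vanishes on the chord between the ends vanishes on the circle at the two
ends only, which belong to [E]; a connected set that avoids them cannot reach
both sides. *)
Lemma component_gap (E : set (R * R)) (a b t : R) :
  E (polar 1 a) -> E (polar 1 b) ->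
  pi <= a -> b <= pi + 1 -> a < t < b ->
  (forall s, a < s < b -> ~ E (polar 1 s)) ->
  connected_component (circle `\` E) (polar 1 t) = polar 1 @` `]a, b[%classic.
Proof.
move=> Ea Eb a0 b1 hatb hE; have p2 := @pi_ge2 R.
have tab : `]a, b[%classic t by rewrite /= in_itv.
apply/seteqP; split; last first.
  apply: connected_component_max; first by exists t.
  - move=> _ [s + <-]; rewrite /= in_itv /= => hs; split; first exact: polar1_circle.
    exact: hE.
  - exact: connected_arc.
set J := connected_component _ _.
pose md := (a + b) / 2; pose dl := (b - a) / 2.
have ab : a < b by case/andP: hatb; apply: lt_trans.
pose H (z : R * R) := cos md * z.1 + sin md * z.2 - cos dl.
have Hp s : H (polar 1 s) = cos (s - md) - cos dl.
  by rewrite /H /= !mul1r cosB; ring.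
have Hc : continuous H.
  move=> z; apply: cvgB; last exact: cvg_cst.
  by apply: cvgD; apply: cvgM; first [exact: cvg_cst | exact: cvg_fst | exact: cvg_snd].
have HJ : is_interval (H @` J).
  apply/connected_intervalP/connected_continuous_connected.
    exact: component_connected.
  by apply: continuous_subspaceT => z; exact: Hc.
have cos_lt (u v : R) : 0 <= u -> u < v -> v <= pi -> cos v < cos u.
  by move=> u0 uv vp; rewrite ltr_cos // in_itv /=; apply/andP; split; lra.
have absl (s : R) : `|s - md| < dl -> 0 < H (polar 1 s).
  by move=> hs; rewrite Hp subr_gt0 -(cos_norm (s - md)); apply: cos_lt => //; rewrite /dl; lra.
have Jt : J (polar 1 t).
  apply: connected_component_refl; split; [exact: polar1_circle | exact: hE].
have Ht : 0 < H (polar 1 t).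
  by apply: absl; rewrite ltr_norml /md /dl; case/andP: hatb => *; apply/andP; split; lra.
have dl0 : 0 <= dl by rewrite /dl; lra.
have out (s : R) : 0 <= s < 2 * pi -> dl < `|s - md| -> cos (s - md) < cos dl.
  move=> /andP[s0 s1] l; have [h|h] := leP `|s - md| pi.
    by rewrite -(cos_norm (s - md)); exact: cos_lt.
  have m0 : s - md < - pi.
    move: h; have [m0|m0] := leP 0 (s - md).
      by rewrite ger0_norm // /md; lra.
    by rewrite ltr0_norm //; lra.
  have -> : cos (s - md) = cos (2 * pi + (s - md)).
    by rewrite [2 * pi + _]addrC mulr_natl cosD2pi.
  by apply: cos_lt => //; rewrite /dl /md in m0 *; lra.
have H0 s : 0 <= s < 2 * pi -> H (polar 1 s) = 0 -> s = a \/ s = b.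
  move=> hs; rewrite Hp => /eqP; rewrite subr_eq0 => /eqP e.
  have [l|l|l] := ltgtP `|s - md| dl.
  - by have := absl s l; rewrite Hp e subrr ltxx.
  - by have := out s hs l; rewrite e ltxx.
  - move: l; have [m0|m0] := leP 0 (s - md).
      by rewrite ger0_norm // /md /dl => l; right; lra.
    by rewrite ltr0_norm // /md /dl => l; left; lra.
move=> z Jz; have [cz nEz] := @connected_component_sub _ _ _ _ Jz.
have [s hs ez] := polar1_surj cz.
have Hz : 0 < H z.
  rewrite ltNge; apply/negP => Hz0.
  have [w Jw Hw] : (H @` J) 0.
    apply: (HJ (H z) (H (polar 1 t))); [by exists z | by exists (polar 1 t) |].
    by rewrite Hz0 ltW.
  have [cw nEw] := @connected_component_sub _ _ _ _ Jw.
  have [r hr ew] := polar1_surj cw.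
  rewrite ew in Hw nEw; have [er|er] := H0 r hr Hw; rewrite er in nEw; exact: nEw.
exists s => //; rewrite /= in_itv /=; rewrite ez Hp subr_gt0 in Hz.
suff : `|s - md| < dl by rewrite ltr_norml /md /dl => /andP[]; lra.
rewrite ltNge; apply/negP; rewrite le_eqVlt => /orP[/eqP l|l].
  by move: Hz; rewrite -(cos_norm (s - md)) -l ltxx.
by have := lt_trans Hz (out s hs l); rewrite ltxx.
Qed.

Lemma arc_length_gap (a b : R) : 0 <= a -> a < b -> b < 2 * pi ->
  arc_length (polar (1 : R) @` `]a, b[%classic) = (b - a) / (2 * pi).
Proof.
move=> a0 ab b1; rewrite /arc_length (_ : [set t | _] = `]a, b[%classic).
  by rewrite lebesgue_measure_itv /= lte_fin ab.
apply/seteqP; split => t; rewrite /= in_itv /=.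
  move=> [t0 [s]]; rewrite /= in_itv /= => /andP[s0 s1] e.
  rewrite (polar1_inj t0 _ (esym e)); first by rewrite s0 s1.
  by apply/andP; split; lra.
move=> /andP[t0 t1]; split; first by apply/andP; split; lra.
by exists t => //; rewrite /= in_itv /= t0 t1.
Qed.

End Arc.

Section CantorArcs.
Variables (R : realType) (alpha : R) (n N M : nat -> nat).
Hypothesis hc : cantor alpha n N M.
Let cantor_set : set R := cantor_set n N M.
Let cantor_level k : set R := cantor_level n N M k.
Let E : set (R * R) := cantor_arc_set n N M.
Let ga k j : R := left_end R n M k.+1 j + hull R n M k.+1.
Let gb k j : R := left_end R n M k.+1 j.+1.
Let good k j := (j.+1 < N k.+1)%N && (ga k j < gb k j <= ga k j + mesh R n k.+1).

Lemma cantor_level0 t : cantor_level 0 t <-> pi <= t <= pi + hull R n M 0.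
Proof.
split; first by move=> [i iN].
by move=> h; exists 0%N => //; rewrite (c_N0 hc).
Qed.

(** Let k be the last level that contains t.  In the interval of level k around t
consider the last child that starts before t: as t is not in it, t lies
between this child and the next one, and there is a next one because the last
child ends where its parent does. *)
Lemma gap_of t : ~ cantor_set t -> cantor_level 0 t ->
  exists k j, good k j /\ ga k j < t < gb k j.
Proof.
move=> nT T0.
have [k [Tk nTk]] : exists k, cantor_level k t /\ ~ cantor_level k.+1 t.
  apply: contrapT => h; apply: nT; elim=> [//|k ih].
  by apply: contrapT => nTk; apply: h; exists k.
case: Tk => i iN /andP[t0 t1]; have s0 := mesh_gt0 hc k.+1; have Mk := M_gt0 hc k.
pose r := Num.Def.truncn ((t - left_end R n M k i) / mesh R n k.+1).
have /andP[r0 r1] : r%:R <= (t - left_end R n M k i) / mesh R n k.+1 < r.+1%:R.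
  by apply: truncn_itv; rewrite divr_ge0 ?(ltW s0) // subr_ge0.
rewrite ler_pdivlMr // in r0; rewrite ltr_pdivrMr // -natr1 in r1.
have jN q : (q < M k)%N -> (i * M k + q < N k.+1)%N.
  move=> qM; rewrite (c_N hc); apply: (@leq_trans (i.+1 * M k)); last by rewrite leq_pmul2r.
  by rewrite mulSnr ltn_add2l.
have [rM|Mr] := ltnP r.+1 (M k); last first.
  exfalso; apply: nTk; exists (i * M k + (M k).-1)%N.
    by apply: jN; rewrite ltn_predL.
  rewrite (left_end_child hc) ?ltn_predL //.
  have e := hull_S R n M k; rewrite e /child_span in t1.
  have : (M k).-1%:R <= r%:R :> R by rewrite ler_nat -ltnS prednK.
  move=> h; have h2 : (M k).-1%:R * mesh R n k.+1 <= r%:R * mesh R n k.+1 by rewrite ler_pM2r.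
  by apply/andP; split; lra.
have rM' : (r < M k)%N by exact: ltnW.
exists k, (i * M k + r)%N.
have ea : ga k (i * M k + r) = left_end R n M k i + r%:R * mesh R n k.+1 + hull R n M k.+1.
  by rewrite /ga (left_end_child hc).
have eb : gb k (i * M k + r) = left_end R n M k i + r%:R * mesh R n k.+1 + mesh R n k.+1.
  by rewrite /gb -addnS (left_end_child hc) // -natr1 mulrDl mul1r addrA.
have /andP[l0 l1] := hull_bounds hc k.+1.
have ta : ga k (i * M k + r) < t.
  rewrite ltNge; apply/negP => h; apply: nTk; exists (i * M k + r)%N; first exact: jN.
  by apply/andP; split; [rewrite (left_end_child hc) //; lra | exact: h].
split; last by rewrite ta eb; lra.
by rewrite /good -addnS jN //= ea eb; apply/andP; split; lra.
Qed.

Lemma gap_free k j t : (j.+1 < N k.+1)%N -> ga k j < t < gb k j -> ~ cantor_set t.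
Proof.
move=> jN /andP[h1 h2] /(_ k.+1) [i iN /andP[h3 h4]].
have s0 := mesh_gt0 hc k.+1.
have [ij|ji] := leqP i j.
  have := left_end_sep hc ij (ltnW jN); have : 0 <= (j%:R - i%:R) * mesh R n k.+1.
    by rewrite mulr_ge0 ?(ltW s0) // subr_ge0 ler_nat.
  by move: h1 h4; rewrite /ga; lra.
have := left_end_sep hc ji iN; have : 0 <= (i%:R - j.+1%:R) * mesh R n k.+1.
  by rewrite mulr_ge0 ?(ltW s0) // subr_ge0 ler_nat.
by move: h2 h3; rewrite /gb; lra.
Qed.

Lemma component_of_gap k j t : (j.+1 < N k.+1)%N -> ga k j < t < gb k j ->
  connected_component (circle `\` E) (polar 1 t) = polar 1 @` `]ga k j, gb k j[%classic.
Proof.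
move=> jN ht; have Ta : cantor_set (ga k j) by apply: (right_end_in hc); exact: ltnW.
have Tb : cantor_set (gb k j) by exact: (left_end_in hc).
apply: component_gap => //.
- by exists (ga k j).
- by exists (gb k j).
- by have /andP[] := cantor_set_range hc Ta.
- by have /andP[] := cantor_set_range hc Tb.
- move=> s hs; have p2 := @pi_ge2 R.
  have /andP[a1 a2] := cantor_set_range hc Ta; have /andP[b1 b2] := cantor_set_range hc Tb.
  have hs' : 0 <= s < 2 * pi by case/andP: hs => s0 s1; apply/andP; split; lra.
  by move/(cantor_arc_set_polar hc hs'); exact: (gap_free jN hs).
Qed.

(** The angles outside the interval of level 0 form one arc through the angle 0;
it is parametrized from negative angles so as not to cut it there. *)
Lemma component_outer t : 0 <= t < 2 * pi -> ~ cantor_level 0 t ->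
  connected_component (circle `\` E) (polar 1 0) =
  connected_component (circle `\` E) (polar 1 t).
Proof.
move=> /andP[t0 t1] nT; have p2 := @pi_ge2 R.
have /andP[l0 l1] := hull_bounds hc 0; have p4 := pi_le4 R.
have l2 : hull R n M 0 <= 1.
  by move: l1; rewrite /mesh (c_n0 hc); lra.
apply: same_connected_component.
set I : set R := `]pi + hull R n M 0 - 2 * pi, pi[%classic.
have per s : polar 1 s = polar 1 (s + 2 * pi) :> R * R.
  by rewrite /polar mulr_natl cosD2pi sinD2pi.
have hI : polar 1 @` I `<=` circle `\` E.
  move=> _ [s + <-]; rewrite /I /= in_itv /= => /andP[s0 s1].
  split; first exact: polar1_circle.
  have nT0 r : 0 <= r < 2 * pi -> ~ cantor_level 0 r -> ~ E (polar 1 r).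
    by move=> hr nTr /(cantor_arc_set_polar hc hr) /(_ 0%N).
  have [sn|sn] := leP 0 s.
    apply: nT0; first by apply/andP; split; lra.
    by rewrite cantor_level0 => /andP[]; lra.
  rewrite per; apply: nT0; first by apply/andP; split; lra.
  by rewrite cantor_level0 => /andP[]; lra.
apply: (connected_component_max _ hI (@connected_arc _ _ _)).
  by exists 0 => //; rewrite /I /= in_itv /=; apply/andP; split; lra.
have [tp|tp] := ltP t pi.
  by exists t => //; rewrite /I /= in_itv /=; apply/andP; split; lra.
exists (t - 2 * pi); last by rewrite [LHS]per subrK.
have tl : pi + hull R n M 0 < t.
  by rewrite ltNge; apply/negP => h; apply: nT; apply/cantor_level0; rewrite tp h.
by rewrite /I /= in_itv /=; apply/andP; split; lra.
Qed.

(** Each complementary arc is the outer one or a gap next to one of the N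
intervals of some level, of length at most 1 / n; then [c_lo] bounds
N n^(- alpha) by the power of the weight. *)
Lemma arcs_summable : 0 < alpha -> alpha < 1 ->
  (\esum_(J in complementary_arcs E) (arc_length J `^ alpha)%:E < +oo)%E.
Proof.
move=> al0 al1.
pose J0 := connected_component (circle `\` E) (polar 1 0).
(* index (0, 0) is the outer arc, index (k + 1, j) the gap after interval j of
   level k + 1, and an index without a gap gets the empty set *)
pose c (p : nat * nat) : set (R * R) :=
  if p.1 is k.+1 then
    if good k p.2 then polar 1 @` `]ga k p.2, gb k p.2[%classic else set0
  else J0.
pose K k := if k is k'.+1 then N k'.+1 else 1%N.
pose b k := if k is k'.+1 then ((n k'.+1)%:R^-1) `^ alpha else arc_length J0 `^ alpha.
have -> // : (\esum_(J in complementary_arcs E) (arc_length J `^ alpha)%:E <=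
   (arc_length J0 `^ alpha + (1 - alpha)^-1)%:E)%E -> (\esum_(J in complementary_arcs E) (arc_length J `^ alpha)%:E < +oo)%E.
  by move=> /le_lt_trans; apply; rewrite ltry.
apply: (@esum_cover R _ _ _ c K b).
- move=> _ [z [cz nEz] <-]; have [t ht ez] := polar1_surj cz.
  have nT : ~ cantor_set t by move/(cantor_arc_set_polar hc ht); rewrite -ez.
  have [T0|nT0] := pselect (cantor_level 0 t).
    have [k [j [gkj hj]]] := gap_of nT T0; exists (k.+1, j).
      by case/andP: gkj => /ltnW.
    by rewrite /c /= gkj ez (component_of_gap _ hj) //; case/andP: gkj.
  exists (0, 0)%N => //; rewrite /c /= /J0 ez; exact: component_outer.
- move=> [[|k] j] //= jK; rewrite lee_fin /c /=.
  have [/andP[jN /andP[g1 g2]]|_] := boolP (good k j); last first.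
    rewrite /arc_length (_ : [set t | _] = set0); last by apply/seteqP; split => t //= -[].
    by rewrite measure0 /= mul0r powR0 ?gt_eqF // powR_ge0.
  have Ta : cantor_set (ga k j) by apply: (right_end_in hc); exact: ltnW.
  have Tb : cantor_set (gb k j) by exact: (left_end_in hc).
  have /andP[a1 a2] := cantor_set_range hc Ta; have /andP[b1 b2] := cantor_set_range hc Tb.
  have p2 := @pi_ge2 R.
  rewrite arc_length_gap //; [|lra|lra].
  apply: ge0_ler_powR; rewrite ?nnegrE ?(ltW al0) //.
  - by rewrite divr_ge0 ?subr_ge0 ?(ltW g1) // mulr_ge0 //; lra.
  - have -> : (n k.+1)%:R^-1 = mesh R n k.+1 / (2 * pi).
      by rewrite /mesh mulrAC divff ?mul1r // mulf_neq0 // gt_eqF // pi_gt0.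
    rewrite ler_pM2r ?invr_gt0 ?mulr_gt0 ?pi_gt0 //; lra.
- by case=> [|k]; exact: powR_ge0.
- case=> [|m].
    rewrite big_ord0 addr_ge0 ?powR_ge0 // invr_ge0; lra.
  rewrite big_ord_recl /= mul1r lerD2l.
  apply: le_trans (weight_pow_sum m al1); apply: ler_sum => k _.
  have n0 := nR_gt0 hc k.+1.
  apply: (@le_trans _ _ ((n k.+1)%:R `^ alpha * weight R k.+1 `^ (2 - alpha) * ((n k.+1)%:R^-1) `^ alpha)).
    by apply: ler_wpM2r; [exact: powR_ge0 | exact: (c_lo hc)].
  rewrite mulrAC -powRM ?invr_ge0 ?(ltW n0) // divff ?gt_eqF // powR1 mul1r.
  by [].
Qed.

End CantorArcs.

(** * The Cantor measure is not a deficiency measure *)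

Section WeakLimit.
Variable R : realType.

Lemma expRN_left : expR (- e) @[e --> (0 : R)^'+] --> (1 : R)^'-.
Proof.
move=> A hA; have hA' : \forall x \near (1 : R), x < 1 -> A x by [].
have c : expR (- e) @[e --> (0 : R)] --> (1 : R).
  rewrite -[X in _ --> X](expR0 R) -[X in _ --> expR X]oppr0.
  exact: (dv_cont (dv_exp (dvN (dvid 0)))).
have h : \forall e \near (0 : R), expR (- e) < 1 -> A (expR (- e)) by exact: (c _ hA').
suff : \forall e \near (0 : R)^'+, A (expR (- e)) by [].
have h' : \forall e \near (0 : R)^'+, expR (- e) < 1 -> A (expR (- e)).
  exact: (@cvg_within _ (nbhs (0 : R)) _ (fun x => 0 < x) _ h).
apply: filterS2 h' (nbhs_right_gt 0) => e he e0.
by apply: he; rewrite expR_lt1; lra.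
Qed.

(** The integrals that define the deficiency measure, at r = exp (- e). *)
Lemma weak_limit (w phi : R * R -> R) (l : R) :
  Ck_on 2 disk w -> continuous phi ->
  circle_integral w phi r @[r --> 1^'-] --> l%:E ->
  xint (fun t => phi (polar 1 t) * j0 (jpolar w) t e) @[e --> 0^'+] --> l.
Proof.
move=> w2 cphi hl.
have h1 : circle_integral w phi (expR (- e)) @[e --> 0^'+] --> l%:E.
  exact: (cvg_comp _ _ expRN_left hl).
apply: cvg_trans (fine_cvg h1); apply: near_eq_cvg.
near=> e; have e0 : 0 < e by near: e; exact: nbhs_right_gt.
rewrite /= /xint /Rintegral /circle_integral.
by [].
Unshelve. all: by end_near.
Qed.

End WeakLimit.

Section Main.
Variables (R : realType) (m : R).
Hypothesis hm : 3 < m.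
Let alpha := (m - 3) / (m - 1).

Lemma alpha_bounds : [/\ 0 < alpha, alpha < 1 & 2 / (m - 1) = 1 - alpha].
Proof.
have m1 : 0 < m - 1 by have h := hm; lra.
have h := hm; rewrite /alpha; split.
- by rewrite divr_gt0 //; lra.
- by rewrite ltr_pdivrMr //; lra.
- by field; rewrite gt_eqF.
Qed.

Variables (n N M : nat -> nat).
Hypothesis hc : cantor alpha n N M.

Lemma n_ge k : (k < n k)%N.
Proof.
elim: k => [|k ih]; first by rewrite (c_n0 hc).
have [q -> hq] := c_n hc k.
apply: (@leq_trans (k.+1 * 2)); first by rewrite muln2 -addnn addnS ltnS leq_addr.
apply: leq_mul => //; apply: leq_trans hq.
by apply: (@leq_trans (100 * 1)) => //; rewrite leq_pmul2l // (M_gt0 hc).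
Qed.

(** The Poisson kernel as a function of the boundary point, extended to the plane
with a denominator that is bounded away from 0. *)
Definition pkern (y x : R) (z : R * R) : R :=
  sh2 y / (ch y - 1 + `|1 - (cos x * z.1 + sin x * z.2)|).

Lemma pkernE y x t : pkern y x (polar 1 t) = kern y x t.
Proof.
rewrite /pkern /kern /= !mul1r -cosB ger0_norm; last by rewrite subr_ge0 cos_le1.
by congr (_ / _); ring.
Qed.

Let pk1 (y s : R) : R := sh2 y / (ch y - 1 + `|1 - s|).

Lemma pk1_cont y : 0 < y -> y <= 1 -> continuous (pk1 y).
Proof.
move=> y0 y1 s; have c1 := ch_gt1 y0 y1.
apply: cvgM; first exact: cvg_cst.
apply: cvgV; first by rewrite gt_eqF // ltr_wpDr // subr_gt0.
apply: cvgD; first exact: cvg_cst.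
by apply: cvg_norm; apply: cvgB; [exact: cvg_cst | exact: cvg_id].
Qed.

Lemma pkern_cont y x : 0 < y -> y <= 1 -> continuous (pkern y x).
Proof.
move=> y0 y1 z.
have cL : (cos x * w.1 + sin x * w.2) @[w --> z] --> cos x * z.1 + sin x * z.2.
  by apply: cvgD; apply: cvgM; first [exact: cvg_cst | exact: cvg_fst | exact: cvg_snd].
exact: (cvg_comp _ _ cL (@pk1_cont y y0 y1 _)).
Qed.

Lemma pkern_meas y x : 0 < y -> y <= 1 -> measurable_fun setT (pkern y x).
Proof.
move=> y0 y1.
have mL : measurable_fun setT (fun z : R * R => cos x * z.1 + sin x * z.2).
  by apply: measurable_funD; apply: measurable_funM.
have mk : measurable_fun setT (pk1 y).
  by apply: continuous_measurable_fun; exact: pk1_cont.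
exact: (measurableT_comp mk mL).
Qed.

Lemma pkern_ge0 y x z : 0 < y -> y <= 1 / 2 -> 0 <= pkern y x z.
Proof.
move=> y0 y1; have /andP[s0 _] := sh2_bounds (ltW y0) y1.
apply: divr_ge0; first lra.
by apply: addr_ge0 => //; rewrite subr_ge0 ch_ge1.
Qed.

Lemma scale_identity (al y q a : R) : 0 < y -> 0 < q -> 0 < a ->
  y * q ^+ 2 = y `^ (- (1 - al)) * (y * q / a) `^ (2 - al) * (q `^ al * a `^ (2 - al)).
Proof.
move=> y0 q0 a0; have yq := mulr_gt0 y0 q0.
have e1 : (y * q / a) `^ (2 - al) * a `^ (2 - al) = y `^ (2 - al) * q `^ (2 - al).
  by rewrite -powRM ?divr_ge0 ?(ltW a0) ?(ltW yq) // divfK ?gt_eqF // powRM ?(ltW y0) ?(ltW q0).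
have e2 : q `^ (2 - al) * q `^ al = q ^+ 2.
  rewrite -powRD; last by apply/implyP => _; rewrite gt_eqF.
  by rewrite subrK powR_mulrn // ltW.
have e3 : y `^ (- (1 - al)) * y `^ (2 - al) = y.
  rewrite -powRD; last by apply/implyP => _; rewrite gt_eqF.
  by rewrite (_ : - _ + _ = 1) ?powRr1 ?(ltW y0) //; ring.
rewrite -{1}e3 -e2.
transitivity (y `^ (- (1 - al)) * ((y * q / a) `^ (2 - al) * a `^ (2 - al)) * q `^ al).
  by rewrite e1; ring.
by ring.
Qed.

(** With N comparable with n^alpha a^(2 - alpha), the quotient y n^2 / N is
y^(- kappa) times (y n / a)^(2 - alpha), and y n / a is bounded at the heights
of the stage. *)
Lemma scale_bound k y : 0 < y -> y <= 11 / 4 * (weight R k.+1 / (n k.+1)%:R) ->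
  y * (n k.+1)%:R ^+ 2 / (N k.+1)%:R <= 16 * y `^ (- (1 - alpha)).
Proof.
move=> y0 y1; have [al0 al1 _] := alpha_bounds.
have q0 := nR_gt0 hc k.+1; have a0 := weight_gt0 R k.+1.
have N0 : 0 < (N k.+1)%:R :> R by rewrite ltr0n (N_gt0 hc).
rewrite ler_pdivrMr // (scale_identity alpha y0 q0 a0) -[leLHS]mulrA.
have b1 : (y * (n k.+1)%:R / weight R k.+1) `^ (2 - alpha) <= 8.
  apply: (@le_trans _ _ ((11 / 4) `^ (2 - alpha))).
    apply: ge0_ler_powR; rewrite ?nnegrE; try lra.
      by rewrite divr_ge0 ?(ltW a0) // mulr_ge0 // ltW.
    by rewrite ler_pdivrMr // -ler_pdivlMr // -mulrA.
  apply: (@le_trans _ _ ((11 / 4) `^ 2%:R)).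
    by apply: ler_powR; lra.
  by rewrite powR_mulrn // expr2; lra.
have b2 := c_hi hc k.
have p0 := powR_ge0 y (- (1 - alpha)).
rewrite (_ : 16 * _ * _ = y `^ (- (1 - alpha)) * (8 * (2 * (N k.+1)%:R))); last by ring.
apply: ler_wpM2l => //.
by apply: ler_pM => //; rewrite ?mulr_ge0 ?powR_ge0.
Qed.

(** Letting e tend to 0 in [poisson_bound] replaces the boundary values of W by
the measure, so the Poisson integral of the Cantor measure bounds W, and
[kern_integral] with [scale_bound] supply the hypothesis of [stages_absurd] at
each level k >= 1. *)
Lemma not_deficiency : ~ Def m (cantor_law hc).
Proof.
move=> [U [u [hU [hu _] [_ hw]]]].
have [al0 al1 kap] := alpha_bounds.
set w := U \- u in hw.
have W2 : C2 0 (jpolar w) := diff_C2 hU hu.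
have Wp : periodic (jpolar w) by exact: periodic_pol.
have W0 := diff_ge0 hU hu; have L0 := diff_lap_ge0 hm hU hu.
have w2 : Ck_on 2 disk w.
  by apply: Ck_sub; [exact: disk_open | exact: hU.1.1 | exact: hu.1].
have wl phi (l : R) : continuous phi ->
    (\int[cantor_law hc]_(z in circle) (phi z)%:E = l%:E)%E ->
    xint (fun t => phi (polar 1 t) * j0 (jpolar w) t e) @[e --> 0^'+] --> l.
  move=> cphi hl; apply: weak_limit => //; rewrite -hl; apply: hw.
  exact: continuous_subspaceT.
have M1 : mass (jpolar w) y @[y --> 0^'+] --> (1 : R).
  have cc : continuous (cst 1 : R * R -> R) by move=> z; exact: cvg_cst.
  have e1 : (\int[cantor_law hc]_(z in circle) (cst 1 z)%:E = 1%:E)%E.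
    rewrite (cantor_law_integral hc (measurable_cst (1 : R)) (fun _ => ler01)).
    rewrite (_ : (fun t => _) = cst 1%:E) //.
    by rewrite integral_cst //= lebesgue_measure_itv /= lte_fin ltr01 mul1e sube0.
  have := wl _ _ cc e1; under eq_fun do under eq_fun do rewrite /= mul1r.
  exact.
have [CW CW0 hP] := poisson_bound W2 Wp W0 L0.
have [B B0 eB] : exists2 B : R, 0 < B & 150 ^+ 2 * 450 = B.
  by eexists; last reflexivity; apply: mulr_gt0; [apply: exprn_gt0 |]; exact: ltr0Sn.
pose K := 1 + 221 * (16 * B + CW).
have K1 : 1 <= K.
  rewrite /K lerDl; apply: mulr_ge0; first exact: ler0n.
  by apply: addr_ge0 => //; apply: mulr_ge0; [exact: ler0n | exact: ltW].
have c0 := decay_const_gt0 hm; have HL := diff_lap_lower hm hU hu; rewrite kap in HL.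
apply: (@stages_absurd _ _ _ _ W2 Wp W0 L0 c0 HL M1
  (fun k => n k.+1) (fun k => weight R k.+1) K).
- by move=> k; apply: ltnW; exact: n_ge.
- by move=> k; exact: weight_gt0.
- by move=> k; exact: weight_le.
- by move=> k; exact: (c_a hc).
- move=> A; have [q hq] := weight_dvg (A + 1).
  exists q; have := weight_le R 0; move: hq.
  have s0 := weight_gt0 R q.
  have : \sum_(k < q) weight R k <= \sum_(k < q.+1) weight R k by rewrite big_ord_recr /=; lra.
  have -> : \sum_(k < q.+1) weight R k = weight R 0 + \sum_(k < q) weight R k.+1.
    by rewrite big_ord_recl.
  lra.
- exact: K1.
- move=> k x y /andP[x0 x1] /andP[y0 y1] hx.
  have q0 := nR_gt0 hc k.+1; have a0 := weight_gt0 R k.+1.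
  have aq0 : 0 < weight R k.+1 / (n k.+1)%:R by exact: divr_gt0.
  have yp : 0 < y by lra.
  have aq1 : weight R k.+1 / (n k.+1)%:R <= 1 / 20.
    rewrite ler_pdivrMr //; apply: le_trans (weight_le R k.+1) _.
    by rewrite ler_peMr // ler1n (n_gt0 hc).
  have y4 : y <= 1 / 4 by lra.
  (* at both ends of the period cos (n x) = 1 *)
  have xin : 0 < x < 2 * pi.
    have c1 : cos ((n k.+1)%:R * 0) = 1 :> R by rewrite mulr0 cos0.
    have c2 : cos ((n k.+1)%:R * (2 * pi)) = 1 :> R.
      by rewrite -[X in cos X]add0r cos_period cos0.
    rewrite !lt_neqAle x0 x1 !andbT; apply/andP; split.
      by apply/eqP => e; move: hx; rewrite -e c1; lra.
    by apply/eqP => e; move: hx; rewrite e c2; lra.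
  have y12 : y <= 1 / 2 by lra.
  have yle1 : y <= 1 by lra.
  have iE : (\int[cantor_law hc]_(z in circle) (pkern y x z)%:E =
     \int[lebesgue_measure]_(t in `[0%R, 1%R]) (kern y x (cantor_fun n N M t))%:E)%E.
    rewrite cantor_law_integral; [|exact: pkern_meas | by move=> z; exact: pkern_ge0].
    by apply: eq_integral => t _; rewrite pkernE.
  have iB := kern_integral hc (introT andP (conj x0 x1)) hx yp y12.
  rewrite eB -iE in iB.
  set I := (\int[_]_(z in circle) _)%E in iB iE.
  have I0 : (0 <= I)%E.
    by apply: integral_ge0 => z _; rewrite lee_fin pkern_ge0.
  have If : I = (fine I)%:E.
    by rewrite fineK // ge0_fin_numE // (le_lt_trans iB) // ltry.
  have fB : fine I <= B * (16 * y `^ (- (1 - alpha))).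
    rewrite If lee_fin in iB; apply: le_trans iB _.
    by apply: ler_wpM2l; [exact: ltW | exact: scale_bound].
  have lim1 := wl _ _ (@pkern_cont y x yp yle1) If.
  have lim2 : j0 (jpolar w) x (y + e) @[e --> 0^'+] --> j0 (jpolar w) x y.
    have cw : jcont 0 (j0 (jpolar w)) := C2_c0 W2.
    have cy : (y + e) @[e --> (0 : R)^'+] --> y.
      rewrite -[X in _ --> X]addr0; apply: cvg_at_right_filter.
      by apply: cvgD; [exact: cvg_cst | exact: cvg_id].
    exact: (continuous2_cvg _ (cw x y yp) (cvg_cst _) cy).
  have lim3 : 221 * (xint (fun t => pkern y x (polar 1 t) * j0 (jpolar w) t e) + CW * y)
     @[e --> (0 : R)^'+] --> 221 * (fine I + CW * y).
    by apply: cvgM; [exact: cvg_cst | apply: cvgD; [exact: lim1 | exact: cvg_cst]].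
  have main : j0 (jpolar w) x y <= 221 * (fine I + CW * y).
    apply: (ler_cvg_to lim2 lim3); near=> e.
    have e0 : 0 < e by near: e; exact: nbhs_right_gt.
    have e1 : e <= 1 by near: e; apply: nbhs_right_le; exact: ltr01.
    have := hP x y e xin; rewrite yp y4 e0 e1 => /(_ isT isT) h.
    apply: le_trans h _.
    rewrite ler_pM2l ?ltr0n // lerD2r le_eqVlt; apply/orP; left; apply/eqP.
    congr xint; apply: funext => t; rewrite pkernE mulrC /kern.
    by rewrite -(cosN (t - x)) opprB.
  apply: le_trans main _.
  have p1 : 1 <= y `^ (- (1 - alpha)).
    rewrite powRN invf_ge1 ?powR_gt0 //.
    apply: (@le_trans _ _ (1 `^ (1 - alpha))); last by rewrite powR1.
    by apply: ge0_ler_powR; rewrite ?nnegrE //; lra.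
  have h1 : CW * y <= CW * y `^ (- (1 - alpha)) by apply: ler_wpM2l => //; lra.
  rewrite /K; move: fB h1 p1; move: (y `^ _) (fine I) (CW * y) => Y J Q fB h1 p1.
  have h2 : 221 * (J + Q) <= 221 * (B * (16 * Y) + CW * Y).
    by apply: ler_wpM2l; [exact: ler0n | exact: lerD].
  lra.
Unshelve. all: by end_near.
Qed.

End Main.

Theorem theorem1p2 (R : realType) (m alpha : R)
    (hm : 3 < m) (halpha : alpha = (m - 3) / (m - 1)) :
  ~ (BC_measures alpha `<=` Def m) /\
  exists (E : set (R * R)) (mu : probability (R * R)%type R),
    [/\ closed E, E `<=` circle, arc_length E = 0,
        carried_by mu E & nonatomic mu] /\
    (\esum_(J in complementary_arcs E) (arc_length J `^ alpha)%:E < +oo)%E /\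
    ~ Def m mu.
Proof.
have [al0 al1 _] := alpha_bounds hm; rewrite -halpha in al0 al1.
have [n [N [M hc]]] := cantor_exists al0 al1.
have sE := arcs_summable hc al0 al1.
rewrite halpha in hc.
have nD := @not_deficiency R m hm n N M hc.
have cE : closed (cantor_arc_set n N M : set (R * R)) by exact: (cantor_arc_set_closed hc).
have cC : (cantor_arc_set n N M : set (R * R)) `<=` circle by exact: cantor_arc_set_circle.
have lE := cantor_arc_set_length hc.
have mE : carried_by (cantor_law hc) (cantor_arc_set n N M) by apply: cantor_law_carried; exact: (cantor_point_in hc).
split; last first.
  exists (cantor_arc_set n N M), (cantor_law hc); split; last by [].
  by split => //; exact: cantor_law_nonatomic.
move=> sub; apply: nD; apply: sub; split.
  by apply: cantor_law_carried => tau; exact: polar1_circle.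
exists (fun=> cantor_arc_set n N M); split; first by move=> _; split.
by rewrite bigcup_const //; exists 0%N.
Qed.
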